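(* Let $H$ be a Hilbert space with norm $\|\cdot\|$, $n\ge1$, and let $X_1,\dots,X_n,Y_1,\dots,Y_n$ be independent symmetric random variables with logarithmically concave tails satisfying the normalization $\inf\{t\ge 0: N^X_i(t)\ge 1\}=\inf\{t\ge0: M^Y_j(t)\ge 1\}=1$ for all $i,j$. Let $(a_{ij})_{i,j\le n}$ be an $H$-valued matrix. Then for every $p\ge1$, \begin{align*} \Big\|\sum_{i,j}a_{ij}X_iY_j\Big\|_p\sim\ &\mathbb{E}\Big\|\sum_{i,j}a_{ij}X_iY_j\Big\|+\sup_{x\in B^X_p}\mathbb{E}\Big\|\sum_{i,j}a_{ij}x_iY_j\Big\|+\sup_{y\in B^Y_p}\mathbb{E}\Big\|\sum_{i,j}a_{ij}X_iy_j\Big\|\\ &+\sup_{f\in B^*(H)}\Big\|\Big(\sqrt{\textstyle\sum_jf(a_{ij})^2}\Big)_i\Big\|_{X,p}+\sup_{f\in B^*(H)}\big\|(f(a_{ij}))_{ij}\big\|_{X,Y,p}, \end{align*} where $a\sim b$ means $C^{-1}a\le b\le Ca$ for a universal constant $C$, and $\|Z\|_p=(\mathbb{E}\|Z\|^p)^{1/p}$.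
   Context: A random variable $Z$ has logarithmically concave tails if $t\mapsto -\ln\mathbb{P}(|Z|\ge t)\in[0,\infty]$ is convex on $[0,\infty)$. Set $N^X_i(t)=-\ln\mathbb{P}(|X_i|\ge t)$, $M^Y_j(t)=-\ln\mathbb{P}(|Y_j|\ge t)$, $\hat N^X_i(t)=t^2$ for $|t|\le1$ and $\hat N^X_i(t)=N^X_i(|t|)$ for $|t|>1$, and $\hat M^Y_j$ analogously. $B^X_p=\{x\in\mathbb{R}^n:\sum_i\hat N^X_i(x_i)\le p\}$, $B^Y_p=\{y\in\mathbb{R}^n:\sum_j\hat M^Y_j(y_j)\le p\}$. For real $(b_i)$, $\|(b_i)\|_{X,p}=\sup_{x\in B^X_p}\sum_ib_ix_i$; for a real matrix, $\|(b_{ij})\|_{X,Y,p}=\sup\{\sum_{ij}b_{ij}x_iy_j:x\in B^X_p,y\in B^Y_p\}$. $B^*(H)$ is the unit ball of the dual of $H$. *)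

(* Defs.v *)
From HB Require Import structures.
From mathcomp Require Import all_boot all_order all_algebra.
From mathcomp Require Import all_classical all_reals all_analysis.
Set Implicit Arguments. Unset Strict Implicit. Unset Printing Implicit Defensive.
Import Order.TTheory GRing.Theory Num.Theory.
Import numFieldNormedType.Exports.
Local Open Scope classical_set_scope.
Local Open Scope ring_scope.

Section Defs.
Context {R : realType}.

(* Real inner product inducing the norm of H (H complete => Hilbert space). *)
Definition inner_product (H : normedModType R) (ip : H -> H -> R) : Prop :=
  (forall x y, ip x y = ip y x) /\
  (forall (a : R) x y z, ip (a *: x + y) z = a * ip x z + ip y z) /\
  (forall x, `|x| = Num.sqrt (ip x x)).

Definition dual_ball (H : normedModType R) : set (H -> R) :=
  [set f | (forall (a : R) x y, f (a *: x + y) = a * f x + f y) /\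
           (forall x, `|f x| <= `|x|)].

Context {d : measure_display} {T : measurableType d} (P : probability T R).

Definition tailN (Z : T -> R) (t : R) : \bar R :=
  let q := P [set w | t <= `|Z w|] in
  if q == 0%E then +oo%E else (- ln (fine q))%:E.

Definition log_concave_tails (Z : T -> R) : Prop :=
  forall s t l : R, 0 <= s -> 0 <= t -> 0 <= l <= 1 ->
    (tailN Z (l * s + (1 - l) * t) <= l%:E * tailN Z s + (1 - l)%:E * tailN Z t)%E.

Definition tail_normalized (Z : T -> R) : Prop :=
  ereal_inf [set t%:E | t in [set t : R | 0 <= t /\ (1 <= tailN Z t)%E]] = 1%E.

Definition symmetric_rv (Z : T -> R) : Prop :=
  forall B : set R, measurable B ->
    P (Z @^-1` B) = P ((fun w => - Z w) @^-1` B).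

Definition mutually_independent (I : finType) (Z : I -> T -> R) : Prop :=
  forall B : I -> set R, (forall i, measurable (B i)) ->
    fine (P (\bigcap_(i in [set: I]) (Z i @^-1` B i))) =
    \prod_(i : I) fine (P (Z i @^-1` B i)).

Definition join_family n (X Y : 'I_n -> T -> R) : 'I_n + 'I_n -> T -> R :=
  fun k => match k with inl i => X i | inr j => Y j end.

Definition hatN (Z : T -> R) (t : R) : \bar R :=
  if `|t| <= 1 then (t ^+ 2)%:E else tailN Z `|t|.

Definition ballX n (X : 'I_n -> T -> R) (p : R) : set ('I_n -> R) :=
  [set x | (\sum_(i < n) hatN (X i) (x i) <= p%:E)%E].

Definition normXp n (X : 'I_n -> T -> R) (p : R) (b : 'I_n -> R) : \bar R :=
  ereal_sup [set (\sum_(i < n) b i * x i)%:E | x in ballX X p].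

Definition normXYp n (X Y : 'I_n -> T -> R) (p : R) (b : 'I_n -> 'I_n -> R)
  : \bar R :=
  ereal_sup [set r | exists x y, ballX X p x /\ ballX Y p y /\
     r = (\sum_(i < n) \sum_(j < n) b i j * x i * y j)%:E].

Definition expect_norm (H : normedModType R) (Z : T -> H) : \bar R :=
  (\int[P]_w (`|Z w|)%:E)%E.

Definition pnorm (H : normedModType R) (Z : T -> H) (p : R) : \bar R :=
  poweR (\int[P]_w (powR `|Z w| p)%:E)%E p^-1.

End Defs.

(* Main.v *)
(* After discretising the variables and choosing orthonormal coordinates, the chaos is an
   l2-valued bilinear form on a finite product space, so every supremum runs over finitely many
   real parameters and every expectation is a finite sum.

   Upper bound.  Conditionally on X, the moment of the linear form in Y is controlled by its
   Hilbert-Schmidt norm and by a supremum over the ball of Y and over functionals f.  The point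
   is to bound such a supremum for random coefficients without chaining: for each integer m there
   is a prior law on Y-points y and functionals f, built from the costs, such that every point of
   the ball is a mean of the prior tilted by a density D with E D^2 <= e^(C m).  The supremum over
   all tilts is absorbed in an m-th moment by Hoelder's inequality, and the fluctuation of the
   tilted prior around its mean is again a chaos with real coefficients, where only e^(C m)
   configurations of large coordinates matter.

   Lower bound.  Tilting the law of X or Y by a density D with E D^2 <= e^(C m) shifts its mean to
   x / 32 for any prescribed point x of the ball of radius m; Hoelder's inequality against the
   m-th moment of the chaos then bounds each of the deterministic terms.

   Both bounds are uniform in the discretisation and pass to the limit by Fatou and dominated
   convergence.  Finally the first moments in the theorem are compared with the Hilbert-Schmidt
   norms by Khintchine's inequality. *)
Require Import Defs.
From HB Require Import structures.
From mathcomp Require Import all_boot all_order all_algebra.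
From mathcomp Require Import all_classical all_reals all_analysis.
From mathcomp Require Import measurable_realfun ring lra zify.
Import Order.TTheory GRing.Theory Num.Theory.
Import numFieldNormedType.Exports.
Local Open Scope classical_set_scope.
Local Open Scope ring_scope.
Set Implicit Arguments. Unset Strict Implicit. Unset Printing Implicit Defensive.

(** * Finite product spaces *)

Section FiniteExpectation.
Context {R : realType}.

(** Tilting is affordable because exponents match: under a density with second moment [e^(C m)], a
    second moment is at most a constant, free of [m], times the squared [m]-th norm under the
    original law. Points of a ball of radius [m] are reached at that price because the prior gives a
    point of cost [N] a mass of about [e^(-N)] and costs add up over independent coordinates. A
    functional [f] has no cost of its own; it acquires one when each coordinate is written as the
    mean of [m] independent bounded variables.

    The obstacle is the fluctuation around the tilted mean, since it is paired with all points [x]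
    of the other ball. For [f] it has size [1 / sqrt m], which is exactly what Cauchy-Schwarz loses
    over that ball, so fourth moments suffice. For [y] there is no such gain: small and large
    coordinates have to be separated, and it is the term with [sqrt (sum_j f(a_ij)^2)] that limits
    the number of configurations of large coordinates. All these suprema are needed in second moment
    only, because the [m]-th moment has already been absorbed by the tilt. *)

Definition fE (Om : finType) (W F : Om -> R) : R := \sum_o W o * F o.

Definition fprob (Om : finType) (W : Om -> R) : Prop :=
  (forall o, 0 <= W o) /\ \sum_o W o = 1.

Definition pw (I V : finType) (w : I -> V -> R) (o : {ffun I -> V}) : R :=
  \prod_i w i (o i).

Section Basic.
Variables (Om : finType) (W : Om -> R).
Hypothesis Wp : fprob W.

Lemma eq_fE F G : (forall o, 0 < W o -> F o = G o) -> fE W F = fE W G.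
Proof.
case: Wp => W0 _ FG; apply: eq_bigr => o _.
by have := W0 o; rewrite le_eqVlt => /orP[/eqP<-|/FG->//]; rewrite !mul0r.
Qed.

Lemma fE_le F G : (forall o, 0 < W o -> F o <= G o) -> fE W F <= fE W G.
Proof.
case: Wp => W0 _ FG; apply: ler_sum => o _.
have := W0 o; rewrite le_eqVlt => /orP[/eqP<-|Wo]; first by rewrite !mul0r.
by rewrite ler_wpM2l ?FG // ltW.
Qed.

Lemma fE_cst c : fE W (fun=> c) = c.
Proof. by case: Wp => _ W1; rewrite /fE -mulr_suml W1 mul1r. Qed.

Lemma fE_ge0 F : (forall o, 0 < W o -> 0 <= F o) -> 0 <= fE W F.
Proof. by move=> F0; rewrite -(fE_cst 0); apply: fE_le. Qed.

Lemma fED F G : fE W (fun o => F o + G o) = fE W F + fE W G.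
Proof. by rewrite -big_split; apply: eq_bigr => o _; rewrite mulrDr. Qed.

Lemma fEZ c F : fE W (fun o => c * F o) = c * fE W F.
Proof. by rewrite mulr_sumr; apply: eq_bigr => o _; rewrite mulrCA. Qed.

Lemma fEZr c F : fE W (fun o => F o * c) = fE W F * c.
Proof. by rewrite mulr_suml; apply: eq_bigr => o _; rewrite mulrA. Qed.

Lemma fE_sum (J : finType) (P : pred J) (F : J -> Om -> R) :
  fE W (fun o => \sum_(j | P j) F j o) = \sum_(j | P j) fE W (F j).
Proof. by rewrite exchange_big; apply: eq_bigr => o _; rewrite mulr_sumr. Qed.

Lemma fE_lebound F c : (forall o, 0 < W o -> F o <= c) -> fE W F <= c.
Proof. by move=> Fc; rewrite -(fE_cst c); apply: fE_le. Qed.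

Lemma fE_norm F : `|fE W F| <= fE W (fun o => `|F o|).
Proof.
apply: le_trans (ler_norm_sum _ _ _) _; apply: ler_sum => o _.
by rewrite normrM ger0_norm //; case: Wp.
Qed.

End Basic.

Lemma fE_swap (O1 O2 : finType) (W1 : O1 -> R) (W2 : O2 -> R) F :
  fE W1 (fun x => fE W2 (F x)) = fE W2 (fun y => fE W1 (F^~ y)).
Proof.
rewrite /fE; under eq_bigr do rewrite mulr_sumr.
rewrite exchange_big; apply: eq_bigr => y _; rewrite mulr_sumr.
by apply: eq_bigr => x _; rewrite mulrCA.
Qed.

Lemma fE_tilt (Om : finType) (W D F : Om -> R) :
  fE (fun o => W o * D o) F = fE W (fun o => D o * F o).
Proof. by apply: eq_bigr => o _; rewrite mulrA. Qed.

Lemma fprob_tilt (Om : finType) (W D : Om -> R) : fprob W ->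
  (forall o, 0 <= D o) -> fE W D = 1 -> fprob (fun o => W o * D o).
Proof. by move=> [W0 _] D0 D1; split=> // o; rewrite mulr_ge0. Qed.

Section Product.
Variables (I V : finType) (w : I -> V -> R).
Hypothesis wp : forall i, fprob (w i).

Lemma fE_prod (g : I -> V -> R) :
  fE (pw w) (fun o => \prod_i g i (o i)) = \prod_i fE (w i) (g i).
Proof.
rewrite /fE bigA_distr_bigA; apply: eq_bigr => o _.
by rewrite /pw -big_split.
Qed.

Lemma fprob_pw : fprob (pw w).
Proof.
split=> [x|]; first by apply: prodr_ge0 => i _; case: (wp i).
transitivity (fE (pw w) (fun o => \prod_(i : I) 1)).
  by apply: eq_bigr => o _; rewrite big1 ?mulr1.
rewrite (fE_prod (fun _ _ => 1)); apply: big1 => i _; exact: fE_cst.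
Qed.

Lemma fE_coord i (g : V -> R) : fE (pw w) (fun o => g (o i)) = fE (w i) g.
Proof.
transitivity (fE (pw w) (fun o => \prod_k (if k == i then g else fun=> 1) (o k))).
  by apply: eq_bigr => o _; rewrite (bigD1 i) //= eqxx big1 ?mulr1 // => k /negPf->.
rewrite (fE_prod (fun k => if k == i then g else fun=> 1)) (bigD1 i) //= eqxx.
by rewrite big1 ?mulr1 // => k /negPf->; exact: fE_cst.
Qed.

Lemma pw_tilt (D : I -> V -> R) (o : {ffun I -> V}) :
  pw (fun i v => w i v * D i v) o = pw w o * \prod_i D i (o i).
Proof. by rewrite /pw -big_split. Qed.

Lemma fE_coord_tilt (D : I -> V -> R) i (g : V -> R) :
  (forall k, fE (w k) (D k) = 1) ->
  fE (pw w) (fun o => (\prod_k D k (o k)) * g (o i)) =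
  fE (w i) (fun v => D i v * g v).
Proof.
move=> D1.
transitivity (fE (pw w) (fun o => \prod_k (fun v => D k v * (if k == i then g v else 1)) (o k))).
  apply: eq_bigr => o _; congr (_ * _); rewrite big_split /=; congr (_ * _).
  by rewrite (bigD1 i) //= eqxx big1 ?mulr1 // => k /negPf->.
rewrite (fE_prod (fun k v => D k v * (if k == i then g v else 1))) (bigD1 i) //= eqxx.
rewrite [X in _ * X]big1 ?mulr1 // => k /negPf->.
by rewrite -[RHS](D1 k); apply: eq_bigr => v _; rewrite mulr1.
Qed.

End Product.

(** With [u = |F| / B], [u ^ 2 <= 1 + u ^ m] pointwise; this replaces Jensen's inequality and its
    roots at the price of the factor 2. *)
Lemma fE_sq_le (Om : finType) (W F : Om -> R) (m : nat) B : fprob W -> (2 <= m)%N ->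
  0 < B -> fE W (fun o => `|F o| ^+ m) <= B ^+ m ->
  fE W (fun o => F o ^+ 2) <= 2 * B ^+ 2.
Proof.
move=> Wp m2 B0 FB.
have key o : F o ^+ 2 <= B ^+ 2 + B ^+ 2 / B ^+ m * `|F o| ^+ m.
  have Bn0 : B != 0 by rewrite gt_eqF.
  rewrite -[F o ^+ 2]real_normK ?num_real //; set u := `|F o| / B.
  have u0 : 0 <= u by rewrite divr_ge0 // ltW.
  have -> : `|F o| = u * B by rewrite divfK.
  have -> : B ^+ 2 / B ^+ m * (u * B) ^+ m = B ^+ 2 * u ^+ m.
    by rewrite exprMn [u ^+ m * _]mulrC mulrA divfK ?expf_neq0.
  rewrite exprMn [X in X <= _]mulrC.
  rewrite -[X in _ <= X + _]mulr1 -mulrDr ler_wpM2l ?exprn_ge0 ?(ltW B0) //.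
  case: (leP u 1) => u1.
    by rewrite -[X in X <= _]addr0 lerD ?exprn_ile1 ?exprn_ge0.
  by rewrite -[X in X <= _]add0r lerD // ler_weXn2l // ltW.
apply: le_trans (fE_le Wp (fun o _ => key o)) _.
rewrite fED fE_cst // fEZ mulr2n mulrDl !mul1r lerD2l.
rewrite -[X in _ <= X](@divfK _ (B ^+ m)) ?expf_neq0 ?gt_eqF //.
by rewrite ler_wpM2l // divr_ge0 ?exprn_ge0 ?ltW.
Qed.

End FiniteExpectation.

(** * Costs, balls and moments of linear forms *)

Section Cost.
Context {R : realType}.

(* [hatN] with its effective domain: [cdom] stands for finiteness, and only the homogeneity
   [N (t x) <= |t| N x], which replaces convexity for [|t| <= 1], is retained. *)
Record cost := Cost {
  cval :> R -> R;
  cdom : R -> Prop;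
  cdomZ : forall t x, `|t| <= 1 -> cdom x -> cdom (t * x);
  cvalZ : forall t x, `|t| <= 1 -> cdom x -> cval (t * x) <= `|t| * cval x;
  cdom1 : forall x, `|x| <= 1 -> cdom x;
  cval1 : forall x, `|x| <= 1 -> cval x = x ^+ 2;
  cval_ge : forall x, 1 < `|x| -> cdom x -> `|x| <= cval x }.

Lemma cval_ge0 (N : cost) x : cdom N x -> 0 <= N x.
Proof.
move=> dx; case: (leP `|x| 1) => x1; first by rewrite cval1 // sqr_ge0.
by apply: le_trans (cval_ge x1 dx).
Qed.

Lemma abs_le_cval (N : cost) x : cdom N x -> `|x| <= 1 + N x.
Proof.
move=> dx; case: (leP `|x| 1) => x1; first by rewrite ler_wpDr ?cval_ge0.
by apply: le_trans (cval_ge x1 dx) _; rewrite ler_wpDl.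
Qed.

Lemma cval_norm (N : cost) x : cdom N x -> cdom N `|x| /\ N `|x| <= N x.
Proof.
move=> dx; case: (leP 0 x) => x0; first by rewrite ger0_norm.
rewrite ltr0_norm // -mulN1r; have n1 : `|(-1 : R)| <= 1 by rewrite normrN1.
by split; [exact: cdomZ|rewrite -[leRHS]mul1r -{2}(normrN1 R); exact: cvalZ].
Qed.

Definition ball (I : finType) (N : I -> cost) (p : R) (x : I -> R) : Prop :=
  (forall i, cdom (N i) (x i)) /\ \sum_i N i (x i) <= p.

Section Ball.
Variables (I : finType) (N : I -> cost).

Lemma ballM p x (t : I -> R) : (forall i, `|t i| <= 1) -> ball N p x ->
  ball N p (fun i => t i * x i).
Proof.
move=> t1 [dx xp]; split=> [i|]; first exact: cdomZ.
apply: le_trans xp; apply: ler_sum => i _.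
by apply: le_trans (cvalZ (t1 i) (dx i)) _; rewrite ler_piMl ?cval_ge0.
Qed.

(** Homogeneity divides every cost by [k]: a change of radius is paid by the same change of scale,
    which is how different exponents are compared later. *)
Lemma ball_scale k p x : 1 <= k -> ball N (k * p) x ->
  ball N p (fun i => k^-1 * x i).
Proof.
move=> k1 [dx xp]; have k0 : 0 < k by exact: lt_le_trans k1.
have nk : `|k^-1| <= 1 by rewrite ger0_norm ?invr_ge0 ?(ltW k0) // invf_le1.
split=> [i|]; first exact: cdomZ.
rewrite -(ler_pM2l k0); apply: le_trans xp; rewrite mulr_sumr; apply: ler_sum => i _.
apply: (@le_trans _ _ (k * (`|k^-1| * N i (x i)))).
  by rewrite ler_wpM2l ?cvalZ // ltW.
by rewrite ger0_norm ?invr_ge0 ?(ltW k0) // mulrA mulfV ?gt_eqF // mul1r.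
Qed.

Lemma ball_le p q x : p <= q -> ball N p x -> ball N q x.
Proof. by move=> pq [dx xp]; split=> //; exact: le_trans pq. Qed.

Lemma ball_small p x : (forall i, `|x i| <= 1) -> \sum_i x i ^+ 2 <= p -> ball N p x.
Proof.
move=> x1 xp; split=> [i|]; first exact: cdom1.
by under eq_bigr do rewrite cval1 //.
Qed.

Lemma ball_ge0 p x : ball N p x -> 0 <= p.
Proof. by move=> [dx]; apply: le_trans; apply: sumr_ge0 => i _; exact: cval_ge0. Qed.

Lemma ball_coord p x i : ball N p x -> N i (x i) <= p.
Proof.
move=> [dx]; apply: le_trans; rewrite (bigD1 i) //= ler_wpDr //.
by apply: sumr_ge0 => j _; exact: cval_ge0.
Qed.

Lemma ball_norm p x : ball N p x -> ball N p (fun i => `|x i|).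
Proof.
move=> [dx xp]; split=> [i|]; first by case: (cval_norm (dx i)).
by apply: le_trans xp; apply: ler_sum => i _; case: (cval_norm (dx i)).
Qed.

(** A large coordinate satisfies [|x i| <= N i (x i) <= p], so its square is at most [p] times its
    cost; the square of a small one is its cost. *)
Lemma ball_sqr p x : ball N p x -> \sum_i x i ^+ 2 <= p + p ^+ 2.
Proof.
move=> b; case: (b) => dx xp; have p0 := ball_ge0 b.
apply: (@le_trans _ _ (\sum_i (N i (x i) + N i (x i) * p))); last first.
  by rewrite big_split /= lerD // -mulr_suml expr2 ler_wpM2r.
apply: ler_sum => i _; have h0 := cval_ge0 (dx i).
case: (leP `|x i| 1) => x1; first by rewrite cval1 // lerDl mulr_ge0 // sqr_ge0.
apply: ler_wpDl => //; rewrite -real_normK ?num_real // expr2.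
apply: ler_pM => //; first exact: cval_ge.
by apply: le_trans (cval_ge x1 (dx i)) _; exact: ball_coord b.
Qed.

Lemma ball_small_part p x : ball N p x -> \sum_(i | `|x i| <= 1) x i ^+ 2 <= p.
Proof.
move=> [dx]; apply: le_trans; rewrite [leRHS](bigID (fun i => `|x i| <= 1)) /=.
rewrite ler_wpDr //; first by apply: sumr_ge0 => i _; exact: cval_ge0.
by apply: ler_sum => i xi; rewrite cval1.
Qed.

Lemma ball_large_part p x : ball N p x -> \sum_(i | ~~ (`|x i| <= 1)) `|x i| <= p.
Proof.
move=> [dx]; apply: le_trans; rewrite [leRHS](bigID (fun i => `|x i| <= 1)) /=.
rewrite ler_wpDl //; first by apply: sumr_ge0 => i _; exact: cval_ge0.
by apply: ler_sum => i; rewrite -ltNge => xi; exact: cval_ge.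
Qed.

End Ball.

(** The linear term is kept exact so that it disappears for a centered variable. *)
Lemma expR_le_quad (z : R) : expR z <= 1 + z + z ^+ 2 * expR `|z|.
Proof.
case: (leP 0 z) => z0.
  rewrite ger0_norm //; have e0 := expR_gt0 z.
  have : (1 - z) * expR z <= 1.
    have := expR_ge1Dx (- z); rewrite expRN => h.
    have : expR z * (expR z)^-1 = 1 by rewrite mulfV // gt_eqF.
    nra.
  case: (leP z 1) => z1; nra.
rewrite ltr0_norm //; set u := - z; have u0 : 0 < u by rewrite oppr_gt0.
have -> : z = - u by rewrite opprK.
rewrite expRN sqrrN.
have h := expR_ge1Dx u; have e0 := expR_gt0 u.
have : (expR u)^-1 <= (1 + u)^-1 by rewrite lef_pV2 ?posrE //; lra.
have ui : (1 + u)^-1 * (1 + u) = 1 by rewrite mulVf // gt_eqF //; lra.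
set v := (1 + u)^-1 in ui *.
have v0 : 0 < v by rewrite invr_gt0; lra.
have : v <= 1 - u + u ^+ 2 by nra.
nra.
Qed.

Lemma sqr_le_expR (u : R) : 0 <= u -> u ^+ 2 <= 2 * expR u.
Proof.
move=> u0; have -> : expR u = (expR (u / 4) ^+ 2) ^+ 2.
  by rewrite -exprM -expRM_natl; congr expR; field.
have h : u <= expR (u / 4) ^+ 2.
  by have := expR_ge1Dx (u / 4); have := sqr_ge0 (1 - u / 4); nra.
have := sqr_ge0 (expR (u / 4) ^+ 2 : R); nra.
Qed.

Lemma expR_half_le2 : expR (2^-1 : R) <= 2.
Proof.
have := expR_ge1Dx (- 2^-1 : R); rewrite expRN => h.
have e0 := expR_gt0 (2^-1 : R).
have : expR (2^-1 : R) * (expR 2^-1)^-1 = 1 by rewrite mulfV // gt_eqF.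
nra.
Qed.

(* The Laplace transform of [X / 16] is dominated by the Legendre transform of the cost; the
   constants 16 and 33 are those produced by [subN_intro]. *)
Definition subN (V : finType) (w X : V -> R) (N : cost) : Prop :=
  fprob w /\ forall s K, (forall t, cdom N t -> s * t - N t <= K) ->
    fE w (fun v => expR (s * X v / 16)) <= expR (33 * K).

Lemma subN_const0 (V : finType) (w X : V -> R) (N : cost) :
  fprob w -> (forall v, 0 < w v -> X v = 0) -> subN w X N.
Proof.
move=> wp X0; split=> // s K hK.
rewrite (eq_fE wp (G := fun=> 1)); last by move=> v /X0->; rewrite mulr0 mul0r expR0.
rewrite fE_cst // -[leLHS]expR0 ler_expR mulr_ge0 //.
have n0 : `|(0 : R)| <= 1 by rewrite normr0.
by have := hK 0 (cdom1 N n0); rewrite cval1 // mulr0 expr0n subr0.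
Qed.

(** [X] is centered, [U] is a nearby variable with an exponential moment. For [|s| >= 2] the test
    point [sg s] in the Legendre transform gives [|s| <= 1 + K], so the shift by [X - U] is absorbed
    in [K]. For [|s| < 2] the test point [s / 2] gives [s ^ 2 <= 4 K], and the second-order
    expansion yields [1 + 8 s ^ 2 <= 1 + 32 K <= expR (33 K)]. *)
Lemma subN_intro (V : finType) (w X U : V -> R) (N : cost) : fprob w ->
  fE w X = 0 -> (forall v, 0 < w v -> `|X v - U v| <= 1) ->
  (forall v, 0 < w v -> cdom N (U v)) ->
  fE w (fun v => expR (N (U v) / 2)) <= 8 -> subN w X N.
Proof.
move=> wp X0 XU dU E8; split=> // s K hK.
case: (leP 2 `|s|) => s2.
  have sg1 : `|Num.sg s| <= 1 by rewrite normr_sg; case: eqP.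
  have s0 : s != 0 by rewrite -normr_gt0; lra.
  have hs : `|s| <= 1 + K.
    have := hK _ (cdom1 N sg1); rewrite cval1 // mulrC -normrEsg -real_normK ?num_real //.
    by rewrite normr_sg s0 expr1n; lra.
  have K1 : 1 <= K by lra.
  apply: (@le_trans _ _ (fE w (fun v => expR (3 / 16 * K) * expR (N (U v) / 2)))).
    apply: fE_le => // v wv; rewrite -expRD ler_expR.
    have := hK _ (dU v wv); have h0 := cval_ge0 (dU v wv).
    have : s * (X v - U v) <= `|s|.
      apply: le_trans (ler_norm _) _; rewrite normrM ler_piMr //; exact: XU.
    lra.
  rewrite fEZ; apply: (@le_trans _ _ (expR (3 / 16 * K) * expR (8 * K))).
    rewrite ler_wpM2l ?expR_ge0 //; apply: le_trans E8 _.
    by have := expR_ge1Dx (8 * K); lra.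
  by rewrite -expRD ler_expR; lra.
have hs : s ^+ 2 <= 4 * K.
  have n1 : `|s / 2| <= 1 by rewrite normrM (ger0_norm (x := 2^-1)) //; lra.
  by have := hK _ (cdom1 N n1); rewrite cval1 //; lra.
apply: (@le_trans _ _ (fE w (fun v => 1 + X v * (s / 16) + s ^+ 2 * expR (N (U v) / 2)))).
  apply: fE_le => // v wv; apply: le_trans (expR_le_quad _) _.
  have -> : s * X v / 16 = X v * (s / 16) by ring.
  rewrite lerD2l; set z := X v * (s / 16); have h0 := cval_ge0 (dU v wv).
  have hX : `|X v| <= 2 + N (U v).
    have -> : X v = (X v - U v) + U v by rewrite subrK.
    apply: le_trans (ler_normD _ _) _.
    have := XU v wv; have := abs_le_cval (dU v wv); lra.
  set h := N (U v) in h0 hX *.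
  have zle : `|z| <= (2 + h) / 8.
    rewrite normrM normrM (ger0_norm (x := 16^-1)) //.
    have := normr_ge0 s; have := normr_ge0 (X v); nra.
  have z2 : z ^+ 2 <= s ^+ 2 * (((2 + h) / 8) ^+ 2 / 4).
    rewrite /z exprMn exprMn.
    have : X v ^+ 2 <= (2 + h) ^+ 2.
      by rewrite -real_normK ?num_real // ler_sqr ?nnegrE //; lra.
    have := sqr_ge0 s; nra.
  have q := sqr_le_expR (u := (2 + h) / 8) _.
  have {}q : ((2 + h) / 8) ^+ 2 <= 2 * expR ((2 + h) / 8) by apply: q; lra.
  have e1 : expR `|z| <= expR ((2 + h) / 8) by rewrite ler_expR.
  have e2 : expR ((2 + h) / 8) * expR ((2 + h) / 8) <= 2 * expR (h / 2).
    rewrite -expRD; apply: (@le_trans _ _ (expR (2^-1) * expR (h / 2))).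
      by rewrite -expRD ler_expR; lra.
    by rewrite ler_wpM2r ?expR_ge0 // expR_half_le2.
  apply: (@le_trans _ _ (s ^+ 2 * (expR ((2 + h) / 8) / 2) * expR ((2 + h) / 8))).
    apply: ler_pM => //; rewrite ?sqr_ge0 ?expR_ge0 //.
    apply: le_trans z2 _; rewrite ler_wpM2l ?sqr_ge0 //; lra.
  rewrite -mulrA ler_wpM2l ?sqr_ge0 //; lra.
rewrite fED fED fE_cst // fEZr X0 mul0r addr0 fEZ.
apply: (@le_trans _ _ (1 + 32 * K)).
  rewrite lerD2l; apply: (@le_trans _ _ (s ^+ 2 * 8)); last lra.
  by rewrite ler_wpM2l ?sqr_ge0.
have K0 : 0 <= K by have := sqr_ge0 s; lra.
by apply: le_trans (expR_ge1Dx _) _; rewrite ler_expR; lra.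
Qed.

(** [16] undoes the scale in [subN], [2] pays for the two exponentials that bound an absolute value,
    and [66] is the exponent of [subN_laplace]. *)
Definition cGK : R := 32 * expR 66.

Lemma cGK_ge1 : 1 <= cGK.
Proof. by rewrite /cGK; have := expR_ge1Dx (66 : R); lra. Qed.

Section LinearForm.
Variables (I V : finType) (w X : I -> V -> R) (N : I -> cost).
Hypothesis XN : forall i, subN (w i) (X i) (N i).

Let wp i : fprob (w i). Proof. by case: (XN i). Qed.

(** By independence only the sum of the coordinatewise Legendre transforms matters. These suprema
    need not be attained, so near-maximisers with total error at most [m] are taken; this doubles
    [33 m] to [66 m]. *)
Lemma subN_laplace (s : I -> R) (m : R) : 0 < m ->
  (forall x, (forall i, cdom (N i) (x i)) -> \sum_i (s i * x i - N i (x i)) <= m) ->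
  fE (pw w) (fun o => expR ((\sum_i s i * X i (o i)) / 16)) <= expR (66 * m).
Proof.
move=> m0 hs; pose eta := m / #|I|.+1%:R.
have eta0 : 0 < eta by rewrite divr_gt0.
have n0 : `|(0 : R)| <= 1 by rewrite normr0.
have near i : exists x, cdom (N i) x /\
    forall t, cdom (N i) t -> s i * t - N i t <= s i * x - N i x + eta.
  pose E := [set s i * t - N i t | t in cdom (N i)].
  have E0 : E !=set0 by exists (s i * 0 - N i 0), 0 => //; exact: cdom1.
  have Eb : has_ubound E.
    exists m => _ [t dt <-].
    have := hs (fun k => if k == i then t else 0).
    rewrite (bigD1 i) //= eqxx big1 => [|k /negPf->]; last first.
      by rewrite cval1 // mulr0 expr0n subr0.
    by rewrite addr0; apply => k; case: eqP => [->//|_]; exact: cdom1.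
  have [_ [x dx <-] xs] := sup_adherent eta0 (conj E0 Eb).
  exists x; split=> // t dt; have : s i * t - N i t <= sup E.
    by apply: sup_upper_bound => //; exists t.
  by move=> ?; lra.
have [x hx] := choice near.
rewrite (eq_fE (fprob_pw wp) (G := fun o => \prod_i (fun v => expR (s i * X i v / 16)) (o i))).
  rewrite (fE_prod w (fun i v => expR (s i * X i v / 16))).
  apply: (@le_trans _ _ (\prod_i expR (33 * (s i * x i - N i (x i) + eta)))).
    apply: ler_prod => i _; apply/andP; split.
      by apply: fE_ge0 => // v _; exact: expR_ge0.
    by case: (XN i) => _; apply; case: (hx i).
  rewrite -expR_sum ler_expR -mulr_sumr big_split /= sumr_const.
  have := hs x (fun i => (hx i).1).
  have : eta *+ #|I| <= m.
    by rewrite -mulr_natr /eta mulrAC ler_pdivrMr ?ltr0n // ler_wpM2l ?ltW // ltr_nat.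
  by move=> ? ?; lra.
by move=> o _; rewrite -expR_sum mulr_suml.
Qed.

(* With [lam = m / Rb], star-shapedness of the costs upgrades the bound on the ball to
   [lam * <b, x> - N(x) <= m] for all [x], so the Laplace transform is at most [e^(66 m)]. *)
Lemma linear_form_moment (m : nat) (b : I -> R) (Rb : R) : (0 < m)%N -> 0 <= Rb ->
  (forall x, ball N m%:R x -> \sum_i b i * x i <= Rb) ->
  fE (pw w) (fun o => `|\sum_i b i * X i (o i)| ^+ m) <= (cGK * Rb) ^+ m.
Proof.
move=> m0; rewrite le_eqVlt => /orP[/eqP<- hb|Rb0 hb].
  (* The sign of [b i], placed at the single coordinate [i], lies in the ball, so a vanishing
     supremum forces [b = 0]. *)
  have b0 i : b i = 0.
    have : `|b i| <= 0; last by rewrite normr_le0 => /eqP.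
    have := hb (fun k => if k == i then Num.sg (b i) else 0).
    rewrite (bigD1 i) //= eqxx big1 => [|k /negPf->]; last by rewrite mulr0.
    rewrite addr0 mulrC -normrEsg; apply; apply: ball_small => [k|].
      by case: eqP => _; rewrite ?normr0 // normr_sg; case: eqP.
    rewrite (bigD1 i) //= eqxx big1 => [|k /negPf->]; last by rewrite expr0n.
    rewrite addr0 -real_normK ?num_real // normr_sg.
    by apply: (@le_trans _ _ 1); [case: (b i != 0); rewrite ?expr1n ?expr0n|rewrite ler1n].
  rewrite mulr0 expr0n gtn_eqF // (eq_fE (fprob_pw wp) (G := fun=> 0)).
    by rewrite fE_cst //; exact: fprob_pw.
  by move=> o _; rewrite big1 ?normr0 ?expr0n ?gtn_eqF // => i _; rewrite b0 mul0r.
have mR : 0 < m%:R :> R by rewrite ltr0n.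
pose lam := m%:R / Rb; have lam0 : 0 < lam by rewrite divr_gt0.
have lap (e : R) : `|e| = 1 ->
    fE (pw w) (fun o => expR ((\sum_i e * lam * b i * X i (o i)) / 16)) <= expR (66 * m%:R).
  move=> e1; apply: subN_laplace => // x dx; rewrite big_split /= sumrN.
  have sc y : ball N m%:R y -> \sum_i e * lam * b i * y i <= m%:R.
    move=> By; have e1' : `|e| <= 1 by rewrite e1.
    have := hb (fun i => e * y i) (ballM (t := fun=> e) (fun=> e1') By).
    have -> : \sum_i e * lam * b i * y i = lam * \sum_i b i * (e * y i).
      by rewrite mulr_sumr; apply: eq_bigr => i _; ring.
    move=> h; rewrite /lam mulrAC ler_pdivrMr //.
    by rewrite ler_wpM2l // ltW.
  case: (leP (\sum_i N i (x i)) m%:R) => xm.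
    have := sc x (conj dx xm); have : 0 <= \sum_i N i (x i); last lra.
    by apply: sumr_ge0 => i _; exact: cval_ge0.
  set S := \sum_i N i (x i) in xm *; pose k := S / m%:R.
  have k1 : 1 <= k by rewrite ler_pdivlMr ?mul1r ?(ltW xm).
  have : ball N (k * m%:R) x by split=> //; rewrite divfK ?gt_eqF.
  move=> /(ball_scale k1) /sc.
  have -> : \sum_i e * lam * b i * (k^-1 * x i) = k^-1 * \sum_i e * lam * b i * x i.
    by rewrite mulr_sumr; apply: eq_bigr => i _; ring.
  have k0 : 0 < k by exact: lt_le_trans k1.
  rewrite mulrC ler_pdivrMr // [m%:R * k]mulrC divfK ?gt_eqF //.
  by rewrite -/S; lra.
apply: (@le_trans _ _ (fE (pw w) (fun o => (16 * Rb) ^+ m *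
   (expR ((\sum_i 1 * lam * b i * X i (o i)) / 16) +
    expR ((\sum_i (-1) * lam * b i * X i (o i)) / 16))))).
  apply: fE_le => [|o _]; first exact: fprob_pw.
  set z := \sum_i _.
  have -> : \sum_i 1 * lam * b i * X i (o i) = lam * z.
    by rewrite mulr_sumr; apply: eq_bigr => i _; rewrite mul1r mulrA.
  have -> : \sum_i (-1) * lam * b i * X i (o i) = - (lam * z).
    by rewrite mulr_sumr -sumrN; apply: eq_bigr => i _; rewrite mulN1r !mulNr mulrA.
  have t0 : 0 <= lam * `|z| / 16 / m%:R.
    by rewrite !mulr_ge0 ?invr_ge0 ?(ltW Rb0).
  (* From [u <= expR u] with [u = lam |z| / (16 m)], raised to the power [m]. *)
  have h : (lam * `|z| / 16 / m%:R) ^+ m <= expR (lam * `|z| / 16).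
    have -> : expR (lam * `|z| / 16) = expR (lam * `|z| / 16 / m%:R) ^+ m.
      by rewrite -expRM_natl [m%:R * _]mulrC divfK ?gt_eqF.
    apply: lerXn2r; rewrite ?nnegrE ?expR_ge0 //.
    by apply: le_trans (expR_ge1Dx _); rewrite lerDr ler01.
  have -> : `|z| = 16 * Rb * (lam * `|z| / 16 / m%:R).
    by rewrite /lam; field; rewrite ?gt_eqF.
  rewrite exprMn ler_wpM2l ?exprn_ge0 ?mulr_ge0 ?(ltW Rb0) //; apply: le_trans h _.
  case: (leP 0 z) => z0.
    by rewrite ger0_norm // lerDl expR_ge0.
  by rewrite ltr0_norm // mulrN mulNr lerDr expR_ge0.
rewrite fEZ fED.
have := lap 1; have := lap (-1); rewrite normrN normr1 => /(_ erefl) h1 /(_ erefl) h2.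
apply: (@le_trans _ _ ((16 * Rb) ^+ m * (2 * expR (66 * m%:R)))).
  by rewrite ler_wpM2l ?exprn_ge0 ?mulr_ge0 ?(ltW Rb0) //; lra.
have -> : (cGK * Rb) ^+ m = (16 * Rb) ^+ m * (2 ^+ m * expR (66 * m%:R)).
  by rewrite [66 * _]mulrC expRM_natl -!exprMn /cGK; congr (_ ^+ _); ring.
rewrite ler_wpM2l ?exprn_ge0 ?mulr_ge0 ?(ltW Rb0) // ler_wpM2r ?expR_ge0 //.
by case: m m0 {mR lam lam0 lap hb h1 h2} => // m _; rewrite exprS ler_peMr // exprn_ege1 // ler1n.
Qed.

End LinearForm.

End Cost.

(** * Suprema over tilts of a prior *)

Section Master.
Context {R : realType}.

Lemma root_exists (a : R) (m : nat) : 0 <= a -> (0 < m)%N ->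
  exists r, 0 <= r /\ r ^+ m = a.
Proof.
move=> a0 m0; exists (a `^ (m%:R^-1)); split; first exact: powR_ge0.
rewrite -powR_mulrn ?powR_ge0 // -powRrM mulVf ?powRr1 //.
by rewrite pnatr_eq0 -lt0n.
Qed.

Lemma sum_CauchySchwarz (I : finType) (P : pred I) (a b : I -> R) :
  (\sum_(i | P i) a i * b i) ^+ 2 <=
  (\sum_(i | P i) a i ^+ 2) * (\sum_(i | P i) b i ^+ 2).
Proof.
rewrite -subr_ge0.
have : 0 <= \sum_(i | P i) \sum_(j | P j) (a i * b j - a j * b i) ^+ 2.
  by apply: sumr_ge0 => i _; apply: sumr_ge0 => j _; rewrite sqr_ge0.
have -> : \sum_(i | P i) \sum_(j | P j) (a i * b j - a j * b i) ^+ 2 =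
  2 * ((\sum_(i | P i) a i ^+ 2) * (\sum_(i | P i) b i ^+ 2) -
       (\sum_(i | P i) a i * b i) ^+ 2).
  transitivity (\sum_(i | P i) \sum_(j | P j)
     (a i ^+ 2 * b j ^+ 2 + (b i ^+ 2 * a j ^+ 2 - 2 * ((a i * b i) * (a j * b j))))).
    by apply: eq_bigr => i _; apply: eq_bigr => j _; ring.
  have prodE (f g : I -> R) : \sum_(i | P i) \sum_(j | P j) f i * g j =
      (\sum_(i | P i) f i) * (\sum_(i | P i) g i).
    by rewrite mulr_suml; apply: eq_bigr => i _; rewrite mulr_sumr.
  rewrite (eq_bigr (fun i => \sum_(j | P j) a i ^+ 2 * b j ^+ 2 +
     (\sum_(j | P j) b i ^+ 2 * a j ^+ 2 - 2 * \sum_(j | P j) a i * b i * (a j * b j)))).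
    by rewrite big_split sumrB /= -mulr_sumr !prodE; ring.
  by move=> i _; rewrite big_split /= sumrB mulr_sumr.
by rewrite pmulr_rge0.
Qed.

(** Pointwise Hoelder inequality, one term for each regime: [Phi <= c]; [Phi > c] with
    [D <= Phi ^ (m - r)]; and [D] larger still, where [r <= m - r] lets one more factor [D] absorb
    [Phi ^ r]. *)
Lemma tilt_young (D Phi c : R) (m r : nat) : (r.*2 <= m)%N -> 1 <= c -> 0 <= D ->
  0 <= Phi ->
  D * Phi ^+ r <= c ^+ r * D + Phi ^+ m + c ^+ r.*2 * D ^+ 2 / c ^+ m.
Proof.
move=> rm c1 D0 Phi0; have c0 : 0 < c by exact: lt_le_trans c1.
have t1 : 0 <= c ^+ r * D by rewrite mulr_ge0 // exprn_ge0 // ltW.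
have t2 : 0 <= Phi ^+ m by rewrite exprn_ge0.
have t3 : 0 <= c ^+ r.*2 * D ^+ 2 / c ^+ m.
  by rewrite divr_ge0 ?mulr_ge0 ?sqr_ge0 // exprn_ge0 // ltW.
case: (leP Phi c) => Pc.
  have : Phi ^+ r <= c ^+ r by apply: lerXn2r => //; rewrite nnegrE // ltW.
  by move=> h; have : D * Phi ^+ r <= c ^+ r * D; [rewrite mulrC ler_wpM2r|lra].
have r_m : (r <= m)%N by apply: leq_trans rm; rewrite -addnn leq_addr.
case: (leP D (Phi ^+ (m - r))) => DP.
  have : D * Phi ^+ r <= Phi ^+ m; last lra.
  by rewrite -[in leRHS](subnK r_m) exprD ler_wpM2r ?exprn_ge0.
have : D * Phi ^+ r <= c ^+ r.*2 * D ^+ 2 / c ^+ m; last lra.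
rewrite expr2 mulrCA -mulrA ler_wpM2l // ler_pdivlMr ?exprn_gt0 //.
apply: (@le_trans _ _ (c ^+ r.*2 * Phi ^+ (m - r))); last first.
  by rewrite ler_wpM2l ?exprn_ge0 // ltW.
set s := Phi / c; have s1 : 1 <= s by rewrite ler_pdivlMr ?mul1r ?(ltW Pc).
have -> : Phi = c * s by rewrite /s mulrC divfK // gt_eqF.
have -> : (c * s) ^+ r * c ^+ m = c ^+ (r + m) * s ^+ r by rewrite exprMn exprD mulrAC.
have -> : c ^+ r.*2 * (c * s) ^+ (m - r) = c ^+ (r.*2 + (m - r)) * s ^+ (m - r).
  by rewrite exprMn exprD mulrA.
have -> : (r.*2 + (m - r) = r + m)%N by rewrite -addnn -addnA subnKC.
rewrite ler_wpM2l ?exprn_ge0 ?(ltW c0) // ler_weXn2l //.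
by rewrite leq_subRL // addnn.
Qed.

(** The resulting factor does not involve [m]: this is why densities of exponential size [c ^ m] are
    harmless against an [m]-th moment. *)
Lemma tilt_moment (Om : finType) (mu D Phi : Om -> R) (c al : R) (m r : nat) :
  fprob mu -> (0 < r)%N -> (r.*2 <= m)%N -> 1 <= c -> 0 < al ->
  (forall o, 0 <= D o) -> fE mu D = 1 -> fE mu (fun o => D o ^+ 2) <= c ^+ m ->
  (forall o, 0 <= Phi o) -> fE mu (fun o => Phi o ^+ m) <= al ^+ m ->
  fE mu (fun o => D o * Phi o ^+ r) <= 3 * c ^+ r.*2 * al ^+ r.
Proof.
move=> mup r0 rm c1 al0 D0 D1 D2 Phi0 Phim.
have c0 : 0 < c by exact: lt_le_trans c1.
rewrite -ler_pdivrMr ?exprn_gt0 // -fEZr.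
have cm : 0 < c ^+ m by rewrite exprn_gt0.
apply: (@le_trans _ _ (fE mu (fun o => c ^+ r * D o + (Phi o / al) ^+ m +
   c ^+ r.*2 / c ^+ m * D o ^+ 2))).
  apply: fE_le => // o _; rewrite -mulrA -exprVn -exprMn.
  have := @tilt_young (D o) (Phi o / al) c m r rm c1 (D0 o).
  rewrite mulrAC; apply; rewrite divr_ge0 // ltW //.
rewrite !fED !fEZ D1 mulr1.
have -> : fE mu (fun o => (Phi o / al) ^+ m) = fE mu (fun o => Phi o ^+ m) / al ^+ m.
  by rewrite -fEZr; apply: eq_fE => // o _; rewrite exprMn exprVn.
have h1 : c ^+ r <= c ^+ r.*2 by rewrite ler_weXn2l // -addnn leq_addr.
have h2 : fE mu (fun o => Phi o ^+ m) / al ^+ m <= c ^+ r.*2.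
  rewrite ler_pdivrMr ?exprn_gt0 //; apply: le_trans Phim _.
  by rewrite ler_peMl ?exprn_ge0 ?(ltW al0) // exprn_ege1.
have h3 : c ^+ r.*2 / c ^+ m * fE mu (fun o => D o ^+ 2) <= c ^+ r.*2.
  rewrite -mulrA ler_piMr ?exprn_ge0 ?(ltW c0) // mulrC ler_pdivrMr //.
  by rewrite mul1r.
lra.
Qed.

(* The supremum over all densities [D] is taken inside the [m]-th moment: Hoelder's
   inequality with the weight [Gam] separates [D] from the random variable [Psi x]. *)
Lemma sup_over_tilts (Om Om' : finType) (W : Om -> R) (mu : Om' -> R)
    (Psi : Om -> Om' -> R) (Gam : Om' -> R) (m : nat) :
  fprob W -> fprob mu -> (4 <= m)%N -> (forall o, 0 < Gam o) ->
  (forall o, fE W (fun x => `|Psi x o| ^+ m) <= Gam o ^+ m) ->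
  exists A : Om -> R, (forall x, 0 < A x) /\ fE W (fun x => A x ^+ m) <= 2 /\
    forall x D B c, (forall o, 0 <= D o) -> fE mu D = 1 -> 1 <= c ->
      fE mu (fun o => D o ^+ 2) <= c ^+ m -> 0 < B ->
      fE mu (fun o => D o * Gam o ^+ 2) <= B ^+ 2 ->
      `|fE mu (fun o => D o * Psi x o)| <= 2 * c ^+ 2 * B * A x.
Proof.
move=> Wp mup m4 Gam0 PsiGam.
pose Phi x o := `|Psi x o| / Gam o.
have Phi0 x o : 0 <= Phi x o by rewrite divr_ge0 // ltW.
have m0 : (0 < m)%N by lia.
have EPhi0 x : 0 <= fE mu (fun o => Phi x o ^+ m).
  by apply: fE_ge0 => // o _; rewrite exprn_ge0.
(* The added 1 keeps [A] positive. After exchanging the two expectations the other summand has mean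
   at most 1, hence the bound 2. *)
have /choice[A hA] x : exists r, 0 <= r /\ r ^+ m = fE mu (fun o => Phi x o ^+ m) + 1.
  by apply: root_exists => //; rewrite addr_ge0.
have A0 x : 0 < A x.
  have [Ax0 Axm] := hA x; rewrite lt_neqAle Ax0 andbT eq_sym.
  apply: contraTneq isT => Ax; move: Axm; rewrite Ax expr0n gtn_eqF // => /esym/eqP.
  by rewrite gt_eqF // ltr_wpDl.
exists A; split=> //; split.
  rewrite (eq_fE Wp (G := fun x => fE mu (fun o => Phi x o ^+ m) + 1)); last first.
    by move=> x _; case: (hA x).
  rewrite fED fE_cst // fE_swap -lerBrDr [2 - 1](_ : _ = 1); last by ring.
  apply: fE_lebound => // o _.
  rewrite (eq_fE Wp (G := fun x => `|Psi x o| ^+ m * (Gam o ^+ m)^-1)); last first.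
    by move=> x _; rewrite exprMn exprVn.
  by rewrite fEZr ler_pdivrMr ?exprn_gt0 // mul1r.
move=> x D B c D0 D1 c1 D2 B0 DG.
have c0 : 0 < c by exact: lt_le_trans c1.
have DPhi2 : fE mu (fun o => D o * Phi x o ^+ 2) <= 3 * c ^+ 4 * A x ^+ 2.
  apply: (@tilt_moment _ mu D (Phi x) c (A x) m 2) => //.
  by case: (hA x) => _ ->; rewrite ler_wpDr.
apply: le_trans (fE_norm mup _) _.
have AB : 0 < c ^+ 2 * A x by rewrite mulr_gt0 ?exprn_gt0.
set k := c ^+ 2 * A x in AB.
(* Arithmetic-geometric mean inequality with weights [k / B] and [B / k]; the two terms add up to
   [k B / 2 + 3 k B / 2 = 2 k B]. *)
apply: (@le_trans _ _ (fE mu (fun o => 2^-1 * (k / B) * (D o * Gam o ^+ 2) +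
   2^-1 * (B / k) * (D o * Phi x o ^+ 2)))).
  apply: fE_le => // o _.
  have -> : `|D o * Psi x o| = D o * (Gam o * Phi x o).
    by rewrite normrM (ger0_norm (D0 o)) /Phi [Gam o * _]mulrC divfK // gt_eqF.
  have -> : 2^-1 * (k / B) * (D o * Gam o ^+ 2) + 2^-1 * (B / k) * (D o * Phi x o ^+ 2)
    = D o * (2^-1 * (k / B * Gam o ^+ 2 + B / k * Phi x o ^+ 2)) by ring.
  rewrite ler_wpM2l // -subr_ge0.
  have -> : 2^-1 * (k / B * Gam o ^+ 2 + B / k * Phi x o ^+ 2) - Gam o * Phi x o =
    2^-1 * (k / B) * (Gam o - B / k * Phi x o) ^+ 2.
    by field; rewrite !gt_eqF.
  by rewrite mulr_ge0 ?sqr_ge0 // mulr_ge0 // divr_ge0 // ltW.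
rewrite fED !fEZ.
apply: (@le_trans _ _ (2^-1 * (k / B) * B ^+ 2 + 2^-1 * (B / k) * (3 * c ^+ 4 * A x ^+ 2))).
  by apply: lerD; rewrite ler_wpM2l // mulr_ge0 // divr_ge0 // ltW.
rewrite le_eqVlt; apply/orP; left; apply/eqP; rewrite /k; field.
by rewrite !gt_eqF.
Qed.

End Master.

(** * The one-dimensional prior built from a cost *)

Section Prior.
Context {R : realType}.

(** The supremum of a sublevel set of the cost need not be attained, so a point within a factor 2 of
    it is used. *)
Lemma level_exists (N : cost (R := R)) (k : nat) : exists t,
  [/\ 0 <= t, cdom N t, N t <= k.+1%:R &
      forall t', cdom N t' -> N t' <= k.+1%:R -> `|t'| <= 2 * t].
Proof.
pose E := [set t : R | [/\ 0 <= t, cdom N t & N t <= k.+1%:R]].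
have n1 : `|(1 : R)| <= 1 by rewrite normr1.
have E1 : E 1.
  by split=> //; [exact: cdom1|rewrite cval1 // expr1n ler1n].
have Eb : has_ubound E.
  exists k.+2%:R => t [t0 dt tk]; have := abs_le_cval dt; rewrite ger0_norm //.
  by move=> h; apply: le_trans h _; rewrite -addn1 natrD addrC lerD2r.
have supE1 : 1 <= sup E by apply: sup_upper_bound => //; split=> //; exists 1.
have [|t [t0 dt tk] ht] := @sup_adherent _ E (sup E / 2) _ (conj (ex_intro _ _ E1) Eb).
  by rewrite divr_gt0 //; lra.
exists t; split=> // t' dt' t'k; apply: (@le_trans _ _ (sup E)); last lra.
apply: sup_upper_bound; first by split=> //; exists 1.
have [d n] := cval_norm dt'; split=> //; exact: le_trans n _.
Qed.

(** Level 0 is the point 1, which serves coordinates with [|y| <= 1]; its cost is 1, hence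
    [maxn k 1] in [lev_cost]. *)
Definition lev (N : cost (R := R)) (k : nat) : R :=
  if k is k'.+1 then sval (cid (level_exists N k')) else 1.

Lemma lev_dom (N : cost (R := R)) k : cdom N (lev N k).
Proof.
by case: k => [|k] /=; [apply: cdom1; rewrite normr1|case: cid => t /= []].
Qed.

Lemma lev_cost (N : cost (R := R)) k : N (lev N k) <= (maxn k 1)%:R.
Proof.
case: k => [|k] /=; first by rewrite cval1 ?normr1 ?expr1n.
by case: cid => t /= [].
Qed.

Lemma lev_max (N : cost (R := R)) k t : (0 < k)%N -> cdom N t -> N t <= k%:R -> `|t| <= 2 * lev N k.
Proof. by case: k => // k _ dt tk; rewrite /=; case: cid => t' /= [_ _ _]; apply. Qed.

Lemma lev0 (N : cost (R := R)) : lev N 0 = 1. Proof. by []. Qed.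

Arguments lev : simpl never.

Lemma expR_neg1 : expR (- 1 : R) <= 2^-1.
Proof.
rewrite expRN lef_pV2 ?posrE ?expR_gt0 //.
by have := expR_ge1Dx (1 : R); lra.
Qed.

Lemma geometric_le (q : R) (n : nat) : 0 <= q < 1 -> \sum_(k < n) q ^+ k <= (1 - q)^-1.
Proof.
move=> /andP[q0 q1]; have q1' : 0 < 1 - q by lra.
rewrite -[leRHS]mul1r ler_pdivlMr //.
by have := subrX1 q n; have : 0 <= q ^+ n; [rewrite exprn_ge0|lra].
Qed.

Variable K : nat.

Definition prZ : R := \sum_(k < K.+1) expR (- k%:R).
(** The level has a truncated geometric law: the logarithm of its mass is minus its cost, up to a
    constant. The sign is uniform. *)
Definition pwt (v : bool * 'I_K.+1) : R := expR (- (v.2)%:R) / (2 * prZ).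
Definition bsgn (b : bool) : R := if b then 1 else -1.
Definition pval (N : cost (R := R)) (v : bool * 'I_K.+1) : R := bsgn v.1 * lev N v.2.

Lemma expR_neg_nat (x : R) (k : nat) : expR (- (k%:R * x)) = expR (- x) ^+ k.
Proof. by rewrite -mulrN expRM_natl. Qed.

Lemma prZ_ge1 : 1 <= prZ.
Proof.
rewrite /prZ big_ord_recl /= oppr0 expR0 lerDl; apply: sumr_ge0 => k _; exact: expR_ge0.
Qed.

Lemma prZ_le2 : prZ <= 2.
Proof.
rewrite /prZ (eq_bigr (fun k : 'I_K.+1 => expR (-1) ^+ k)); last first.
  by move=> k _; rewrite -expR_neg_nat mulr1.
have := expR_neg1; have := expR_gt0 (-1 : R) => q0 q1.
apply: le_trans (geometric_le _ _) _; first by rewrite ltW //=; lra.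
by rewrite invf_ple ?posrE //; lra.
Qed.

Lemma fE_pwt F : fE pwt F =
  \sum_(k < K.+1) expR (- k%:R) / prZ * ((F (true, k) + F (false, k)) / 2).
Proof.
rewrite /fE (eq_bigr (fun p => pwt (p.1, p.2) * F (p.1, p.2))); last by case.
rewrite -(pair_bigA _ (fun e k => pwt (e, k) * F (e, k))) /= exchange_big /=.
apply: eq_bigr => k _; rewrite big_bool /= /pwt /=; field.
by have := prZ_ge1; apply: contraTneq => ->; rewrite -ltNge.
Qed.

Lemma fprob_pwt : fprob pwt.
Proof.
have Z1 := prZ_ge1; split=> [v|].
  by rewrite divr_ge0 ?expR_ge0 // mulr_ge0 //; lra.
transitivity (fE pwt (fun=> 1)); first by apply: eq_bigr => v _; rewrite mulr1.
have half2 : (1 + 1) / 2 = 1 :> R by field.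
rewrite fE_pwt; under eq_bigr do rewrite half2 mulr1.
by rewrite -mulr_suml -/prZ mulfV // gt_eqF //; lra.
Qed.

Lemma pval_cost (N : cost (R := R)) v : cdom N (pval N v) /\ N (pval N v) <= (maxn v.2 1)%:R.
Proof.
have n1 : `|bsgn v.1| <= 1 by rewrite /bsgn; case: v.1; rewrite ?normrN1 ?normr1.
split; first exact: cdomZ (lev_dom _ _).
apply: le_trans (cvalZ n1 (lev_dom _ _)) _; apply: le_trans (lev_cost N v.2).
by rewrite ler_piMl // cval_ge0 //; exact: lev_dom.
Qed.

Lemma expR_neghalf : expR (- 2^-1 : R) <= 5 / 8.
Proof.
have -> : - 2^-1 = 4%:R * (- 8^-1) :> R by field.
rewrite expRM_natl expRN; set e := expR _; have e1 : 9 / 8 <= e.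
  by have := expR_ge1Dx (8^-1 : R); rewrite -/e; lra.
have e0 : 0 < e by lra.
have : e^-1 <= 8 / 9 by rewrite invf_ple ?posrE //; lra.
have : 0 < e^-1 by rewrite invr_gt0.
set u := e^-1 => u0 u1; have : u ^+ 2 <= (8 / 9) ^+ 2 by rewrite ler_sqr ?nnegrE //; lra.
have : 0 <= u ^+ 2 by rewrite sqr_ge0.
rewrite (_ : u ^+ 4 = (u ^+ 2) ^+ 2); last by rewrite -exprM.
set z := u ^+ 2; move=> z0 z1; nra.
Qed.

(** Level [k] contributes at most [3 expR (- k / 2)]. The factor [3 / 2] anticipates the largest
    value of the density that biases signs in [prior_tilt], so that the bound 8 survives the tilt
    and meets [subN_intro]. *)
Lemma pval_exp_moment (N : cost (R := R)) : fE pwt (fun v => 3 / 2 * expR (N (pval N v) / 2)) <= 8.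
Proof.
rewrite fE_pwt; have Z1 := prZ_ge1.
apply: (@le_trans _ _ (\sum_(k < K.+1) 3 * expR (- 2^-1) ^+ k)).
  apply: ler_sum => k _.
  have bd b : expR (N (pval N (b, k)) / 2) <= 2 * expR (k%:R / 2).
    apply: (@le_trans _ _ (expR (2^-1) * expR (k%:R / 2))); last first.
      by rewrite ler_wpM2r ?expR_ge0 // expR_half_le2.
    rewrite -expRD ler_expR (_ : 2^-1 + k%:R / 2 = (1 + k%:R) / 2 :> R); last by field.
    rewrite ler_wpM2r ?invr_ge0 //.
    have [_ /= h] := pval_cost N (b, k); apply: le_trans h _.
    by rewrite addrC natr1 ler_nat geq_max; lia.
  have -> : 3 * expR (- 2^-1) ^+ k = expR (- k%:R) * (3 * expR (k%:R / 2)) :> R.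
    rewrite -expR_neg_nat mulrCA -expRD; congr (_ * expR _); lra.
  have := bd true; have := bd false; have e0 := expR_gt0 (- k%:R : R) => h1 h2.
  apply: ler_pM => //; rewrite ?divr_ge0 ?addr_ge0 ?mulr_ge0 ?expR_ge0 //; try lra.
    by rewrite ler_pdivrMr ?ler_peMr ?expR_ge0 //; lra.
rewrite -mulr_sumr; have q := expR_neghalf; have q0 := expR_gt0 (- 2^-1 : R).
have := @geometric_le (expR (- 2^-1)) K.+1 _; set S := \sum_(k < _) _ => h.
have {h} : S <= (1 - expR (- 2^-1))^-1 by apply: h; rewrite ltW //=; lra.
have : (1 - expR (- 2^-1 : R))^-1 <= 8 / 3 by rewrite invf_ple ?posrE //; lra.
lra.
Qed.

(* Under the tilted law, [pval = sh + (pval - sh)]: [sh] is a point of the ball, and the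
   fluctuation [pval - sh] is centered with the same tails as before tilting. *)
Lemma prior_tilt (N : cost (R := R)) (y : R) : cdom N y -> N y < K%:R ->
  exists D sh : bool * 'I_K.+1 -> R,
    [/\ forall v, 0 <= D v, fE pwt D = 1,
        fE pwt (fun v => D v * pval N v) = y / 4 &
        fE pwt (fun v => D v ^+ 2) <= expR (4 * N y)] /\
    [/\ forall v, cdom N (sh v) /\ N (sh v) <= 2 * N y,
        `|y| <= 1 -> forall v, sh v = y / 4 &
        subN (fun v => pwt v * D v) (fun v => pval N v - sh v) N].
Proof.
move=> dy NyK; have Z1 := prZ_ge1; have Z2 := prZ_le2; have Zn0 : prZ != 0 by lra.
have Ny0 := cval_ge0 dy.
case: (leP `|y| 1) => y1.
  (* For [|y| <= 1] only the sign at level 0 is biased. That level has mass [1 / prZ] and values [1]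
     and [-1], so the bias [prZ / 4 * y] produces the mean [y / 4]. *)
  pose D (v : bool * 'I_K.+1) := 1 + bsgn v.1 * (prZ / 4 * y) * (v.2 == ord0)%:R.
  exists D, (fun=> y / 4).
  have absb : `|prZ / 4 * y| <= 2^-1.
    rewrite normrM ger0_norm; last by rewrite divr_ge0 //; lra.
    by have := normr_ge0 y; nra.
  have D_bd v : 2^-1 <= D v <= 3 / 2.
    move: absb; rewrite /D /bsgn ler_norml => /andP[h1 h2].
    by case: v.1; case: eqP => _; rewrite ?mulr1 ?mulr0 ?mul1r ?mulN1r; lra.
  have D0 v : 0 <= D v by case/andP: (D_bd v) => ? _; lra.
  have D1 : fE pwt D = 1.
    rewrite fE_pwt /D /bsgn /= -[RHS](fE_cst fprob_pwt) fE_pwt.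
    by apply: eq_bigr => k _; congr (_ * _); rewrite mul1r mulN1r mulNr; field.
  have Dp : fE pwt (fun v => D v * pval N v) = y / 4.
    rewrite fE_pwt big_ord_recl big1 /= ?addr0 => [|k _].
      by rewrite /D /pval /bsgn /= lev0 oppr0 expR0; field.
    by rewrite /D /pval /bsgn /=; field.
  split; first (split=> //).
    rewrite cval1 //; apply: (@le_trans _ _ (1 + y ^+ 2)); last first.
      by have := expR_ge1Dx (4 * y ^+ 2); have := sqr_ge0 y; lra.
    rewrite fE_pwt; apply: (@le_trans _ _
        (\sum_(k < K.+1) (expR (- k%:R) / prZ * 1 + (if k == ord0 then y ^+ 2 else 0)))).
      apply: ler_sum => k _; rewrite /D /bsgn /=; case: eqP => [->|_] /=.
        rewrite oppr0 expR0 -subr_ge0.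
        have -> : 1 / prZ * 1 + y ^+ 2 - 1 / prZ *
          (((1 + 1 * (prZ / 4 * y) * 1) ^+ 2 + (1 + -1 * (prZ / 4 * y) * 1) ^+ 2) / 2) =
          (1 - prZ / 16) * y ^+ 2 by field.
        by rewrite mulr_ge0 ?sqr_ge0 //; lra.
      by rewrite !mulr0 !addr0 expr1n (_ : (1 + 1) / 2 = 1 :> R) //; field.
    rewrite big_split /= -mulr_suml mulr1 -mulr_suml -/prZ mulfV // lerD2l.
    by rewrite -big_mkcond /= (big_pred1 ord0).
  split=> // [v|].
    have n4 : `|4^-1 : R| <= 1 by rewrite ger0_norm //; lra.
    rewrite mulrC; split; first exact: cdomZ.
    by apply: le_trans (cvalZ n4 dy) _; rewrite ger0_norm //; lra.
  have pD := fprob_tilt fprob_pwt D0 D1.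
  apply: (@subN_intro _ _ _ _ (pval N)) => // [|v _|v _|].
  - rewrite fE_tilt (eq_fE fprob_pwt (G := fun v => D v * pval N v + - (y / 4) * D v)).
      by rewrite fED fEZ Dp D1 mulr1 subrr.
    by move=> v _; ring.
  - rewrite addrAC subrr add0r normrN normrM (ger0_norm (x := 4^-1)); lra.
  - by case: (pval_cost N v).
  - rewrite fE_tilt; apply: le_trans (pval_exp_moment N).
    apply: fE_le => [|v _]; first exact: fprob_pwt.
    by rewrite ler_wpM2r ?expR_ge0 //; case/andP: (D_bd v).
have Ny1 : 1 <= N y by apply: le_trans (ltW y1) _; exact: cval_ge.
(* For large [y] the law is concentrated on the first integer level above [N y]; [N y < K]
   guarantees that this level exists. Since [1 <= N y], it costs at most [2 * N y]. The sign bias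
   [s = y / (4 t)] gives the mean [y / 4], and [lev_max] keeps it below [1 / 2]. *)
set k0 := (Num.truncn (N y)).+1.
have [tr1 tr2] : (k0%:R <= N y + 1) /\ N y < k0%:R.
  have := truncn_itv Ny0 => /andP[h1 h2]; split=> //.
  by rewrite /k0 -natr1 lerD2r.
have k0K : (k0 < K.+1)%N.
  rewrite ltnS /k0 -(ltr_nat R); apply: le_lt_trans NyK.
  by have := truncn_itv Ny0 => /andP[].
pose kk := Ordinal k0K; set t := lev N k0.
have yt : `|y| <= 2 * t by apply: lev_max => //; exact: ltW.
have t0 : 0 < t by lra.
pose s := y / (4 * t).
have s1 : `|s| <= 2^-1.
  rewrite normrM normfV (ger0_norm (x := 4 * t)); last by lra.
  by rewrite ler_pdivrMr; lra.
pose D (v : bool * 'I_K.+1) := (v.2 == kk)%:R * ((1 + bsgn v.1 * s) * (prZ * expR k0%:R)).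
have sb b : 2^-1 <= 1 + bsgn b * s <= 3 / 2.
  by move: s1; rewrite /bsgn ler_norml => /andP[? ?]; case: b; lra.
have D0 v : 0 <= D v.
  have /andP[? ?] := sb v.1; rewrite mulr_ge0 ?ler0n // mulr_ge0 //; first lra.
  by rewrite mulr_ge0 ?expR_ge0 //; lra.
have single F : fE pwt (fun v => (v.2 == kk)%:R * F v) =
    expR (- k0%:R) / prZ * ((F (true, kk) + F (false, kk)) / 2).
  rewrite fE_pwt (bigD1 kk) //= eqxx big1 => [|k /negPf->]; first by rewrite addr0 !mul1r.
  by rewrite !mul0r addr0 mul0r mulr0.
have ek : expR (- k0%:R) * expR k0%:R = 1 :> R by rewrite -expRD addNr expR0.
have D1 : fE pwt D = 1.
  rewrite single /bsgn /= -[RHS]ek; field; lra.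
(* Here [sh] is the whole variable: on the support of [D] the fluctuation vanishes. *)
exists D, (fun v => bsgn v.1 * t).
have Dp : fE pwt (fun v => D v * pval N v) = y / 4.
  rewrite (eq_fE fprob_pwt (G := fun v => (v.2 == kk)%:R *
    (((1 + bsgn v.1 * s) * (prZ * expR k0%:R)) * pval N v))); last first.
    by move=> v _; rewrite /D; ring.
  rewrite single /pval /bsgn /= -/t.
  transitivity (expR (- k0%:R) * expR k0%:R * (y / 4)); last by rewrite ek mul1r.
  by rewrite /s; field; lra.
have n1 b : `|bsgn b| <= 1 by rewrite /bsgn; case: b; rewrite ?normrN1 ?normr1.
split; first (split=> //).
  rewrite (eq_fE fprob_pwt (G := fun v => (v.2 == kk)%:R *
    ((1 + bsgn v.1 * s) * (prZ * expR k0%:R)) ^+ 2)); last first.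
    by move=> v _; rewrite /D exprMn; case: eqP => _; rewrite ?expr1n ?expr0n.
  rewrite single /bsgn /=.
  have -> : expR (- k0%:R) / prZ * ((((1 + 1 * s) * (prZ * expR k0%:R)) ^+ 2 +
     ((1 + -1 * s) * (prZ * expR k0%:R)) ^+ 2) / 2) =
     (expR (- k0%:R) * expR k0%:R) * (prZ * (1 + s ^+ 2)) * expR k0%:R by field; lra.
  rewrite ek mul1r; apply: (@le_trans _ _ (4 * expR (2 * N y))).
    have e1 : expR k0%:R <= expR (2 * N y) by rewrite ler_expR; lra.
    have s2 : s ^+ 2 <= 1.
      by rewrite -real_normK ?num_real //; have := normr_ge0 s; nra.
    apply: ler_pM; rewrite ?mulr_ge0 ?expR_ge0 ?addr_ge0 ?sqr_ge0 //; first by lra.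
    by have := sqr_ge0 s; nra.
  have -> : expR (4 * N y) = expR (2 * N y) * expR (2 * N y) by rewrite -expRD; congr expR; ring.
  rewrite ler_wpM2r ?expR_ge0 //.
  have -> : expR (2 * N y) = expR (N y) ^+ 2 by rewrite -expRM_natl.
  by have := expR_ge1Dx (N y); nra.
split=> [v|y1'|].
- split; first exact: cdomZ (lev_dom _ _).
  apply: le_trans (cvalZ (n1 _) (lev_dom _ _)) _.
  apply: (@le_trans _ _ (N t)); first by rewrite ler_piMl // cval_ge0 //; exact: lev_dom.
  apply: le_trans (lev_cost N k0) _.
  have -> : maxn k0 1 = k0 by apply/maxn_idPl.
  lra.
- by [].
apply: subN_const0; first exact: fprob_tilt fprob_pwt D0 D1.
move=> v; rewrite /D; case: (v.2 =P kk) => [vk _|_].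
  by rewrite /pval vk subrr.
by rewrite mul0r mulr0 ltxx.
Qed.

End Prior.

(** * Fluctuations paired with a ball *)

Section Noise.
Context {R : realType}.
Local Notation cost := (cost (R := R)).

Definition l2 (I : finType) (u : I -> R) : R := Num.sqrt (\sum_i u i ^+ 2).

Lemma sum_sqr_ge0 (I : finType) (u : I -> R) : 0 <= \sum_i u i ^+ 2.
Proof. by apply: sumr_ge0 => i _; rewrite sqr_ge0. Qed.

Lemma l2_ge0 (I : finType) (u : I -> R) : 0 <= l2 u.
Proof. exact: sqrtr_ge0. Qed.

Lemma l2_sqr (I : finType) (u : I -> R) : l2 u ^+ 2 = \sum_i u i ^+ 2.
Proof. by rewrite sqr_sqrtr // sum_sqr_ge0. Qed.

Lemma ler_sqr_norm (a b : R) : 0 <= b -> a ^+ 2 <= b ^+ 2 -> `|a| <= b.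
Proof. by move=> b0 ab; rewrite -ler_sqr ?nnegrE // real_normK ?num_real. Qed.

Lemma l2_dot (I : finType) (u v : I -> R) : `|\sum_i u i * v i| <= l2 u * l2 v.
Proof.
apply: ler_sqr_norm; first by rewrite mulr_ge0 ?l2_ge0.
by rewrite exprMn !l2_sqr sum_CauchySchwarz.
Qed.

Lemma l2_dual (I : finType) (u : I -> R) (c : R) : 0 <= c ->
  (forall f, \sum_i f i ^+ 2 <= 1 -> `|\sum_i f i * u i| <= c) -> l2 u <= c.
Proof.
move=> c0 h; have := l2_ge0 u; rewrite le_eqVlt => /orP[/eqP<-//|u0].
have un0 : l2 u != 0 by rewrite gt_eqF.
have := h (fun i => u i / l2 u).
have -> : \sum_i (u i / l2 u) ^+ 2 = 1.
  under eq_bigr do rewrite exprMn; rewrite -mulr_suml -l2_sqr exprVn mulfV //.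
  by rewrite expf_neq0.
have -> : \sum_i u i / l2 u * u i = l2 u.
  under eq_bigr do rewrite mulrAC -expr2; rewrite -mulr_suml -l2_sqr expr2.
  by rewrite mulfK.
by rewrite ger0_norm ?l2_ge0 //; apply.
Qed.

Lemma fE_sqr_sum (I V : finType) (w X : I -> V -> R) (c : I -> R) :
  (forall i, fprob (w i)) -> (forall i, fE (w i) (X i) = 0) ->
  fE (pw w) (fun o => (\sum_i c i * X i (o i)) ^+ 2) =
  \sum_i c i ^+ 2 * fE (w i) (fun v => X i v ^+ 2).
Proof.
move=> wp X0.
rewrite (eq_fE (fprob_pw wp) (G := fun o => \sum_i \sum_j c i * c j * (X i (o i) * X j (o j)))).
  rewrite fE_sum; apply: eq_bigr => i _; rewrite fE_sum (bigD1 i) //= fEZ.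
  have -> : fE (pw w) (fun o => X i (o i) * X i (o i)) = fE (w i) (fun v => X i v ^+ 2).
    by rewrite -(fE_coord wp).
  rewrite -expr2 big1 ?addr0 // => j ji; rewrite fEZ.
  rewrite (eq_fE (fprob_pw wp) (G := fun o =>
     \prod_k (if k == i then X i else if k == j then X j else fun=> 1) (o k))).
    rewrite (fE_prod w (fun k => if k == i then X i else if k == j then X j else fun=> 1)).
    by rewrite (bigD1 i) //= eqxx X0 mul0r mulr0.
  move=> o _; rewrite (bigD1 i) //= eqxx (bigD1 j) //= (negPf ji) eqxx big1 ?mulr1 //.
  by move=> k /andP[/negPf-> /negPf->].
move=> o _; rewrite expr2 mulr_suml; apply: eq_bigr => i _; rewrite mulr_sumr.
by apply: eq_bigr => j _; ring.
Qed.

(** The left side is the mean of the hypothesis over independent random signs. Balls are stable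
    under sign changes, so a bound over a ball becomes a bound on a weighted Hilbert-Schmidt
    norm. *)
Lemma sign_average (I : finType) (K : finType) (v : I -> K -> R) (c : R) :
  (forall s : I -> R, (forall i, `|s i| <= 1) ->
     \sum_k (\sum_i s i * v i k) ^+ 2 <= c) ->
  \sum_k \sum_i v i k ^+ 2 <= c.
Proof.
move=> h; pose w (i : I) (b : bool) : R := 2^-1; pose X (i : I) (b : bool) : R := bsgn b.
have wp i : fprob (w i) by split=> [b|]; rewrite /w ?invr_ge0 // big_bool /=; field.
have X0 i : fE (w i) (X i) = 0 by rewrite /fE big_bool /= /w /X /bsgn; field.
have X2 i : fE (w i) (fun b => X i b ^+ 2) = 1 by rewrite /fE big_bool /= /w /X /bsgn; field.
have -> : \sum_k \sum_i v i k ^+ 2 =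
    fE (pw w) (fun o => \sum_k (\sum_i v i k * X i (o i)) ^+ 2).
  rewrite fE_sum; apply: eq_bigr => k _; rewrite fE_sqr_sum //.
  by apply: eq_bigr => i _; rewrite X2 mulr1.
apply: fE_lebound => [|o _]; first exact: fprob_pw.
have := h (fun i => X i (o i)).
under eq_bigr do under eq_bigr do rewrite mulrC; apply=> i.
by rewrite /X /bsgn; case: (o i); rewrite ?normrN1 ?normr1.
Qed.

(** By [ball_sqr] the ball of radius [p] has Euclidean radius at most [2 p]. The lemma is applied
    with [p] equal to 2, 4 or 8 only, where a factor linear in [p] is harmless. *)
Lemma linear_form_moment_l2 (I V : finType) (w X : I -> V -> R) (N : I -> cost)
    (b : I -> R) (s : R) (p : nat) :
  (forall i, subN (w i) (X i) (N i)) -> (0 < p)%N -> 0 <= s ->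
  \sum_i b i ^+ 2 <= s ^+ 2 ->
  fE (pw w) (fun o => `|\sum_i b i * X i (o i)| ^+ p) <= (cGK * (s * (2 * p%:R))) ^+ p.
Proof.
move=> XN p0 s0 bs; apply: (linear_form_moment XN p0); first by rewrite mulr_ge0 ?mulr_ge0.
move=> x /ball_sqr hx; apply: le_trans (ler_norm _) _; apply: ler_sqr_norm.
  by rewrite mulr_ge0 ?mulr_ge0.
apply: le_trans (sum_CauchySchwarz _ _ _) _; rewrite exprMn.
apply: ler_pM; rewrite ?sum_sqr_ge0 //; apply: le_trans hx _.
have : 1 <= p%:R :> R by rewrite ler1n.
by nra.
Qed.

(* Splitting [x] at 1 and [r * xi] at the level [M / sqrt m] removes any loss in the
   number of large coordinates of [x]. *)
Lemma weighted_ball_bound (I : finType) (N : I -> cost) (m : nat) (x r xi : I -> R) (M : R) :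
  (0 < m)%N -> ball N m%:R x -> 0 < M -> \sum_i (x i * r i) ^+ 2 <= M ^+ 2 ->
  `|\sum_i x i * (r i * xi i)| <= Num.sqrt m%:R *
    (l2 (fun i => r i * xi i) + M + l2 (fun i => r i * xi i ^+ 2)).
Proof.
move=> m0 bx M0 xr; have mR : 0 < m%:R :> R by rewrite ltr0n.
set q := Num.sqrt m%:R; have q0 : 0 < q by rewrite sqrtr_gt0.
have q2 : q ^+ 2 = m%:R by rewrite sqr_sqrtr // ltW.
apply: le_trans (ler_norm_sum _ _ _) _.
rewrite (bigID (fun i => `|x i| <= 1)) /= -addrA mulrDr; apply: lerD.
  apply: (@le_trans _ _ `|\sum_(i | `|x i| <= 1) `|x i| * `|r i * xi i| |).
    by rewrite ler_normr; apply/orP; left; apply: ler_sum => i _; rewrite normrM.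
  apply: ler_sqr_norm; first by rewrite mulr_ge0 ?l2_ge0 // ltW.
  apply: le_trans (sum_CauchySchwarz _ _ _) _; rewrite exprMn l2_sqr q2.
  apply: ler_pM; try by apply: sumr_ge0 => i _; rewrite sqr_ge0.
    by under eq_bigr do rewrite real_normK ?num_real //; exact: ball_small_part bx.
  under eq_bigr do rewrite real_normK ?num_real //.
  by rewrite [leRHS](bigID (fun i => `|x i| <= 1)) /= lerDl sumr_ge0 // => i _; rewrite sqr_ge0.
(* For large coordinates [|r xi| <= T + (r xi) ^ 2 / T]. The first part is summed with total weight
   at most [m], and [m T = sqrt m * M]; the second goes to Cauchy-Schwarz. *)
set T := M / q; have T0 : 0 < T by rewrite divr_gt0.
apply: (@le_trans _ _ (\sum_(i | ~~ (`|x i| <= 1)) (`|x i| * T + `|x i * r i| * `|r i * xi i ^+ 2| / T))).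
  apply: ler_sum => i _; rewrite [`|r i * xi i ^+ 2|]normrM normrX 3!normrM -!mulrA -mulrDr ler_wpM2l //.
  set a := `|r i|; set b := `|xi i|.
  rewrite -subr_ge0.
  have -> : T + a * (a * (b * (b / T))) - a * b = ((a * b - T / 2) ^+ 2 + 3 / 4 * T ^+ 2) / T.
    by field; rewrite gt_eqF.
  apply: divr_ge0; last exact: ltW.
  by apply: addr_ge0; [exact: sqr_ge0|apply: mulr_ge0; [lra|exact: sqr_ge0]].
rewrite big_split /= -!mulr_suml mulrDr; apply: lerD.
  have -> : q * M = m%:R * T by rewrite /T -q2; field; rewrite gt_eqF.
  by rewrite ler_wpM2r ?(ltW T0) //; exact: ball_large_part bx.
rewrite ler_pdivrMr // /T [q * _]mulrC -mulrA [q * _]mulrC divfK ?gt_eqF //.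
apply: (@le_trans _ _ `|\sum_(i | ~~ (`|x i| <= 1)) `|x i * r i| * `|r i * xi i ^+ 2| |).
  exact: ler_norm.
apply: ler_sqr_norm; first by rewrite mulr_ge0 ?l2_ge0 // ltW.
apply: le_trans (sum_CauchySchwarz _ _ _) _; rewrite exprMn l2_sqr [leRHS]mulrC.
have part (u : I -> R) : \sum_(i | ~~ (`|x i| <= 1)) `|u i| ^+ 2 <= \sum_i u i ^+ 2.
  rewrite [leRHS](bigID (fun i => `|x i| <= 1)) /= ler_wpDl //.
    by rewrite sumr_ge0 // => i _; rewrite sqr_ge0.
  by apply: ler_sum => i _; rewrite real_normK ?num_real.
apply: ler_pM; try by apply: sumr_ge0 => i _; rewrite sqr_ge0.
  by apply: le_trans xr; exact: part.
exact: (part (fun i => r i * xi i ^+ 2)).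
Qed.

(** The [zeta i] have size [r i / sqrt m], which cancels the factor [sqrt m] of
    [weighted_ball_bound]. Fourth moments are required because that bound contains [r * xi ^ 2], to
    be squared once more. *)
Lemma noise_bound (Om I : finType) (P : Om -> R) (zeta : I -> Om -> R) (r : I -> R)
    (N : I -> cost) (m : nat) (M k : R) :
  fprob P -> (0 < m)%N -> 0 < M -> 1 <= k -> (forall i, 0 <= r i) ->
  \sum_i r i ^+ 2 <= M ^+ 2 ->
  (forall i, fE P (fun o => zeta i o ^+ 4) <= k * (r i ^+ 4 / m%:R ^+ 2)) ->
  exists G : Om -> R, [/\ forall o, 0 <= G o, fE P (fun o => G o ^+ 2) <= 12 * k * M ^+ 2 &
    forall o x, 0 < P o -> ball N m%:R x -> \sum_i (x i * r i) ^+ 2 <= M ^+ 2 ->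
      `|\sum_i x i * zeta i o| <= G o].
Proof.
move=> Pp m0 M0 k1 r0 rM zr; have mR : 0 < m%:R :> R by rewrite ltr0n.
pose q : R := Num.sqrt m%:R; have q0 : 0 < q by rewrite sqrtr_gt0.
have q2 : q ^+ 2 = m%:R by rewrite sqr_sqrtr // ltW.
(* Where [r i = 0] the quotient is 0 by convention, and the fourth moment bound forces [zeta i] to
   vanish on the support of [P]. *)
pose xi o i := q * zeta i o / r i.
have z_xi o i : 0 < P o -> zeta i o = q^-1 * (r i * xi o i).
  move=> Po; have := r0 i; rewrite le_eqVlt => /orP[/eqP ri|ri].
    have z4 : fE P (fun o => zeta i o ^+ 4) <= 0.
      by apply: le_trans (zr i) _; rewrite -ri expr0n /= mul0r mulr0.
    have : P o * zeta i o ^+ 4 <= 0.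
      apply: le_trans z4; rewrite /fE (bigD1 o) //= lerDl; apply: sumr_ge0 => o' _.
      by case: Pp => P0 _; rewrite mulr_ge0 // -[4%N]/(2 * 2)%N exprM sqr_ge0.
    rewrite pmulr_rle0 // => z0; have : zeta i o ^+ 4 == 0.
      by rewrite eq_le z0 -[4%N]/(2 * 2)%N exprM sqr_ge0.
    by rewrite expf_eq0 /= => /eqP zz; rewrite /xi zz mulr0 mul0r !mulr0.
  by rewrite /xi; field; rewrite !gt_eqF.
have xi4 i : fE P (fun o => r i ^+ 2 * xi o i ^+ 4) <= k * r i ^+ 2.
  have := r0 i; rewrite le_eqVlt => /orP[/eqP ri|ri].
    rewrite -ri expr0n /= mulr0 (eq_fE Pp (G := fun=> 0)) ?fE_cst // => o _.
    by rewrite mul0r.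
  rewrite (eq_fE Pp (G := fun o => m%:R ^+ 2 / r i ^+ 2 * zeta i o ^+ 4)); last first.
    by move=> o _; rewrite /xi -q2; field; rewrite gt_eqF.
  rewrite fEZ; apply: (@le_trans _ _ (m%:R ^+ 2 / r i ^+ 2 * (k * (r i ^+ 4 / m%:R ^+ 2)))).
    by rewrite ler_wpM2l // divr_ge0 ?sqr_ge0.
  by rewrite le_eqVlt; apply/orP; left; apply/eqP; field; rewrite !gt_eqF.
clearbody xi.
pose G o := l2 (fun i => r i * xi o i) + M + l2 (fun i => r i * xi o i ^+ 2).
have J2 : fE P (fun o => l2 (fun i => r i * xi o i ^+ 2) ^+ 2) <= k * M ^+ 2.
  rewrite (eq_fE Pp (G := fun o => \sum_i r i ^+ 2 * xi o i ^+ 4)); last first.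
    by move=> o _; rewrite l2_sqr; apply: eq_bigr => i _; rewrite exprMn -exprM.
  rewrite fE_sum; apply: (@le_trans _ _ (\sum_i k * r i ^+ 2)); first exact: ler_sum.
  by rewrite -mulr_sumr ler_wpM2l //; lra.
exists G; split=> [u||o x Po bx xr].
- by rewrite !addr_ge0 ?l2_ge0 // ltW.
- apply: (@le_trans _ _ (fE P (fun o => 3 * (2 * M ^+ 2 +
      2 * l2 (fun i => r i * xi o i ^+ 2) ^+ 2)))).
    apply: fE_le => // o _.
    have H2 : l2 (fun i => r i * xi o i) ^+ 2 <= M ^+ 2 + l2 (fun i => r i * xi o i ^+ 2) ^+ 2.
      rewrite !l2_sqr; apply: (@le_trans _ _ (\sum_i (r i ^+ 2 + (r i * xi o i ^+ 2) ^+ 2))).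
        apply: ler_sum => i _; rewrite !exprMn.
        rewrite -subr_ge0 (_ : _ - _ = r i ^+ 2 * ((xi o i ^+ 2 - 2^-1) ^+ 2 + 3 / 4)); last by field.
        by apply: mulr_ge0; [exact: sqr_ge0|apply: addr_ge0; [exact: sqr_ge0|lra]].
      by rewrite big_split /= lerD2r.
    rewrite /G; move: H2; set a := l2 _; set b := l2 _ => H2.
    have := sqr_ge0 (a - M); have := sqr_ge0 (a - b); have := sqr_ge0 (b - M).
    nra.
  rewrite fEZ fED fE_cst // fEZ.
  have := sqr_ge0 M; move: J2; set E := fE _ _ => J2 M2.
  by nra.
- rewrite (eq_bigr (fun i => q^-1 * (x i * (r i * xi o i)))); last first.
    by move=> i _; rewrite (z_xi _ _ Po); ring.
  rewrite -mulr_sumr normrM ger0_norm ?invr_ge0 ?(ltW q0) // mulrC ler_pdivrMr //.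
  by rewrite [leRHS]mulrC; exact: (weighted_ball_bound _ m0 bx M0 xr).
Qed.

Lemma radcost_subproof1 (t x : R) : `|t| <= 1 -> `|x| <= 1 -> `|t * x| <= 1.
Proof. by move=> t1 x1; rewrite normrM mulr_ile1. Qed.

Lemma radcost_subproof2 (t x : R) : `|t| <= 1 -> `|x| <= 1 -> (t * x) ^+ 2 <= `|t| * x ^+ 2.
Proof.
move=> t1 x1; rewrite exprMn ler_wpM2r ?sqr_ge0 // -real_normK ?num_real //.
by rewrite expr2 ler_piMl.
Qed.

Lemma radcost_subproof3 (x : R) : 1 < `|x| -> `|x| <= 1 -> `|x| <= x ^+ 2.
Proof. by move=> h1 h2; have := lt_le_trans h1 h2; rewrite ltxx. Qed.

(** The modified tail function of a random sign: quadratic on [[-1, 1]], infinite outside. *)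
Definition radcost : cost :=
  @Cost R (fun x => x ^+ 2) (fun x => `|x| <= 1) radcost_subproof1 radcost_subproof2
    (fun _ h => h) (fun _ _ => erefl) radcost_subproof3.

(** Second moments of densities multiply over coordinates, so the exponents [4 N i (y i)] add up to
    at most [4 m]. The shift costs at most twice as much as [y], hence half of it is back in the
    ball. *)
Lemma product_tilt (I : finType) (N : I -> cost) (K m : nat) (y : I -> R) :
  ball N m%:R y -> (m < K)%N ->
  exists D sh : I -> bool * 'I_K.+1 -> R,
    [/\ forall i v, 0 <= D i v, forall i, fE (@pwt R K) (D i) = 1,
        forall i, fE (@pwt R K) (fun v => D i v * pval (N i) v) = y i / 4 &
        fE (pw (fun i : I => @pwt R K)) (fun o => (\prod_i D i (o i)) ^+ 2) <= expR 4 ^+ m] /\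
    [/\ forall o : {ffun I -> _}, ball N m%:R (fun i => 2^-1 * sh i (o i)),
        forall i, `|y i| <= 1 -> forall v, sh i v = y i / 4 &
        forall i, subN (fun v => @pwt R K v * D i v) (fun v => pval (N i) v - sh i v) (N i)].
Proof.
move=> By mK; have Kp := @fprob_pwt R K.
have /choice[D /choice[sh h]] i : exists D sh, [/\ forall v, 0 <= D v, fE (@pwt R K) D = 1,
        fE (@pwt R K) (fun v => D v * pval (N i) v) = y i / 4 &
        fE (@pwt R K) (fun v => D v ^+ 2) <= expR (4 * N i (y i))] /\
    [/\ forall v, cdom (N i) (sh v) /\ N i (sh v) <= 2 * N i (y i),
        `|y i| <= 1 -> forall v, sh v = y i / 4 &
        subN (fun v => @pwt R K v * D v) (fun v => pval (N i) v - sh v) (N i)].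
  apply: prior_tilt; first by case: By.
  by apply: le_lt_trans (ball_coord i By) _; rewrite ltr_nat.
exists D, sh; split; split.
- by move=> i; case: (h i) => -[].
- by move=> i; case: (h i) => -[].
- by move=> i; case: (h i) => -[].
- rewrite (eq_fE (fprob_pw (fun=> Kp)) (G := fun o => \prod_i (fun v => D i v ^+ 2) (o i))).
    rewrite (fE_prod _ (fun i v => D i v ^+ 2)).
    apply: (@le_trans _ _ (\prod_i expR (4 * N i (y i)))).
      apply: ler_prod => i _; apply/andP; split; last by case: (h i) => -[].
      by apply: fE_ge0 => // v _; rewrite sqr_ge0.
    rewrite -expR_sum -expRM_natl ler_expR -mulr_sumr mulrC ler_wpM2r //.
    by case: By.
  by move=> o _; rewrite prodrXl.
- move=> o; apply: ball_scale; first by lra.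
  split=> [i|]; first by case: (h i) => _ [/(_ (o i))[]].
  apply: (@le_trans _ _ (\sum_i 2 * N i (y i))).
    by apply: ler_sum => i _; case: (h i) => _ [/(_ (o i))[]].
  by rewrite -mulr_sumr ler_wpM2l //; case: By.
- by move=> i; case: (h i) => _ [].
- by move=> i; case: (h i) => _ [].
Qed.

End Noise.

(** * Moments of Hilbert-valued linear forms *)

Section HilbertLinear.
Context {R : realType}.
Local Notation cost := (cost (R := R)).
Local Notation cGK := (@cGK R).

Lemma sum_pair (K L : finType) (F : K * L -> R) :
  \sum_(p : K * L) F p = \sum_k \sum_l F (k, l).
Proof. by rewrite pair_bigA /=; apply: eq_bigr => -[]. Qed.

Lemma fE_pw_tilt (I V : finType) (w D : I -> V -> R) (F : {ffun I -> V} -> R) :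
  fE (pw w) (fun o => (\prod_i D i (o i)) * F o) = fE (pw (fun i v => w i v * D i v)) F.
Proof. by apply: eq_bigr => o _; rewrite pw_tilt mulrA. Qed.

Lemma fE_linear_tilt (I V : finType) (w D X : I -> V -> R) (c : I -> R) :
  (forall i, fprob (w i)) -> (forall i, fE (w i) (D i) = 1) ->
  fE (pw w) (fun o => (\prod_i D i (o i)) * \sum_i c i * X i (o i)) =
  \sum_i c i * fE (w i) (fun v => D i v * X i v).
Proof.
move=> wp D1; rewrite (eq_fE (fprob_pw wp) (G := fun o =>
    \sum_i c i * ((\prod_k D k (o k)) * X i (o i)))).
  by rewrite fE_sum; apply: eq_bigr => i _; rewrite fEZ (fE_coord_tilt _ _ D1).
by move=> o _; rewrite mulr_sumr; apply: eq_bigr => i _; rewrite mulrCA.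
Qed.

(** [384 cGK ^ 3] is the square root of [36 k cGK ^ 2] with [k = (8 cGK) ^ 4]; [8 expR 4 ^ 2] joins
    the factor of [sup_over_tilts] with the 4 that undoes the mean [f / 4]; the outer 2 absorbs the
    bound 2 on the moment of [A]. *)
Definition cHL : R := 2 * (8 * expR 4 ^+ 2 * (384 * cGK ^+ 3)).

Lemma cHL_ge1 : 1 <= cHL.
Proof.
rewrite /cHL; have h1 := exprn_ege1 3 (@cGK_ge1 R).
have : 1 <= expR 4 ^+ 2 :> R.
  by apply: exprn_ege1; have := expR_ge1Dx (4 : R); lra.
by move=> h2; nra.
Qed.

(* The norm is linearized by [f' = (1/m) \sum_l eps_(k,l)], a random functional
   whose law dominates all its translates by unit vectors at exponential cost [m]. *)
Lemma hilbert_linear_moment (I V K : finType) (w X : I -> V -> R) (N : I -> cost)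
    (v : I -> K -> R) (m : nat) (Q Rb : R) :
  (forall i, subN (w i) (X i) (N i)) -> (4 <= m)%N -> 0 < Q -> 0 <= Rb ->
  \sum_i \sum_k v i k ^+ 2 <= Q ^+ 2 ->
  (forall y, ball N m%:R y -> \sum_k (\sum_i y i * v i k) ^+ 2 <= Rb ^+ 2) ->
  fE (pw w) (fun o => l2 (fun k => \sum_i X i (o i) * v i k) ^+ m) <=
    (cHL * (Q + Rb)) ^+ m.
Proof.
move=> XN m4 Q0 Rb0 vQ vRb.
have wp i : fprob (w i) by case: (XN i).
have m0 : (0 < m)%N by apply: leq_trans m4.
have mR : 0 < m%:R :> R by rewrite ltr0n.
have mn0 : m%:R != 0 :> R by rewrite gt_eqF.
pose M := Q + Rb; have M0 : 0 < M by rewrite /M ltr_wpDr.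
(* With [m] copies of each coordinate, a unit vector repeated over the copies has total cost at most
   [m], and the averaged prior deviates from its tilted mean by [1 / sqrt m] only. *)
pose J : finType := ((K * 'I_m)%type : finType).
pose mu := pw (fun _ : J => @pwt R m.+1).
have mup : fprob mu by apply: fprob_pw => _; exact: fprob_pwt.
pose ev (o : {ffun J -> bool * 'I_m.+2}) (p : J) : R := pval radcost (o p).
pose Psi (x : {ffun I -> V}) o :=
  \sum_(p : J) (m%:R^-1 * \sum_i X i (x i) * v i p.1) * ev o p.
have /choice[g hg] o : exists r, 0 <= r /\ r ^+ m = fE (pw w) (fun x => `|Psi x o| ^+ m).
  apply: root_exists => //; apply: fE_ge0 => [|x _]; first exact: fprob_pw.
  by rewrite exprn_ge0.
(* The weight has to be positive even where the conditional moment [g] vanishes. *)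
pose Gam o := g o + M.
have [|||||A [A0 [A2 HA]]] := @sup_over_tilts R _ _ (pw w) mu Psi Gam m.
- exact: fprob_pw.
- exact: mup.
- exact: m4.
- by move=> o; rewrite /Gam ltr_wpDl //; case: (hg o).
- move=> o; case: (hg o) => g0 <-; apply: lerXn2r; rewrite ?nnegrE //.
    by rewrite addr_ge0 // ltW.
  by rewrite /Gam lerDl ltW.
pose B := 384 * cGK ^+ 3 * M.
have G1 := @cGK_ge1 R; have G0 : 0 < cGK by lra.
have B0 : 0 < B.
  by apply: mulr_gt0 M0; apply: mulr_gt0; [exact: ltr0Sn|exact: exprn_gt0].
have key (x : {ffun I -> V}) (f : K -> R) : \sum_k f k ^+ 2 <= 1 ->
    `|\sum_k f k * \sum_i X i (x i) * v i k| <= 8 * expR 4 ^+ 2 * B * A x.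
  move=> f1.
  have fk k : `|f k| <= 1.
    rewrite -(@ler_pXn2r _ 2) ?nnegrE // expr1n real_normK ?num_real //.
    apply: le_trans f1; rewrite (bigD1 k) //= lerDl.
    by apply: sumr_ge0 => j _; rewrite sqr_ge0.
  have By : ball (fun _ : J => radcost) m%:R (fun p => f p.1).
    apply: ball_small => [p|]; first exact: fk.
    rewrite sum_pair /=; under eq_bigr do rewrite sumr_const card_ord -mulr_natr.
    by rewrite -mulr_suml ler_piMl // ltW.
  have [D [sh [[D0 D1 Dp D2] [_ shE subD]]]] := product_tilt By (ltnSn m).
  have {}shE p u : sh p u = f p.1 / 4 by apply: shE; exact: fk.
  pose Dpr (o : {ffun J -> bool * 'I_m.+2}) := \prod_p D p (o p).
  have Dpr0 o : 0 <= Dpr o by apply: prodr_ge0.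
  have Dpr1 : fE mu Dpr = 1.
    by rewrite (fE_prod _ D) big1 // => p _; rewrite D1.
  have meanE : fE mu (fun o => Dpr o * Psi x o) =
      4^-1 * \sum_k f k * \sum_i X i (x i) * v i k.
    rewrite (@fE_linear_tilt _ _ _ _ (fun p => pval radcost)) //; last first.
      by move=> _; exact: fprob_pwt.
    rewrite sum_pair mulr_sumr; apply: eq_bigr => k _ /=.
    under eq_bigr do rewrite Dp /=.
    by rewrite sumr_const card_ord -mulr_natl; field.
  pose PD := pw (fun (p : J) u => @pwt R m.+1 u * D p u).
  have PDp : fprob PD by apply: fprob_pw => p; case: (subD p).
  pose zeta i o := \sum_(p : J) (m%:R^-1 * v i p.1) * (ev o p - sh p (o p)).
  pose q : R := Num.sqrt m%:R; have q0 : 0 < q by rewrite sqrtr_gt0.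
  have q2 : q ^+ 2 = m%:R by rewrite sqr_sqrtr // ltW.
  pose k := (8 * cGK) ^+ 4.
  have k1 : 1 <= k by apply: exprn_ege1; lra.
  have zeta4 i : fE PD (fun o => zeta i o ^+ 4) <= k * (l2 (v i) ^+ 4 / m%:R ^+ 2).
    have -> : k * (l2 (v i) ^+ 4 / m%:R ^+ 2) = (cGK * (l2 (v i) / q * (2 * 4%:R))) ^+ 4.
      by rewrite /k -q2; field; rewrite gt_eqF.
    rewrite (eq_fE PDp (G := fun o => `|zeta i o| ^+ 4)); last first.
      by move=> o _; rewrite -normrX ger0_norm // -[4%N]/(2 * 2)%N exprM sqr_ge0.
    apply: (linear_form_moment_l2 subD) => //.
      by rewrite divr_ge0 ?l2_ge0 // ltW.
    rewrite sum_pair exprMn l2_sqr exprVn q2 /= mulr_suml.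
    under eq_bigr do rewrite sumr_const card_ord -mulr_natl.
    by rewrite le_eqVlt; apply/orP; left; apply/eqP; apply: eq_bigr => j _; field.
  have [|G [Ge0 G2 HG]] := @noise_bound R _ _ PD zeta (fun i => l2 (v i)) N m M k PDp m0 M0 k1
     (fun i => l2_ge0 _) _ zeta4.
    under eq_bigr do rewrite l2_sqr; apply: le_trans vQ _.
    by rewrite ler_sqr ?nnegrE ?(ltW M0) ?(ltW Q0) // lerDl.
  (* For a fixed prior sample the form is linear in [X]. Its coefficients are a mean part,
     controlled by [vRb], and the noise [zeta]. *)
  have gle o : 0 < PD o -> g o <= cGK * (Rb + G o).
    move=> Po; case: (hg o) => g0 gm.
    have RG0 : 0 <= Rb + G o by rewrite addr_ge0.
    rewrite -(@ler_pXn2r _ m) ?nnegrE ?mulr_ge0 ?(ltW G0) // gm.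
    pose b i := \sum_(p : J) (m%:R^-1 * v i p.1) * ev o p.
    rewrite (eq_fE (fprob_pw wp) (G := fun x => `|\sum_i b i * X i (x i)| ^+ m)); last first.
      move=> x' _; congr (`| _ | ^+ _); rewrite /Psi /b.
      under eq_bigr => p _ do rewrite mulr_sumr mulr_suml.
      rewrite exchange_big /=; apply: eq_bigr => i _; rewrite mulr_suml.
      by apply: eq_bigr => p _; ring.
    apply: (linear_form_moment XN) => // z Bz.
    have -> : \sum_i b i * z i = 4^-1 * \sum_k0 f k0 * (\sum_i z i * v i k0) +
        \sum_i z i * zeta i o.
      have bE i : b i = 4^-1 * (\sum_k0 f k0 * v i k0) + zeta i o.
        have -> : zeta i o = b i - \sum_(p : J) (m%:R^-1 * v i p.1) * sh p (o p).
          by rewrite /zeta /b -sumrB; apply: eq_bigr => p _; rewrite mulrBr.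
        rewrite addrCA -[LHS]addr0; congr (_ + _); apply/esym/eqP; rewrite subr_eq0; apply/eqP.
        rewrite [RHS]sum_pair mulr_sumr; apply: eq_bigr => j _ /=.
        under eq_bigr do rewrite shE /=.
        by rewrite sumr_const card_ord -mulr_natl; field.
      under eq_bigr do rewrite bE mulrDl; rewrite big_split /=; congr (_ + _).
        under eq_bigr => i _ do rewrite -mulrA mulr_suml mulr_sumr.
        rewrite exchange_big /= mulr_sumr; apply: eq_bigr => j _; rewrite !mulr_sumr.
        by apply: eq_bigr => i _; ring.
      by apply: eq_bigr => i _; rewrite mulrC.
    apply: lerD; last first.
      apply: le_trans (ler_norm _) _; apply: HG => //.
      apply: (@le_trans _ _ (Rb ^+ 2)); last by rewrite ler_sqr ?nnegrE ?(ltW M0) // lerDr ltW.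
      (* The row norms weighted by [z] are an average over signs of the squared norms in [vRb]. *)
      rewrite (eq_bigr (fun i => \sum_k0 (z i * v i k0) ^+ 2)); last first.
        move=> i _; rewrite exprMn l2_sqr mulr_sumr; apply: eq_bigr => j _.
        by rewrite exprMn.
      rewrite exchange_big /=; apply: sign_average => s s1.
      have := vRb _ (ballM s1 Bz); apply: le_trans; rewrite le_eqVlt; apply/orP; left.
      by apply/eqP; apply: eq_bigr => j _; congr (_ ^+ _); apply: eq_bigr => i _; rewrite mulrA.
    have : `|\sum_k0 f k0 * \sum_i z i * v i k0| <= Rb.
      apply: ler_sqr_norm => //; apply: le_trans (sum_CauchySchwarz _ _ _) _.
      rewrite -[leRHS]mul1r; apply: ler_pM; rewrite ?sum_sqr_ge0 //; exact: vRb.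
    by have := ler_norm (\sum_k0 f k0 * \sum_i z i * v i k0); lra.
  have DG : fE mu (fun o => Dpr o * Gam o ^+ 2) <= B ^+ 2.
    rewrite fE_pw_tilt -/PD.
    apply: (@le_trans _ _ (fE PD (fun o => cGK ^+ 2 * (2 * G o ^+ 2 + 8 * M ^+ 2)))).
      apply: fE_le => // o Po.
      have h : Gam o <= cGK * (G o + 2 * M).
        have := gle o Po; have := Ge0 o; rewrite /Gam.
        have : Rb <= M by rewrite /M lerDr ltW.
        by move=> h1 h2 h3; nra.
      apply: (@le_trans _ _ ((cGK * (G o + 2 * M)) ^+ 2)).
        rewrite ler_sqr ?nnegrE //.
          by rewrite /Gam addr_ge0 ?(ltW M0) //; case: (hg o).
        by rewrite mulr_ge0 ?addr_ge0 ?mulr_ge0 ?(ltW M0) ?(ltW G0).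
      rewrite exprMn ler_wpM2l ?sqr_ge0 //.
      by have := sqr_ge0 (G o - 2 * M); lra.
    rewrite fEZ fED fE_cst // fEZ.
    apply: (@le_trans _ _ (cGK ^+ 2 * (32 * k * M ^+ 2))).
      rewrite ler_wpM2l ?sqr_ge0 //; have := sqr_ge0 M; move: G2 k1.
      by move: (k) (fE _ _) => k' E; nra.
    have -> : B ^+ 2 = cGK ^+ 2 * (36 * k * M ^+ 2) by rewrite /B /k; ring.
    rewrite ler_wpM2l ?sqr_ge0 //; have := sqr_ge0 M; move: k1.
    by move: (k) => k'; nra.
  have e1 : 1 <= expR (4 : R) by have := expR_ge1Dx (4 : R); lra.
  have := HA x Dpr B (expR 4) Dpr0 Dpr1 e1 D2 B0 DG.
  by rewrite meanE normrM (ger0_norm (x := 4^-1)); lra.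
have c0 : 0 < 8 * expR 4 ^+ 2 * B.
  by rewrite mulr_gt0 // mulr_gt0 // exprn_gt0 // expR_gt0.
apply: (@le_trans _ _ (fE (pw w) (fun x => (8 * expR 4 ^+ 2 * B) ^+ m * A x ^+ m))).
  apply: fE_le => [|x _]; first exact: fprob_pw.
  rewrite -exprMn; apply: lerXn2r; rewrite ?nnegrE ?l2_ge0 //.
    by rewrite mulr_ge0 // ltW.
  by apply: l2_dual => [|f f1]; [rewrite mulr_ge0 // ltW|exact: key].
rewrite fEZ; apply: (@le_trans _ _ ((8 * expR 4 ^+ 2 * B) ^+ m * 2 ^+ m)).
  rewrite ler_wpM2l ?exprn_ge0 ?(ltW c0) //; apply: le_trans A2 _.
  by rewrite -{1}[2]expr1; apply: ler_weXn2l => //; lra.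
by rewrite -exprMn /B /cHL -/M le_eqVlt; apply/orP; left; apply/eqP; congr (_ ^+ _); ring.
Qed.

End HilbertLinear.

(** * Real chaoses *)

Section RealChaos.
Context {R : realType}.
Local Notation cost := (cost (R := R)).
Local Notation cGK := (@cGK R).

Definition cRC : R := 5 * (16 * cGK) ^+ 4 + 18 * (expR 47 * cGK).

Lemma cRC_ge1 : 1 <= cRC.
Proof.
have G1 := @cGK_ge1 R; have h : 1 <= (16 * cGK) ^+ 4 by apply: exprn_ege1; lra.
have : 0 <= expR 47 * cGK by rewrite mulr_ge0 ?expR_ge0 //; lra.
by rewrite /cRC; lra.
Qed.

Lemma sum_sqr_geometric (n : nat) : \sum_(k < n) k%:R ^+ 2 * expR (- k%:R) <= 22 :> R.
Proof.
apply: (@le_trans _ _ (\sum_(k < n) 8 * expR (- 2^-1) ^+ k)).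
  apply: ler_sum => k _; rewrite -expR_neg_nat.
  have h := @sqr_le_expR R (k%:R / 2) _; have {h} : (k%:R / 2) ^+ 2 <= 2 * expR (k%:R / 2) :> R.
    by apply: h; rewrite divr_ge0.
  have -> : expR (- k%:R) = expR (- (k%:R / 2)) * expR (- (k%:R / 2)) :> R.
    by rewrite -expRD; congr expR; field.
  have : expR (k%:R / 2) * expR (- (k%:R / 2)) = 1 :> R by rewrite -expRD subrr expR0.
  have := expR_gt0 (- (k%:R / 2) : R).
  move: (expR _) (expR _) => a b; move: (k%:R) => t; nra.
rewrite -mulr_sumr; have q := @expR_neghalf R; have q0 := expR_gt0 (- 2^-1 : R).
have := @geometric_le _ (expR (- 2^-1)) n _; set S := \sum_(k < _) _ => h.
have {h} : S <= (1 - expR (- 2^-1))^-1 by apply: h; rewrite ltW //=; lra.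
have : (1 - expR (- 2^-1 : R))^-1 <= 8 / 3 by rewrite invf_ple ?posrE //; lra.
lra.
Qed.

(** Otherwise the vector [min 1 (r / T)], scaled down to Euclidean norm [sqrt m], would be a point
    of the ball whose pairing with [r] exceeds [m T = 2 R4]. *)
Lemma min_sum_le (I : finType) (N : I -> cost) (m : nat) (r : I -> R) (R4 T : R) :
  (0 < m)%N -> 0 < R4 -> T = 2 * R4 / m%:R -> (forall i, 0 <= r i) ->
  (forall x, ball N m%:R x -> \sum_i x i * r i <= R4) ->
  \sum_i (Num.min 1 (r i / T)) ^+ 2 <= m%:R.
Proof.
move=> m0 R40 TE r0 h4; have mR : 0 < m%:R :> R by rewrite ltr0n.
have T0 : 0 < T by rewrite TE divr_gt0 //; lra.
pose rho i := Num.min 1 (r i / T); have rho0 i : 0 <= rho i.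
  by rewrite le_min ler01 divr_ge0 // ltW.
have rho1 i : rho i <= 1 by rewrite ge_min lexx.
rewrite leNgt; apply/negP; set sg := \sum_i _ => sgm.
pose q := Num.sqrt (m%:R / sg); have sg0 : 0 < sg by exact: lt_trans sgm.
have q0 : 0 < q by rewrite sqrtr_gt0 divr_gt0.
have q2 : q ^+ 2 = m%:R / sg by rewrite sqr_sqrtr // divr_ge0 // ltW.
have q1 : q <= 1.
  by rewrite -(@ler_pXn2r _ 2) ?nnegrE ?(ltW q0) // q2 expr1n ler_pdivrMr // mul1r ltW.
have : \sum_i (q * rho i) * r i <= R4.
  apply: h4; apply: ball_small => [i|].
    by rewrite normrM !ger0_norm ?(ltW q0) // mulr_ile1 // ltW.
  under eq_bigr do rewrite exprMn; rewrite -mulr_sumr q2 divfK ?gt_eqF //.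
have : \sum_i q * T * rho i ^+ 2 <= \sum_i (q * rho i) * r i.
  apply: ler_sum => i _; rewrite expr2 -!mulrA ler_wpM2l ?(ltW q0) // mulrCA ler_wpM2l //.
  by rewrite mulrC -ler_pdivlMr // ge_min lexx orbT.
rewrite -mulr_sumr -/sg.
have : q * sg > m%:R.
  rewrite -(@ltr_pXn2r _ 2) ?nnegrE ?mulr_ge0 ?(ltW q0) ?(ltW sg0) //.
  by rewrite exprMn q2 [sg ^+ 2]expr2 mulrA divfK ?gt_eqF // expr2 ltr_pM2l.
have : m%:R * T = 2 * R4 by rewrite TE; field; rewrite gt_eqF.
by move=> h1 h2 h3 h4'; nra.
Qed.

Section Configurations.
Variables (I : finType) (N : I -> cost) (m : nat) (r : I -> R) (R4 : R).
Hypotheses (m0 : (0 < m)%N) (R40 : 0 < R4) (r0 : forall i, 0 <= r i).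
Hypothesis h4 : forall x, ball N m%:R x -> \sum_i x i * r i <= R4.

Definition thr : R := 2 * R4 / m%:R.
Let T := thr.
Let K := (3 * m)%N.

Let mR : 0 < m%:R :> R. Proof. by rewrite ltr0n. Qed.
Let T0 : 0 < T. Proof. by rewrite /T /thr divr_gt0 // mulr_gt0. Qed.

(** In a configuration level 0 means that the coordinate is absent, unlike in [pval]; its sign is
    forced so that absence is counted once. *)
Definition allowed (i : I) (u : bool * 'I_K.+1) : bool :=
  if u.2 == ord0 then u.1 else T < r i * u.2%:R.

Definition config (c : {ffun I -> bool * 'I_K.+1}) : bool :=
  [forall i, allowed i (c i)] && (\sum_i (c i).2 <= K)%N.

Definition cpoint (c : {ffun I -> bool * 'I_K.+1}) (i : I) : R :=
  if (c i).2 == ord0 then 0 else pval (N i) (c i).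

Lemma cpoint_ball c : config c -> ball N m%:R (fun i => 3^-1 * cpoint c i).
Proof.
move=> /andP[_ cK]; apply: ball_scale; first by lra.
have n0 : `|(0 : R)| <= 1 by rewrite normr0.
split=> [i|]; first by rewrite /cpoint; case: ifP => _; [exact: cdom1|case: (pval_cost (N i) (c i))].
apply: (@le_trans _ _ (\sum_i (c i).2%:R)).
  apply: ler_sum => i _; rewrite /cpoint; case: eqP => [->|/eqP k0].
    by rewrite cval1 // expr0n.
  case: (pval_cost (N i) (c i)) => _; have -> : maxn (c i).2 1 = (c i).2; last by [].
  by apply/maxn_idPl; rewrite lt0n.
by rewrite -natr_sum -[3]/(3%:R) -natrM ler_nat.
Qed.

(* Only large coordinates at indices with [r i] not too small are used, so the number of
   configurations is exponential in [m], whatever the number of indices. *)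
Lemma card_config : \sum_(c | config c) (1 : R) <= expR 47 ^+ m.
Proof.
(* Exponential weighting: the total level is at most [K], so [expR K] times the product of the
   [expR (- level)] is at least 1, and the sum of products factorises over the indices. *)
apply: (@le_trans _ _ (\sum_(c : {ffun I -> bool * 'I_K.+1}) \prod_i (if allowed i (c i) then expR (- (c i).2%:R) else 0)
   * expR K%:R)).
  rewrite [leLHS]big_mkcond /=; apply: ler_sum => c _; case: ifP => [/andP[/forallP al cK]|_].
    rewrite (eq_bigr (fun i => expR (- (c i).2%:R))); last by move=> i _; rewrite al.
    rewrite -expR_sum -expRD -[leLHS]expR0 ler_expR sumrN -natr_sum.
    by rewrite addrC subr_ge0 ler_nat.
  by rewrite mulr_ge0 ?expR_ge0 // prodr_ge0 // => i _; case: ifP; rewrite ?expR_ge0.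
rewrite -mulr_suml.
rewrite -(bigA_distr_bigA (fun i u => if allowed i u then expR (- u.2%:R) else 0)) /=.
pose rho i := Num.min 1 (r i / T).
have rho0 i : 0 <= rho i by rewrite le_min ler01 divr_ge0 // ltW.
(* A level [k] used at [i] satisfies [rho i * k >= 1], so it may be counted with weight
   [(rho i * k) ^ 2]. Two signs and the series bounded by 22 give 44; with [K = 3 m] the exponent is
   [47 m]. *)
have one i : \sum_u (if allowed i u then expR (- u.2%:R) else 0) <= expR (44 * rho i ^+ 2).
  rewrite sum_pair big_bool /= -big_split /=.
  apply: (@le_trans _ _ (\sum_(k < K.+1) ((if k == ord0 then 1 else 0) +
      2 * rho i ^+ 2 * (k%:R ^+ 2 * expR (- k%:R))))).
    apply: ler_sum => k _; rewrite /allowed /=; case: eqP => [->|k0].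
      by rewrite oppr0 expR0 expr0n /= mul0r mulr0 !addr0.
    rewrite add0r; case: ifP => [Tk|_]; last first.
      by rewrite addr0 !mulr_ge0 ?sqr_ge0 ?expR_ge0.
    have k1 : 1 <= k%:R :> R by rewrite ler1n lt0n; apply/eqP => k0'; apply: k0; apply: val_inj.
    have : 1 <= rho i * k%:R.
      rewrite /rho /Num.min; case: ifP => _; rewrite ?mul1r // mulrAC ler_pdivlMr ?mul1r //.
      exact: ltW.
    move=> h; have : 1 <= (rho i * k%:R) ^+ 2 by apply: exprn_ege1.
    rewrite exprMn; have := expR_gt0 (- k%:R : R).
    by move: (expR _) (k%:R ^+ 2) (rho i ^+ 2) => e a b; nra.
  rewrite big_split /= -big_mkcond /= big_pred1_eq -mulr_sumr.
  apply: le_trans (expR_ge1Dx _); rewrite lerD2l.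
  have := sum_sqr_geometric K.+1; have := sqr_ge0 (rho i).
  by move: (rho i ^+ 2) (\sum_k _) => a b; nra.
apply: (@le_trans _ _ ((\prod_i expR (44 * rho i ^+ 2)) * expR K%:R)).
  rewrite ler_wpM2r ?expR_ge0 //; apply: ler_prod => i _; rewrite one andbT.
  by apply: sumr_ge0 => u _; case: ifP; rewrite ?expR_ge0.
rewrite -expR_sum -expRD -expRM_natl ler_expR -mulr_sumr /K natrM.
have := min_sum_le m0 R40 erefl r0 h4; rewrite -/thr -/T => h.
have : 44 * \sum_i rho i ^+ 2 <= 44 * m%:R by rewrite ler_wpM2l.
lra.
Qed.

(** Each selected coordinate moves to an integer level at least its cost and takes the sign of
    [Z i], at the loss of a factor 2 by [lev_max]. A selected small coordinate has [rho i = 1] and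
    uses level 1, paid for by [min_sum_le]; a large one uses a level at most [2 N]. The total stays
    below [3 m]. *)
Lemma cpoint_dominates (x Z : I -> R) : ball N m%:R x ->
  exists2 c, config c &
    \sum_(i | if `|x i| <= 1 then T < r i else T < `|x i| * r i) `|x i| * `|Z i| <=
    2 * \sum_i cpoint c i * Z i.
Proof.
move=> Bx; case: (Bx) => dx xm.
pose A i := if `|x i| <= 1 then T < r i else T < `|x i| * r i.
pose k i := if `|x i| <= 1 then 1%N else (Num.truncn (N i (x i))).+1.
pose rho i := Num.min 1 (r i / T).
have k0 i : (0 < k i)%N by rewrite /k; case: ifP.
have Nx0 i : 0 <= N i (x i) by exact: cval_ge0.
have kN i : N i (x i) <= (k i)%:R.
  rewrite /k; case: ifP => [x1|_].
    by rewrite cval1 // -real_normK ?num_real // exprn_ile1.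
  by have /andP[_ /ltW] := truncn_itv (Nx0 i).
have k2 i : 1 < `|x i| -> (k i)%:R <= N i (x i) + 1.
  move=> x1; rewrite /k ifN -?ltNge // -natr1 lerD2r.
  by have /andP[] := truncn_itv (Nx0 i).
have kA i : A i -> (k i)%:R <= rho i ^+ 2 + 2 * N i (x i).
  rewrite /A; case: (leP `|x i| 1) => x1 Ti.
    have -> : rho i = 1.
      by rewrite /rho min_l // ler_pdivlMr // mul1r; exact: ltW.
    by rewrite /k x1 expr1n lerDl mulr_ge0.
  have := k2 i x1; have := cval_ge x1 (dx i); have := sqr_ge0 (rho i); lra.
have kK i : A i -> (k i < K.+1)%N.
  move=> Ai; rewrite ltnS /k; case: (leP `|x i| 1) => x1; first by rewrite /K; lia.
  rewrite -(ler_nat R); apply: (@le_trans _ _ (m%:R + 1)).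
    by have := k2 i x1; rewrite /k ifN -?ltNge //; have := ball_coord i Bx; lra.
  by rewrite natr1 ler_nat /K; lia.
pose c : {ffun I -> bool * 'I_K.+1} :=
  [ffun i => if A i then (0 <= Z i, inord (k i)) else (true, ord0)].
have ck i : A i -> (c i).2 = k i :> nat by move=> Ai; rewrite ffunE Ai /= inordK // kK.
exists c.
  apply/andP; split.
    apply/forallP => i; rewrite /allowed; case: (boolP (A i)) => Ai; last first.
      by rewrite ffunE (negPf Ai) /=.
    have kn0 : (c i).2 != ord0 by rewrite -val_eqE /= ck // -lt0n.
    rewrite (negPf kn0) ck //; move: Ai; rewrite /A; case: (leP `|x i| 1) => x1 Ti.
      by rewrite /k x1 mulr1.
    apply: lt_le_trans Ti _; rewrite mulrC ler_wpM2l //.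
    by apply: le_trans (cval_ge x1 (dx i)) _.
  rewrite -(ler_nat R) natr_sum.
  apply: (@le_trans _ _ (\sum_i (rho i ^+ 2 + 2 * N i (x i)))).
    apply: ler_sum => i _; case: (boolP (A i)) => Ai; first by rewrite ck // kA.
    by rewrite ffunE (negPf Ai) /= addr_ge0 ?sqr_ge0 // mulr_ge0.
  rewrite big_split /= -mulr_sumr /K natrM.
  have := min_sum_le m0 R40 erefl r0 h4; rewrite -/thr -/T -/(rho _) => h.
  by have : \sum_i rho i ^+ 2 <= m%:R by []; lra.
rewrite [leLHS]big_mkcond mulr_sumr /=; apply: ler_sum => i _; rewrite -/(A i).
case: (boolP (A i)) => Ai; last by rewrite /cpoint ffunE (negPf Ai) /= mul0r mulr0.
have kn0 : (c i).2 != ord0 by rewrite -val_eqE /= ck // -lt0n.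
rewrite /cpoint (negPf kn0) /pval ck // ffunE Ai /=.
have -> : bsgn (0 <= Z i) * lev (N i) (k i) * Z i = lev (N i) (k i) * `|Z i|.
  rewrite /bsgn; case: (leP 0 (Z i)) => Z0; first by rewrite ger0_norm // mul1r.
  by rewrite ltr0_norm // mulN1r mulrN mulNr.
by rewrite mulrA ler_wpM2r // lev_max.
Qed.

End Configurations.

End RealChaos.

(** * Supremum of a linear form with random coefficients *)

Section RealChaosSup.
Context {R : realType}.
Local Notation cost := (cost (R := R)).
Local Notation cGK := (@cGK R).
Local Notation cRC := (@cRC R).

Lemma sum_sqr_small (I : finType) (N : I -> cost) (m : nat) (r : I -> R) (R4 : R) :
  (0 < m)%N -> 0 < R4 -> (forall i, 0 <= r i) ->
  (forall x, ball N m%:R x -> \sum_i x i * r i <= R4) ->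
  \sum_(i | r i <= thr m R4) r i ^+ 2 <= m%:R * thr m R4 ^+ 2.
Proof.
move=> m0 R40 r0 h4; have mR : 0 < m%:R :> R by rewrite ltr0n.
have T0 : 0 < thr m R4 by rewrite /thr divr_gt0 // mulr_gt0.
rewrite -ler_pdivrMr ?exprn_gt0 //.
apply: le_trans (min_sum_le m0 R40 erefl r0 h4); rewrite -/(thr m R4) mulr_suml.
rewrite [leLHS]big_mkcond; apply: ler_sum => i _; case: ifP => [ri|_]; last exact: sqr_ge0.
by rewrite -exprVn -exprMn min_r // ler_pdivrMr // mul1r.
Qed.

(** With [r i = l2 (b i)] and [Z i] the random coefficient, [|x i| |Z i|] is treated in four
    regimes. Small [x i] with [r i <= T]: Cauchy-Schwarz ([g1]). Large [x i] with [|Z i| <= T]: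
    total at most [m T = 2 R4]. Large [x i] with [|x i| r i <= T < |Z i|]: at most
    [Z i ^ 4 / (r i T ^ 2)], without [x] ([g4]). All others are dominated by a configuration
    ([g5]). *)
Lemma real_chaos_sup (I J V : finType) (N : I -> cost) (w Y : J -> V -> R)
    (N' : J -> cost) (b : I -> J -> R) (m : nat) (R4 R5 : R) :
  (forall j, subN (w j) (Y j) (N' j)) -> (2 <= m)%N -> 0 < R4 -> 0 <= R5 ->
  (forall x, ball N m%:R x -> \sum_i x i * l2 (b i) <= R4) ->
  (forall x y, ball N m%:R x -> ball N' m%:R y ->
     \sum_i \sum_j b i j * x i * y j <= R5) ->
  exists G : {ffun J -> V} -> R,
    [/\ forall o, 0 <= G o, fE (pw w) (fun o => G o ^+ 2) <= (cRC * (R4 + R5)) ^+ 2 &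
      forall (o : {ffun J -> V}) x, ball N m%:R x -> \sum_i x i * (\sum_j b i j * Y j (o j)) <= G o].
Proof.
move=> YN m2 R40 R50 h4 h5.
have wp j : fprob (w j) by case: (YN j).
have pp := fprob_pw wp.
have m0 : (0 < m)%N by apply: leq_trans m2.
have mR : 0 < m%:R :> R by rewrite ltr0n.
pose r i := l2 (b i); have r0 i : 0 <= r i by exact: l2_ge0.
pose T := thr m R4; have T0 : 0 < T by rewrite /T /thr divr_gt0 // mulr_gt0.
have mT : m%:R * T = 2 * R4 by rewrite /T /thr; field; rewrite gt_eqF.
have small := sum_sqr_small m0 R40 r0 h4; rewrite -/T in small.
pose Z i (o : {ffun J -> V}) := \sum_j b i j * Y j (o j).
have G1 := @cGK_ge1 R; have G0 : 0 < cGK by lra.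
have Zmom p i : (0 < p)%N -> fE (pw w) (fun o => `|Z i o| ^+ p) <= (cGK * (r i * (2 * p%:R))) ^+ p.
  by move=> p0; apply: (linear_form_moment_l2 YN) => //; rewrite l2_sqr.
have Z0 i o : r i = 0 -> Z i o = 0.
  move=> ri; rewrite /Z big1 // => j _; have : b i j ^+ 2 <= 0.
    have -> : 0 = r i ^+ 2 by rewrite ri expr0n.
    by rewrite l2_sqr (bigD1 j) //= lerDl sumr_ge0 // => k _; rewrite sqr_ge0.
  by rewrite le_eqVlt ltNge sqr_ge0 orbF sqrf_eq0 => /eqP->; rewrite mul0r.
pose q : R := Num.sqrt m%:R; have q0 : 0 < q by rewrite sqrtr_gt0.
have q2 : q ^+ 2 = m%:R by rewrite sqr_sqrtr // ltW.
pose g1 o := Num.sqrt (\sum_(i | r i <= T) Z i o ^+ 2).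
have g1_sq o : g1 o ^+ 2 = \sum_(i | r i <= T) Z i o ^+ 2.
  by rewrite sqr_sqrtr // sumr_ge0 // => i _; rewrite sqr_ge0.
pose g4 o := \sum_(i | r i <= T) Z i o ^+ 4 / (r i * T ^+ 2).
have even4 (u : R) : 0 <= u ^+ 4 by rewrite -[4%N]/(2 * 2)%N exprM sqr_ge0.
have g40 o : 0 <= g4 o.
  by apply: sumr_ge0 => i _; rewrite divr_ge0 // mulr_ge0 ?sqr_ge0.
(* The maximum over configurations is at most the [m]-th root of the sum of [m]-th powers;
   [card_config] makes this cost a constant factor. *)
pose S o := \sum_(c | config (m := m) r R4 c) `|\sum_i cpoint N c i * Z i o| ^+ m.
have S0 o : 0 <= S o by apply: sumr_ge0 => c _; rewrite exprn_ge0.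
have /choice[g5 hg5] o : exists u, 0 <= u /\ u ^+ m = S o by exact: root_exists.
pose B := 3 * (expR 47 * cGK) * (R4 + R5).
have B0 : 0 < B.
  by apply: mulr_gt0; [apply: mulr_gt0 => //; apply: mulr_gt0; rewrite ?expR_gt0|lra].
have E1 : fE (pw w) (fun o => (q * g1 o) ^+ 2) <= 64 * cGK ^+ 2 * R4 ^+ 2.
  rewrite (eq_fE pp (G := fun o => m%:R * \sum_(i | r i <= T) Z i o ^+ 2)); last first.
    by move=> o _; rewrite exprMn q2 g1_sq.
  rewrite fEZ fE_sum.
  apply: (@le_trans _ _ (m%:R * \sum_(i | r i <= T) 16 * cGK ^+ 2 * r i ^+ 2)).
    rewrite ler_wpM2l ?(ltW mR) //; apply: ler_sum => i _.
    have := Zmom 2%N i erefl; rewrite (eq_fE pp (G := fun o => Z i o ^+ 2)); last first.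
      by move=> o _; rewrite real_normK ?num_real.
    by move/le_trans; apply; rewrite le_eqVlt; apply/orP; left; apply/eqP; ring.
  rewrite -mulr_sumr; have : m%:R * (m%:R * T ^+ 2) = 4 * R4 ^+ 2.
    have -> : m%:R * (m%:R * T ^+ 2) = (m%:R * T) ^+ 2 by ring.
    by rewrite mT; ring.
  have : m%:R * (\sum_(i | r i <= T) r i ^+ 2) <= m%:R * (m%:R * T ^+ 2).
    by rewrite ler_wpM2l ?(ltW mR).
  have : 0 <= cGK ^+ 2 by exact: sqr_ge0.
  by move: (\sum_(i | _) _) (cGK ^+ 2) (T ^+ 2) (R4 ^+ 2) => s k t u; nra.
have E4 : fE (pw w) (fun o => g4 o ^+ 2) <= 4 * (16 * cGK) ^+ 8 * R4 ^+ 2.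
  (* Cauchy-Schwarz with the weights [r i] leads to eighth moments of [Z i], of order [r i ^ 8]; the
     surplus powers of [r i] are absorbed by [r i <= T]. *)
  apply: (@le_trans _ _ (fE (pw w) (fun o => m%:R * T ^+ 2 *
      \sum_(i | r i <= T) Z i o ^+ 8 * (r i ^+ 4 * T ^+ 4)^-1))).
    apply: fE_le => // o _.
    rewrite /g4 (eq_bigr (fun i => r i * (Z i o ^+ 4 / (r i ^+ 2 * T ^+ 2)))); last first.
      move=> i _; case: (eqVneq (r i) 0) => ri; last by field; rewrite ri gt_eqF.
      by rewrite ri Z0 // expr0n /= !mul0r.
    apply: le_trans (sum_CauchySchwarz _ _ _) _; apply: ler_pM => //.
    - by apply: sumr_ge0 => i _; rewrite sqr_ge0.
    - by apply: sumr_ge0 => i _; rewrite sqr_ge0.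
    rewrite le_eqVlt; apply/orP; left; apply/eqP; apply: eq_bigr => i _.
    by rewrite exprMn exprVn -exprM exprMn -!exprM.
  rewrite fEZ fE_sum.
  apply: (@le_trans _ _ (m%:R * T ^+ 2 * \sum_(i | r i <= T) (16 * cGK) ^+ 8 * (r i ^+ 2 / T ^+ 2))).
    apply: ler_wpM2l; first exact: mulr_ge0 (ltW mR) (sqr_ge0 T).
    apply: ler_sum => i riT.
    case: (eqVneq (r i) 0) => ri.
      rewrite ri !expr0n /= !mul0r mulr0 (eq_fE pp (G := fun=> 0)) ?fE_cst // => o _.
      by rewrite Z0 // expr0n mul0r.
    have rp : 0 < r i by rewrite lt_neqAle eq_sym ri r0.
    rewrite fEZr (eq_fE pp (G := fun o => `|Z i o| ^+ 8)); last first.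
      by move=> o _; rewrite -normrX ger0_norm // -[8%N]/(4 * 2)%N exprM sqr_ge0.
    apply: (@le_trans _ _ ((cGK * (r i * (2 * 8%:R))) ^+ 8 * (r i ^+ 4 * T ^+ 4)^-1)).
      by rewrite ler_wpM2r ?Zmom // invr_ge0 mulr_ge0 ?exprn_ge0 // ltW.
    have -> : (cGK * (r i * (2 * 8%:R))) ^+ 8 * (r i ^+ 4 * T ^+ 4)^-1 =
      (16 * cGK) ^+ 8 * ((r i / T) ^+ 2 * (r i / T) ^+ 2).
      by field; rewrite ri gt_eqF.
    rewrite ler_wpM2l ?exprn_ge0 ?mulr_ge0 ?(ltW G0) // -[r i ^+ 2 / T ^+ 2]expr_div_n.
    have u1 : r i / T <= 1 by rewrite ler_pdivrMr // mul1r.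
    have u0 : 0 <= r i / T by rewrite divr_ge0 // ltW.
    by rewrite ler_piMl ?sqr_ge0 // exprn_ile1.
  rewrite -mulr_sumr -mulr_suml mulrCA.
  have h : (\sum_(i | r i <= T) r i ^+ 2) / T ^+ 2 <= m%:R by rewrite ler_pdivrMr ?exprn_gt0.
  have -> : 4 * (16 * cGK) ^+ 8 * R4 ^+ 2 = (16 * cGK) ^+ 8 * (m%:R * T ^+ 2 * m%:R).
    have -> : m%:R * T ^+ 2 * m%:R = (m%:R * T) ^+ 2 by ring.
    by rewrite mT; ring.
  rewrite ler_wpM2l ?exprn_ge0 ?mulr_ge0 ?(ltW G0) // ler_wpM2l //.
  exact: mulr_ge0 (ltW mR) (sqr_ge0 T).
have E5 : fE (pw w) (fun o => g5 o ^+ 2) <= 2 * B ^+ 2.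
  apply: (fE_sq_le pp m2 B0).
  rewrite (eq_fE pp (G := S)); last first.
    by move=> o _; case: (hg5 o) => u0 <-; rewrite ger0_norm.
  rewrite fE_sum; apply: (@le_trans _ _ (\sum_(c | config (m := m) r R4 c) (cGK * (3 * R5)) ^+ m)).
    apply: ler_sum => c cc.
    rewrite (eq_fE pp (G := fun o => `|\sum_j (\sum_i cpoint N c i * b i j) * Y j (o j)| ^+ m)).
      apply: (linear_form_moment YN) => //; first by rewrite mulr_ge0.
      move=> y By; have := h5 _ y (cpoint_ball N cc) By.
      have -> : \sum_i \sum_j b i j * (3^-1 * cpoint N c i) * y j =
          3^-1 * \sum_j (\sum_i cpoint N c i * b i j) * y j.
        rewrite exchange_big mulr_sumr /=; apply: eq_bigr => j _.
        by rewrite mulr_suml mulr_sumr; apply: eq_bigr => i _; ring.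
      lra.
    move=> o _; congr (`| _ | ^+ _); under eq_bigr do rewrite mulr_sumr.
    rewrite exchange_big /=; apply: eq_bigr => j _; rewrite mulr_suml.
    by apply: eq_bigr => i _; rewrite mulrA.
  have cR : (cGK * (3 * R5)) ^+ m = (cGK * (3 * R5)) ^+ m * 1 by rewrite mulr1.
  under eq_bigr do rewrite cR; rewrite -mulr_sumr.
  apply: (@le_trans _ _ ((cGK * (3 * R5)) ^+ m * expR 47 ^+ m)).
    rewrite ler_wpM2l ?exprn_ge0 ?mulr_ge0 ?(ltW G0) //; exact: (card_config m0 R40 r0 h4).
  rewrite -exprMn; apply: lerXn2r; rewrite ?nnegrE ?(ltW B0) //.
    by rewrite !mulr_ge0 ?expR_ge0 ?(ltW G0).
  have e0 := expR_gt0 (47 : R); rewrite /B.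
  have -> : cGK * (3 * R5) * expR 47 = 3 * (expR 47 * cGK) * R5 by ring.
  by rewrite ler_wpM2l ?mulr_ge0 ?(ltW e0) ?(ltW G0) // lerDr ltW.
pose G o := q * g1 o + 2 * R4 + g4 o + 2 * g5 o.
have G_ge0 o : 0 <= G o.
  rewrite /G; case: (hg5 o) => u0 _; have := g40 o.
  have : 0 <= q * g1 o by rewrite mulr_ge0 ?sqrtr_ge0 // ltW.
  by lra.
exists G; split=> // [|o x Bx].
  apply: (@le_trans _ _ (fE (pw w) (fun o => 4 * (q * g1 o) ^+ 2 + 16 * R4 ^+ 2 +
      4 * g4 o ^+ 2 + 16 * g5 o ^+ 2))).
    apply: fE_le => // o _; rewrite /G; move: (q * g1 o) (g4 o) (g5 o) => x y z.
    have := sqr_ge0 (x - 2 * R4); have := sqr_ge0 (x - y); have := sqr_ge0 (x - 2 * z).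
    have := sqr_ge0 (2 * R4 - y); have := sqr_ge0 (2 * R4 - 2 * z); have := sqr_ge0 (y - 2 * z).
    by nra.
  rewrite !fED !fEZ fE_cst // -?expr2.
  set s := R4 + R5; have Rs : R4 ^+ 2 <= s ^+ 2 by rewrite ler_sqr ?nnegrE /s; lra.
  have kc : cGK ^+ 2 <= (16 * cGK) ^+ 8 / 256.
    have : 1 <= (16 * cGK) ^+ 6 by apply: exprn_ege1; lra.
    have -> : (16 * cGK) ^+ 8 / 256 = cGK ^+ 2 * (16 * cGK) ^+ 6 by field.
    by move=> h; rewrite ler_peMr ?sqr_ge0.
  have k1 : 16 <= (16 * cGK) ^+ 8.
    have : 1 <= (16 * cGK) ^+ 7 by apply: exprn_ege1; lra.
    by rewrite exprS; nra.
  (* 25 and 324 are the squares of the coefficients 5 and 18 in [cRC]. *)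
  apply: (@le_trans _ _ ((25 * (16 * cGK) ^+ 8 + 324 * (expR 47 * cGK) ^+ 2) * s ^+ 2)).
    have B2 : B ^+ 2 = 9 * (expR 47 * cGK) ^+ 2 * s ^+ 2 by rewrite /B -/s; ring.
    rewrite B2 in E5; have s2 := sqr_ge0 s; have R2 := sqr_ge0 R4.
    have e2 : 0 <= (expR 47 * cGK) ^+ 2 * s ^+ 2 by rewrite mulr_ge0 ?sqr_ge0.
    move: E1 E4 E5 kc k1 e2 (sqr_ge0 cGK); move: ((16 * cGK) ^+ 8) (cGK ^+ 2) ((expR 47 * cGK) ^+ 2).
    move: (fE _ _) (fE _ _) (fE _ _) Rs s2 R2; move: (R4 ^+ 2) (s ^+ 2) => u t e f g.
    move=> ut t0 u0 k c h E1 E4 E5 kc k1 e2 c0.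
    have ku : k * u <= k * t by rewrite ler_wpM2l //; lra.
    have cu : c * u <= k / 256 * t by exact: ler_pM.
    have kt : 16 * t <= k * t by rewrite ler_wpM2r.
    lra.
  rewrite [leRHS]exprMn ler_wpM2r ?sqr_ge0 // /cRC.
  have -> : (16 * cGK) ^+ 8 = ((16 * cGK) ^+ 4) ^+ 2 by rewrite -exprM.
  have : 0 <= (16 * cGK) ^+ 4 * (expR 47 * cGK).
    by rewrite mulr_ge0 ?exprn_ge0 ?mulr_ge0 ?expR_ge0 ?(ltW G0).
  by move: ((16 * cGK) ^+ 4) (expR 47 * cGK) => x y; nra.
have [c cc hc] := cpoint_dominates m0 R40 r0 h4 (Z^~ o) Bx.
have hW : \sum_i cpoint N c i * Z i o <= g5 o.
  case: (hg5 o) => u0 um; apply: le_trans (ler_norm _) _.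
  rewrite -(@ler_pXn2r _ m) ?nnegrE // um /S (bigD1 c) //= lerDl.
  by apply: sumr_ge0 => c' _; rewrite exprn_ge0.
have h1 : \sum_(i | (`|x i| <= 1) && (r i <= T)) `|x i| * `|Z i o| <= q * g1 o.
  apply: le_trans (ler_norm _) _; apply: ler_sqr_norm.
    by rewrite mulr_ge0 ?sqrtr_ge0 // ltW.
  apply: le_trans (sum_CauchySchwarz _ _ _) _; rewrite exprMn q2 g1_sq.
  apply: ler_pM; try by apply: sumr_ge0 => i _; rewrite sqr_ge0.
    under eq_bigr do rewrite real_normK ?num_real //.
    apply: le_trans (ball_small_part Bx); rewrite [leLHS]big_mkcondr /=.
    by apply: ler_sum => i _; case: ifP => _; rewrite ?lexx ?sqr_ge0.
  under eq_bigr do rewrite real_normK ?num_real //.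
  rewrite big_andbC big_mkcondr /=.
  by apply: ler_sum => i _; case: ifP => _; rewrite ?lexx ?sqr_ge0.
have h3 : \sum_(i | ~~ (`|x i| <= 1)) `|x i| * T <= 2 * R4.
  rewrite -mulr_suml -mT ler_wpM2r ?(ltW T0) //; exact: ball_large_part Bx.
apply: (@le_trans _ _ (\sum_i `|x i| * `|Z i o|)).
  by apply: ler_sum => i _; rewrite -normrM ler_norm.
apply: (@le_trans _ _ (\sum_(i | (`|x i| <= 1) && (r i <= T)) `|x i| * `|Z i o| +
   \sum_(i | ~~ (`|x i| <= 1)) `|x i| * T + g4 o +
   \sum_(i | if `|x i| <= 1 then T < r i else T < `|x i| * r i) `|x i| * `|Z i o|)).
  rewrite /g4 [X in X + _ + _ + _]big_mkcond [X in _ + X + _ + _]big_mkcond.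
  rewrite [X in _ + _ + X + _]big_mkcond [X in _ + _ + _ + X]big_mkcond -!big_split /=.
  apply: ler_sum => i _; set a := `|x i|; set z := `|Z i o|.
  have a0 : 0 <= a by exact: normr_ge0.
  have z0 : 0 <= z by exact: normr_ge0.
  have t4 : 0 <= (if r i <= T then Z i o ^+ 4 / (r i * T ^+ 2) else 0).
    by case: ifP => // _; rewrite divr_ge0 // mulr_ge0 ?sqr_ge0.
  have az : 0 <= a * z by rewrite mulr_ge0.
  have aT : 0 <= a * T by rewrite mulr_ge0 // ltW.
  case: (leP a 1) => a1 /=.
    case: (leP (r i) T) => riT /=.
      by rewrite riT in t4; rewrite !addr0 lerDl.
    by rewrite !add0r.
  rewrite add0r; case: (leP (a * r i) T) => arT; last by rewrite lerDr addr_ge0.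
  rewrite addr0; case: (leP z T) => zT.
    by apply: ler_wpDr => //; rewrite ler_wpM2l.
  have ri0 : 0 < r i.
    rewrite lt_neqAle r0 andbT eq_sym; apply: contraTneq zT => /Z0 Zz.
    by rewrite /z Zz normr0 -leNgt ltW.
  have -> : r i <= T by apply: le_trans arT; rewrite ler_peMl // ltW.
  apply: ler_wpDl => //; rewrite ler_pdivlMr; last exact: mulr_gt0 ri0 (exprn_gt0 2 T0).
  have -> : Z i o ^+ 4 = z ^+ 4 by rewrite -normrX ger0_norm.
  have -> : a * z * (r i * T ^+ 2) = (a * r i) * (z * T ^+ 2) by ring.
  apply: (@le_trans _ _ (T * (z * T ^+ 2))).
    by rewrite ler_wpM2r // mulr_ge0 ?sqr_ge0.
  have -> : T * (z * T ^+ 2) = z * T ^+ 3 by ring.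
  rewrite (exprS z 3) ler_wpM2l //; apply: lerXn2r; rewrite ?nnegrE ?(ltW T0) //; exact: ltW.
rewrite /G; apply: lerD; last by apply: le_trans hc _; rewrite ler_wpM2l.
by rewrite lerD2r; apply: lerD.
Qed.

End RealChaosSup.

(** * The upper bound on finite spaces *)

Section ChaosUpper.
Context {R : realType}.
Local Notation cost := (cost (R := R)).
Local Notation cGK := (@cGK R).
Local Notation cRC := (@cRC R).
Local Notation cHL := (@cHL R).

Definition pairW (O1 O2 : finType) (W1 : O1 -> R) (W2 : O2 -> R) (o : O1 * O2) : R :=
  W1 o.1 * W2 o.2.

Lemma fE_pair (O1 O2 : finType) (W1 : O1 -> R) (W2 : O2 -> R) F :
  fE (pairW W1 W2) F = fE W1 (fun x => fE W2 (fun y => F (x, y))).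
Proof.
rewrite /fE sum_pair; apply: eq_bigr => x _; rewrite mulr_sumr.
by apply: eq_bigr => y _; rewrite /pairW /= mulrA.
Qed.

Lemma fprob_pair (O1 O2 : finType) (W1 : O1 -> R) (W2 : O2 -> R) :
  fprob W1 -> fprob W2 -> fprob (pairW W1 W2).
Proof.
move=> p1 p2; split=> [x|]; first by rewrite mulr_ge0 //; [case: p1|case: p2].
transitivity (fE (pairW W1 W2) (fun=> 1)); first by apply: eq_bigr => x _; rewrite mulr1.
by rewrite fE_pair fE_cst // fE_cst.
Qed.

Lemma pairW_gt0 (O1 O2 : finType) (W1 : O1 -> R) (W2 : O2 -> R) x y :
  fprob W1 -> fprob W2 -> 0 < pairW W1 W2 (x, y) -> 0 < W1 x /\ 0 < W2 y.
Proof.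
move=> [p1 _] [p2 _]; rewrite /pairW /= => h.
by split; rewrite lt_neqAle ?p1 ?p2 andbT eq_sym; apply: contraTneq h => ->;
  rewrite ?mul0r ?mulr0 ltxx.
Qed.

Definition kn : R := (8 * cGK) ^+ 4.

Lemma kn_ge1 : 1 <= kn.
Proof. by apply: exprn_ege1; have := @cGK_ge1 R; lra. Qed.

Lemma linear_form_fourth (I V : finType) (w X : I -> V -> R) (N : I -> cost)
    (b : I -> R) (s : R) :
  (forall i, subN (w i) (X i) (N i)) -> 0 <= s -> \sum_i b i ^+ 2 <= s ^+ 2 ->
  fE (pw w) (fun o => (\sum_i b i * X i (o i)) ^+ 4) <= kn * s ^+ 4.
Proof.
move=> XN s0 bs; have wp : fprob (pw w) by apply: fprob_pw => i; case: (XN i).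
have -> : kn * s ^+ 4 = (cGK * (s * (2 * 4%:R))) ^+ 4 by rewrite /kn; ring.
rewrite (eq_fE wp (G := fun o => `|\sum_i b i * X i (o i)| ^+ 4)).
  exact: linear_form_moment_l2.
by move=> o _; rewrite -normrX ger0_norm // -[4%N]/(2 * 2)%N exprM sqr_ge0.
Qed.

(** Cauchy-Schwarz weighted by the column norms [s k] reduces the claim to scalar fourth moments, so
    the number of coordinates does not enter. *)
Lemma hilbert_form_fourth (I V K : finType) (w X : I -> V -> R) (N : I -> cost)
    (v : I -> K -> R) (r : R) :
  (forall i, subN (w i) (X i) (N i)) -> \sum_k \sum_i v i k ^+ 2 = r ^+ 2 ->
  fE (pw w) (fun o => (\sum_k (\sum_i v i k * X i (o i)) ^+ 2) ^+ 2) <= kn * r ^+ 4.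
Proof.
move=> XN vr; have wp : fprob (pw w) by apply: fprob_pw => i; case: (XN i).
pose s k := l2 (v^~ k); pose U k (o : {ffun I -> V}) := \sum_i v i k * X i (o i).
have U0 k o : s k = 0 -> U k o = 0.
  move=> sk; rewrite /U big1 // => i _; have : v i k ^+ 2 <= 0.
    have -> : 0 = s k ^+ 2 by rewrite sk expr0n.
    by rewrite l2_sqr (bigD1 i) //= lerDl sumr_ge0 // => j _; rewrite sqr_ge0.
  by rewrite le_eqVlt ltNge sqr_ge0 orbF sqrf_eq0 => /eqP->; rewrite mul0r.
apply: (@le_trans _ _ (fE (pw w) (fun o => r ^+ 2 * \sum_k U k o ^+ 4 * (s k ^+ 2)^-1))).
  apply: fE_le => // o _; rewrite (eq_bigr (fun k => s k * (U k o ^+ 2 / s k))).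
    apply: le_trans (sum_CauchySchwarz _ _ _) _; rewrite -vr.
    under eq_bigr do rewrite l2_sqr; rewrite ler_wpM2l //.
      by apply: sumr_ge0 => k _; exact: sum_sqr_ge0.
    rewrite le_eqVlt; apply/orP; left; apply/eqP; apply: eq_bigr => k _.
    by rewrite exprMn exprVn -exprM.
  move=> k _; rewrite -/(U k o); case: (eqVneq (s k) 0) => sk; last by field.
  by rewrite U0 // sk expr0n !mul0r.
rewrite fEZ fE_sum; have -> : kn * r ^+ 4 = r ^+ 2 * (kn * r ^+ 2) by ring.
rewrite ler_wpM2l ?sqr_ge0 // -vr mulr_sumr; apply: ler_sum => k _.
rewrite fEZr -l2_sqr -/(s k).
have h : fE (pw w) (fun o => U k o ^+ 4) <= kn * s k ^+ 4.
  by apply: linear_form_fourth => //; rewrite ?l2_ge0 ?l2_sqr.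
case: (eqVneq (s k) 0) => sk; first by rewrite sk expr0n /= invr0 !mulr0.
rewrite ler_pdivrMr ?exprn_even_gt0 //; apply: le_trans h _.
by rewrite le_eqVlt; apply/orP; left; apply/eqP; ring.
Qed.

(** [expR 4 ^ 4] is the factor [c ^ 2] of [sup_over_tilts] for a density that tilts both [y] and
    [f]; [32] is the 2 of that lemma times the 16 that undoes two means reduced by 4. *)
Definition cCS : R := 32 * expR 4 ^+ 4 * (cGK * (4 * cRC + 16 * kn)).

Section ChaosSup.
Variables (I J K V : finType) (wX X : I -> V -> R) (NX : I -> cost) (NY : J -> cost).
Variables (a : I -> J -> K -> R) (m : nat) (M : R).
Hypothesis XN : forall i, subN (wX i) (X i) (NX i).
Hypotheses (m4 : (4 <= m)%N) (M0 : 0 < M).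
Hypothesis H1 : \sum_i \sum_j \sum_k a i j k ^+ 2 <= M ^+ 2.
Hypothesis H3 : forall y, ball NY m%:R y ->
  \sum_i \sum_k (\sum_j y j * a i j k) ^+ 2 <= M ^+ 2.
Hypothesis H4 : forall f x, \sum_k f k ^+ 2 <= 1 -> ball NX m%:R x ->
  \sum_i x i * l2 (fun j => \sum_k f k * a i j k) <= M.
Hypothesis H5 : forall x y, ball NX m%:R x -> ball NY m%:R y ->
  \sum_k (\sum_i \sum_j x i * y j * a i j k) ^+ 2 <= M ^+ 2.
Hypothesis H2 : forall x, ball NX m%:R x ->
  \sum_j \sum_k (\sum_i x i * a i j k) ^+ 2 <= M ^+ 2.

Local Notation L := ((K * 'I_m)%type : finType).
Local Notation OY := {ffun J -> bool * 'I_m.+2}.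
Local Notation OF := {ffun L -> bool * 'I_m.+2}.

Let m0 : (0 < m)%N. Proof. by apply: leq_trans m4. Qed.
Let mR : 0 < m%:R :> R. Proof. by rewrite ltr0n. Qed.

Definition ey (o : OY) (j : J) : R := pval (NY j) (o j).
Definition ef (o : OF) (k : K) : R := m%:R^-1 * \sum_(l < m) pval radcost (o (k, l)).
Definition bb (o : OY * OF) (i : I) : R := \sum_j \sum_k a i j k * ey o.1 j * ef o.2 k.

(** Averaging [m] independent copies gains [1 / sqrt m], that is [1 / m ^ 2] in the fourth moment,
    as [noise_bound] requires. *)
Lemma prior_functional_fourth (D : L -> bool * 'I_m.+2 -> R) (f : K -> R) (u : K -> R) (r : R) :
  (forall p, subN (fun v => @pwt R m.+1 v * D p v) (fun v => pval radcost v - f p.1 / 4) radcost) ->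
  0 <= r -> \sum_k u k ^+ 2 <= r ^+ 2 ->
  fE (pw (fun p v => @pwt R m.+1 v * D p v))
     (fun o => (\sum_k u k * (ef o k - f k / 4)) ^+ 4) <= kn * (r ^+ 4 / m%:R ^+ 2).
Proof.
move=> subD r0 ur; pose q : R := Num.sqrt m%:R; have q0 : 0 < q by rewrite sqrtr_gt0.
have q2 : q ^+ 2 = m%:R by rewrite sqr_sqrtr // ltW.
have mn0 : m%:R != 0 :> R by rewrite gt_eqF.
have pp : fprob (pw (fun p v => @pwt R m.+1 v * D p v)).
  by apply: fprob_pw => p; case: (subD p).
rewrite (eq_fE pp (G := fun o => (\sum_(p : L) (m%:R^-1 * u p.1) *
   (fun v => pval radcost v - f p.1 / 4) (o p)) ^+ 4)).
  have -> : r ^+ 4 / m%:R ^+ 2 = (r / q) ^+ 4 by rewrite -q2; field; rewrite gt_eqF.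
  apply: linear_form_fourth subD _ _; first by rewrite divr_ge0 // ltW.
  rewrite sum_pair /= [leRHS]exprMn exprVn q2.
  rewrite (eq_bigr (fun k => m%:R^-1 * u k ^+ 2)); last first.
    by move=> k _; rewrite sumr_const card_ord -[LHS]mulr_natl; field.
  by rewrite -mulr_sumr mulrC ler_wpM2r // invr_ge0 ltW.
move=> o _; congr (_ ^+ _); rewrite sum_pair; apply: eq_bigr => k _ /=.
by rewrite -mulr_sumr sumrB sumr_const card_ord -[_ *+ m]mulr_natl /ef; field.
Qed.

(** Expansion of the product of [ey = ys + (ey - ys)] and [ef = f / 4 + (ef - f / 4)]. *)
Lemma prior_split (o : OY * OF) (x : I -> R) (ys : J -> R) (f : K -> R) :
  \sum_i x i * bb o i =
    4^-1 * (\sum_k f k * \sum_i \sum_j x i * ys j * a i j k) +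
    4^-1 * (\sum_i x i * \sum_j (\sum_k f k * a i j k) * (ey o.1 j - ys j)) +
    \sum_i x i * (\sum_k (\sum_j ys j * a i j k) * (ef o.2 k - f k / 4)) +
    \sum_i x i * (\sum_k (\sum_j a i j k * (ey o.1 j - ys j)) * (ef o.2 k - f k / 4)).
Proof.
have -> : \sum_k f k * (\sum_i \sum_j x i * ys j * a i j k) =
    \sum_i x i * \sum_j \sum_k f k * ys j * a i j k.
  under eq_bigr do rewrite mulr_sumr; rewrite exchange_big; apply: eq_bigr => i _ /=.
  rewrite mulr_sumr; under eq_bigr do rewrite mulr_sumr.
  rewrite exchange_big; apply: eq_bigr => j _; rewrite mulr_sumr; apply: eq_bigr => k _.
  by ring.
have ex (F : J -> K -> R) (G : K -> R) : \sum_k (\sum_j F j k) * G k = \sum_j \sum_k F j k * G k.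
  by under eq_bigr do rewrite mulr_suml; rewrite exchange_big.
have quarter (F : I -> R) : 4^-1 * (\sum_i x i * F i) = \sum_i x i * (4^-1 * F i).
  by rewrite mulr_sumr; apply: eq_bigr => i _; rewrite mulrCA.
have D4 (t b c d e : R) : t * b + t * c + t * d + t * e = t * (b + c + d + e) by ring.
rewrite 2!quarter -!big_split /=; apply: eq_bigr => i _; rewrite D4; congr (_ * _).
rewrite !ex ![4^-1 * _]mulr_sumr -!big_split /=; apply: eq_bigr => j _.
rewrite mulr_suml ![4^-1 * _]mulr_sumr -!big_split /=; apply: eq_bigr => k _.
by field.
Qed.

Lemma dot_le (f u : K -> R) (c : R) : 0 <= c -> \sum_k f k ^+ 2 <= 1 ->
  \sum_k u k ^+ 2 <= c ^+ 2 -> \sum_k f k * u k <= c.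
Proof.
move=> c0 f1 uc; apply: le_trans (ler_norm _) _; apply: ler_sqr_norm => //.
apply: le_trans (sum_CauchySchwarz _ _ _) _; rewrite -[leRHS]mul1r.
by apply: ler_pM; rewrite ?sum_sqr_ge0.
Qed.

(** This is the bound on the weight [g + M] that [sup_over_tilts] requires. For a fixed prior sample
    the form is linear in [X], so [g] is controlled by a supremum over the ball of [X], which
    [prior_split] cuts into four parts. The mean part is at most [M / 2] by [H5]; the random parts
    need second moments only. *)
Lemma chaos_tilt_bound (f : K -> R) (g : OY * OF -> R)
    (DY : J -> bool * 'I_m.+2 -> R) (DF : L -> bool * 'I_m.+2 -> R)
    (sh : J -> bool * 'I_m.+2 -> R) :
  \sum_k f k ^+ 2 <= 1 ->
  (forall o : OY, ball NY m%:R (fun j => 2^-1 * sh j (o j))) ->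
  (forall j, subN (fun v => @pwt R m.+1 v * DY j v) (fun v => pval (NY j) v - sh j v) (NY j)) ->
  (forall p, subN (fun v => @pwt R m.+1 v * DF p v) (fun v => pval radcost v - f p.1 / 4) radcost) ->
  (forall o, 0 <= g o) ->
  (forall o, g o ^+ m = fE (pw wX) (fun x => `|\sum_i bb o i * X i (x i)| ^+ m)) ->
  fE (pairW (pw (fun j v => @pwt R m.+1 v * DY j v)) (pw (fun p v => @pwt R m.+1 v * DF p v)))
     (fun o => (g o + M) ^+ 2) <= (cGK * (4 * cRC + 16 * kn) * M) ^+ 2.
Proof.
move=> f1 shB subY subF g0 gm.
have wp i : fprob (wX i) by case: (XN i).
set PY := pw (fun j v => _); set PF := pw (fun p v => _).
have PYp : fprob PY by apply: fprob_pw => j; case: (subY j).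
have PFp : fprob PF by apply: fprob_pw => p; case: (subF p).
have PPp := fprob_pair PYp PFp.
have G1 := @cGK_ge1 R; have G0 : 0 < cGK by lra.
have M2 : 0 < 2 * M by rewrite mulr_gt0.
have k1 := kn_ge1; have kk1 : 1 <= kn ^+ 2 by apply: exprn_ege1.
have MM := ltW M0.
(* The second term of [prior_split] is a real chaos in the fluctuation of [y]; the third has
   noise in [f] only, the fourth in both. *)
have [G2 [G20 G2E HG2]] : exists G : OY -> R, [/\ forall o, 0 <= G o,
    fE PY (fun o => G o ^+ 2) <= (cRC * (M + M)) ^+ 2 &
    forall o x, ball NX m%:R x ->
      \sum_i x i * (\sum_j (\sum_k f k * a i j k) * (ey o j - sh j (o j))) <= G o].
  apply: (real_chaos_sup (b := fun i j => \sum_k f k * a i j k) subY) => //.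
  - by apply: leq_trans m4.
  - by move=> x Bx; exact: H4.
  - move=> x y' Bx By; apply: le_trans (dot_le MM f1 (H5 Bx By)).
    rewrite le_eqVlt; apply/orP; left; apply/eqP.
    under [RHS]eq_bigr do rewrite mulr_sumr; rewrite [RHS]exchange_big; apply: eq_bigr => i _ /=.
    under [RHS]eq_bigr do rewrite mulr_sumr; rewrite [RHS]exchange_big; apply: eq_bigr => j _ /=.
    by rewrite !mulr_suml; apply: eq_bigr => k _; ring.
(* Only half of [sh] is known to lie in the ball, hence the radius [2 M]. Once [y] is fixed, [z3] is
   linear in the noise of [f]. *)
pose v (o : OY) i k := \sum_j sh j (o j) * a i j k.
pose z3 (o : OY) i (o' : OF) := \sum_k v o i k * (ef o' k - f k / 4).
have half3 (o : OY) i k : \sum_j (2^-1 * sh j (o j)) * a i j k = 2^-1 * v o i k.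
  by rewrite /v mulr_sumr; apply: eq_bigr => j _; ring.
have v_sq o : \sum_i \sum_k v o i k ^+ 2 <= (2 * M) ^+ 2.
  have := H3 (shB o); under eq_bigr do under eq_bigr do rewrite half3 exprMn.
  under eq_bigr do rewrite -mulr_sumr; rewrite -mulr_sumr => h.
  by rewrite exprMn; move: h; move: (\sum_i _) => s; lra.
have xv_sq o x : ball NX m%:R x -> \sum_i (x i * l2 (v o i)) ^+ 2 <= (2 * M) ^+ 2.
  move=> Bx; rewrite (eq_bigr (fun i => \sum_k (x i * v o i k) ^+ 2)); last first.
    by move=> i _; rewrite exprMn l2_sqr mulr_sumr; apply: eq_bigr => k _; rewrite exprMn.
  rewrite exchange_big /=; apply: sign_average => s s1.
  have := H5 (ballM s1 Bx) (shB o).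
  have E k : \sum_i \sum_j s i * x i * (2^-1 * sh j (o j)) * a i j k =
      2^-1 * \sum_i s i * (x i * v o i k).
    rewrite mulr_sumr; apply: eq_bigr => i _; rewrite /v !mulr_sumr.
    by apply: eq_bigr => j _; ring.
  under eq_bigr do rewrite E exprMn; rewrite -mulr_sumr => h.
  by rewrite exprMn; move: h; move: (\sum_k _) => t; lra.
have /choice[G3 HG3] o : exists G : OF -> R, [/\ forall o', 0 <= G o',
    fE PF (fun o' => G o' ^+ 2) <= 12 * kn * (2 * M) ^+ 2 &
    forall o' x, 0 < PF o' -> ball NX m%:R x -> \sum_i (x i * l2 (v o i)) ^+ 2 <= (2 * M) ^+ 2 ->
      `|\sum_i x i * z3 o i o'| <= G o'].
  apply: noise_bound => //; first by move=> i; exact: l2_ge0.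
    by under eq_bigr do rewrite l2_sqr; exact: v_sq.
  by move=> i; apply: prior_functional_fourth => //; rewrite ?l2_ge0 ?l2_sqr.
(* With noise in both variables the row norms are those of [a] itself, and the constant is [kn ^ 2],
   one factor per noise. *)
pose U (o : OY) i k := \sum_j a i j k * (ey o j - sh j (o j)).
pose z4 i (o : OY * OF) := \sum_k U o.1 i k * (ef o.2 k - f k / 4).
pose r i := Num.sqrt (\sum_k \sum_j a i j k ^+ 2).
have r2 i : r i ^+ 2 = \sum_k \sum_j a i j k ^+ 2.
  by rewrite sqr_sqrtr //; apply: sumr_ge0 => k _; exact: sum_sqr_ge0.
have [|||G4 [G40 G4E HG4]] := @noise_bound R _ _ (pairW PY PF) z4 r NX m M (kn ^+ 2) PPp m0 M0 kk1.
- by move=> i; exact: sqrtr_ge0.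
- by under eq_bigr do rewrite r2 exchange_big.
- move=> i; rewrite fE_pair.
  apply: (@le_trans _ _ (fE PY (fun o => kn / m%:R ^+ 2 * (\sum_k U o i k ^+ 2) ^+ 2))).
    apply: fE_le => // o _; rewrite [leRHS]mulrAC -[leRHS]mulrA.
    have -> : (\sum_k U o i k ^+ 2) ^+ 2 = l2 (U o i) ^+ 4 by rewrite -l2_sqr -exprM.
    by apply: (prior_functional_fourth (u := U o i) subF); rewrite ?l2_ge0 ?l2_sqr.
  rewrite fEZ; have h := hilbert_form_fourth subY (esym (r2 i)).
  apply: (@le_trans _ _ (kn / m%:R ^+ 2 * (kn * r i ^+ 4))).
    by rewrite ler_wpM2l // divr_ge0 ?sqr_ge0 //; lra.
  by rewrite le_eqVlt; apply/orP; left; apply/eqP; field; rewrite gt_eqF.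
have xr_sq x : ball NX m%:R x -> \sum_i (x i * r i) ^+ 2 <= M ^+ 2.
  move=> Bx; rewrite (eq_bigr (fun i => \sum_(p : J * K) (x i * a i p.1 p.2) ^+ 2)); last first.
    move=> i _; rewrite exprMn r2 sum_pair /= exchange_big mulr_sumr; apply: eq_bigr => j _.
    by rewrite mulr_sumr; apply: eq_bigr => k _; rewrite exprMn.
  rewrite exchange_big /=; apply: sign_average => s s1; rewrite sum_pair /=.
  by under eq_bigr do under eq_bigr do under eq_bigr do rewrite mulrA; exact: H2 (ballM s1 Bx).
have gle o : 0 < pairW PY PF o -> g o <= cGK * (2^-1 * M + 4^-1 * G2 o.1 + G3 o.1 o.2 + G4 o).
  case: o => oy of_ Po; have [Py Pf] := pairW_gt0 PYp PFp Po.
  have [G30 _ HG] := HG3 oy.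
  have T0 : 0 <= 2^-1 * M + 4^-1 * G2 oy + G3 oy of_ + G4 (oy, of_).
    by rewrite !addr_ge0 ?mulr_ge0 ?invr_ge0.
  rewrite -(@ler_pXn2r _ m) ?nnegrE ?mulr_ge0 ?(ltW G0) // gm.
  apply: (linear_form_moment XN) => // x Bx.
  under eq_bigr do rewrite mulrC; rewrite (prior_split _ _ (fun j => sh j (oy j)) f) /=.
  have h1 : \sum_k f k * (\sum_i \sum_j x i * sh j (oy j) * a i j k) <= 2 * M.
    apply: dot_le f1 _; first exact: ltW.
    have := H5 Bx (shB oy).
    have E k : \sum_i \sum_j x i * (2^-1 * sh j (oy j)) * a i j k =
        2^-1 * \sum_i \sum_j x i * sh j (oy j) * a i j k.
      by rewrite mulr_sumr; apply: eq_bigr => i _; rewrite mulr_sumr; apply: eq_bigr => j _; ring.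
    under eq_bigr do rewrite E exprMn; rewrite -mulr_sumr => h.
    by rewrite exprMn; move: h; move: (\sum_k _) => t; lra.
  have h2 := HG2 oy x Bx.
  have h3 := le_trans (ler_norm _) (HG of_ x Pf Bx (xv_sq oy x Bx)).
  have h4 := le_trans (ler_norm _) (HG4 (oy, of_) x Po Bx (xr_sq x Bx)).
  apply: lerD; last exact: h4; apply: lerD; last exact: h3.
  by move: h1 h2; move: (\sum_k _) (\sum_i _) => A B; lra.
apply: (@le_trans _ _ (fE (pairW PY PF) (fun o => cGK ^+ 2 *
    (16 * M ^+ 2 + (4 * G2 o.1 ^+ 2 + (4 * G3 o.1 o.2 ^+ 2 + 4 * G4 o ^+ 2)))))).
  apply: fE_le => // o Po.
  have [G30 _ _] := HG3 o.1.
  have h : g o + M <= cGK * (2 * M + G2 o.1 + G3 o.1 o.2 + G4 o).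
    have := gle o Po; have := G20 o.1; have := G30 o.2; have := G40 o => a4 a3 a2 h.
    apply: le_trans (lerD h (lexx M)) _.
    have : M <= cGK * M by rewrite ler_peMl.
    have : 0 <= cGK * M by rewrite mulr_ge0 // ltW.
    have : 0 <= cGK * G2 o.1 by rewrite mulr_ge0 // ltW.
    by lra.
  apply: (@le_trans _ _ ((cGK * (2 * M + G2 o.1 + G3 o.1 o.2 + G4 o)) ^+ 2)).
    rewrite ler_sqr ?nnegrE ?addr_ge0 //.
    by rewrite mulr_ge0 ?(ltW G0) // !addr_ge0 // ltW.
  rewrite exprMn ler_wpM2l ?sqr_ge0 //.
  move: (G2 _) (G3 _ _) (G4 _) => t u z.
  have := sqr_ge0 (t - u); have := sqr_ge0 (t - z); have := sqr_ge0 (u - z).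
  have := sqr_ge0 (2 * M - t); have := sqr_ge0 (2 * M - u); have := sqr_ge0 (2 * M - z).
  by nra.
rewrite fEZ fED (fE_cst PPp) fED fED fEZ fEZ fEZ.
have -> : fE (pairW PY PF) (fun o => G2 o.1 ^+ 2) = fE PY (fun o => G2 o ^+ 2).
  by rewrite fE_pair; apply: eq_fE => // o _; rewrite /= (fE_cst PFp).
have E3 : fE (pairW PY PF) (fun o => G3 o.1 o.2 ^+ 2) <= 12 * kn * (2 * M) ^+ 2.
  by rewrite fE_pair; apply: fE_lebound => // o _; case: (HG3 o).
have -> : (cGK * (4 * cRC + 16 * kn) * M) ^+ 2 = cGK ^+ 2 * ((4 * cRC + 16 * kn) * M) ^+ 2 by ring.
rewrite ler_wpM2l ?sqr_ge0 //.
have c1 := @cRC_ge1 R; move: G2E E3 G4E.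
move: (fE _ _) (fE _ _) (fE _ _) => e4 e3 e2 E2 E3 E4.
have s2 := sqr_ge0 M.
have t1 : M ^+ 2 <= kn ^+ 2 * M ^+ 2 by rewrite ler_peMl.
have t2 : kn * M ^+ 2 <= kn ^+ 2 * M ^+ 2 by rewrite ler_wpM2r // expr2 ler_peMl //; lra.
have t3 : 0 <= cRC * kn * M ^+ 2 by rewrite mulr_ge0 // mulr_ge0; lra.
have -> : ((4 * cRC + 16 * kn) * M) ^+ 2 =
   16 * (cRC ^+ 2 * M ^+ 2) + 128 * (cRC * kn * M ^+ 2) + 256 * (kn ^+ 2 * M ^+ 2) by ring.
have E2' : e2 <= 4 * (cRC ^+ 2 * M ^+ 2) by apply: le_trans E2 _; rewrite le_eqVlt; apply/orP; left; apply/eqP; ring.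
have E3' : e3 <= 48 * (kn * M ^+ 2) by apply: le_trans E3 _; rewrite le_eqVlt; apply/orP; left; apply/eqP; ring.
have E4' : e4 <= 12 * (kn ^+ 2 * M ^+ 2) by apply: le_trans E4 _; rewrite mulrA.
clear E2 E3 E4; move: (cRC ^+ 2 * M ^+ 2) (cRC * kn * M ^+ 2) (kn ^+ 2 * M ^+ 2) (kn * M ^+ 2) (M ^+ 2) t1 t2 t3 E2' E3' E4' s2.
by move=> u1 u2 u3 u4 u5; lra.
Qed.

End ChaosSup.
End ChaosUpper.

(** * Moments of the Hilbert-valued chaos *)

Section ChaosMoment.
Context {R : realType}.
Local Notation cost := (cost (R := R)).
Local Notation cGK := (@cGK R).
Local Notation cRC := (@cRC R).
Local Notation cHL := (@cHL R).
Local Notation cCS := (@cCS R).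
Local Notation kn := (@kn R).

Lemma fE_pair_tilt (O1 O2 : finType) (W1 D1 : O1 -> R) (W2 D2 : O2 -> R) F :
  fE (pairW W1 W2) (fun o => D1 o.1 * D2 o.2 * F o) =
  fE W1 (fun x => D1 x * fE W2 (fun y => D2 y * F (x, y))).
Proof.
rewrite fE_pair; apply: eq_bigr => x _; congr (_ * _); rewrite -fEZ.
by apply: eq_bigr => y _; rewrite /= -!mulrA.
Qed.

Lemma cCS_ge1 : 1 <= cCS.
Proof.
have G1 := @cGK_ge1 R; have R1 := @cRC_ge1 R; have k1 := @kn_ge1 R.
have e1 : 1 <= expR 4 ^+ 4 :> R.
  by apply: exprn_ege1; have := expR_ge1Dx (4 : R); lra.
rewrite /cCS; move: (cGK) (cRC) (kn) (expR 4 ^+ 4) G1 R1 k1 e1 => u v w e G1 R1 k1 e1.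
have h : 1 <= u * (4 * v + 16 * w) by nra.
have h2 : 1 <= e * (u * (4 * v + 16 * w)) by exact: mulr_ege1.
lra.
Qed.

Section Family.
Variables (I J K : finType) (NX : I -> cost) (NY : J -> cost).
Variables (a : I -> J -> K -> R) (m : nat) (M : R).

(* [M] bounds the five deterministic quantities of the theorem, in Hilbert-Schmidt form. *)
Record chaos_bound : Prop := ChaosBound {
  cb_HS : \sum_i \sum_j \sum_k a i j k ^+ 2 <= M ^+ 2;
  cb_X : forall x, ball NX m%:R x -> \sum_j \sum_k (\sum_i x i * a i j k) ^+ 2 <= M ^+ 2;
  cb_Y : forall y, ball NY m%:R y -> \sum_i \sum_k (\sum_j y j * a i j k) ^+ 2 <= M ^+ 2;
  cb_weak : forall f x, \sum_k f k ^+ 2 <= 1 -> ball NX m%:R x ->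
    \sum_i x i * l2 (fun j => \sum_k f k * a i j k) <= M;
  cb_XY : forall x y, ball NX m%:R x -> ball NY m%:R y ->
    \sum_k (\sum_i \sum_j x i * y j * a i j k) ^+ 2 <= M ^+ 2 }.

Hypotheses (m4 : (4 <= m)%N) (M0 : 0 < M) (H : chaos_bound).

(** Every pair [(y, f)] is, up to scale, the mean of a tilt of one product prior. A single random
    factor [A] therefore serves all [y] at once, and [cCS * M * A x] can play [Rb] in
    [hilbert_linear_moment] conditionally on [X]. *)
Lemma chaos_sup (V : finType) (wX X : I -> V -> R) : (forall i, subN (wX i) (X i) (NX i)) ->
  exists A : {ffun I -> V} -> R, [/\ forall x, 0 < A x, fE (pw wX) (fun x => A x ^+ m) <= 2 &
    forall (x : {ffun I -> V}) y, ball NY m%:R y ->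
      l2 (fun k => \sum_i \sum_j X i (x i) * y j * a i j k) <= cCS * M * A x].
Proof.
move=> XN; have wp i : fprob (wX i) by case: (XN i).
have wpp := fprob_pw wp.
have m0 : (0 < m)%N by apply: leq_trans m4.
have mR : 0 < m%:R :> R by rewrite ltr0n.
have mn0 : m%:R != 0 :> R by rewrite gt_eqF.
pose L : finType := ((K * 'I_m)%type : finType).
pose muY := pw (fun _ : J => @pwt R m.+1); pose muF := pw (fun _ : L => @pwt R m.+1).
have Kp := @fprob_pwt R m.+1.
have muYp : fprob muY by exact: fprob_pw.
have muFp : fprob muF by exact: fprob_pw.
pose mu := pairW muY muF; have mup : fprob mu by exact: fprob_pair.
pose Psi (x : {ffun I -> V}) o := \sum_i bb (m := m) NY a o i * X i (x i).
have /choice[g hg] o : exists r, 0 <= r /\ r ^+ m = fE (pw wX) (fun x => `|Psi x o| ^+ m).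
  by apply: root_exists => //; apply: fE_ge0 => // x _; rewrite exprn_ge0.
pose Gam o := g o + M.
have [|||||A [A0 [A2 HA]]] := @sup_over_tilts R _ _ (pw wX) mu Psi Gam m.
- exact: wpp.
- exact: mup.
- exact: m4.
- by move=> o; rewrite /Gam ltr_wpDl //; case: (hg o).
- move=> o; case: (hg o) => g0 <-; apply: lerXn2r; rewrite ?nnegrE //.
    by rewrite addr_ge0 // ltW.
  by rewrite /Gam lerDl ltW.
exists A; split=> // x y By.
have G1 := @cGK_ge1 R; have R1 := @cRC_ge1 R; have k1 := @kn_ge1 R.
pose B := cGK * (4 * cRC + 16 * kn) * M.
have B0 : 0 < B.
  apply: mulr_gt0 => //; apply: mulr_gt0; first by lra.
  by move: (cRC) (kn) R1 k1 => u v; lra.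
apply: l2_dual => [|f f1].
  by rewrite !mulr_ge0 ?(ltW M0) ?(ltW (A0 _)) //; have := cCS_ge1; lra.
have fk k : `|f k| <= 1.
  rewrite -(@ler_pXn2r _ 2) ?nnegrE // expr1n real_normK ?num_real //.
  apply: le_trans f1; rewrite (bigD1 k) //= lerDl.
  by apply: sumr_ge0 => j _; rewrite sqr_ge0.
have Bf : ball (fun _ : L => radcost) m%:R (fun p => f p.1).
  apply: ball_small => [p|]; first exact: fk.
  rewrite sum_pair /=; under eq_bigr do rewrite sumr_const card_ord -mulr_natr.
  by rewrite -mulr_suml ler_piMl // ltW.
have [DY [sh [[DY0 DY1 DYp DY2] [shB _ subY]]]] := product_tilt By (ltnSn m).
have [DF [shF [[DF0 DF1 DFp DF2] [_ shFE subF]]]] := product_tilt Bf (ltnSn m).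
have {subF} subF p : subN (fun v => @pwt R m.+1 v * DF p v)
    (fun v => pval radcost v - f p.1 / 4) radcost.
  have := subF p; congr (subN _ _ _); apply: funext => v.
  by rewrite shFE //; exact: fk.
pose DYp' (o : {ffun J -> bool * 'I_m.+2}) := \prod_j DY j (o j).
pose DFp' (o : {ffun L -> bool * 'I_m.+2}) := \prod_p DF p (o p).
pose D o := DYp' o.1 * DFp' o.2.
have DY'0 o : 0 <= DYp' o by apply: prodr_ge0.
have DF'0 o : 0 <= DFp' o by apply: prodr_ge0.
have EY1 : fE muY DYp' = 1 by rewrite (fE_prod _ DY) big1 // => j _; rewrite DY1.
have EF1 : fE muF DFp' = 1 by rewrite (fE_prod _ DF) big1 // => j _; rewrite DF1.
have D1 : fE mu D = 1.
  rewrite fE_pair (eq_fE muYp (G := DYp')) // => o _.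
  by rewrite /D /= fEZ EF1 mulr1.
have D2 : fE mu (fun o => D o ^+ 2) <= (expR 4 ^+ 2) ^+ m.
  rewrite fE_pair (eq_fE muYp (G := fun o => DYp' o ^+ 2 * fE muF (fun o => DFp' o ^+ 2))).
    rewrite fEZr -exprM mulnC exprM expr2; apply: ler_pM => //.
      by apply: fE_ge0 => // o _; rewrite sqr_ge0.
    by apply: fE_ge0 => // o _; rewrite sqr_ge0.
  by move=> o _; rewrite -fEZ; apply: eq_fE => // o' _; rewrite /D /= exprMn.
have e1 : 1 <= expR 4 ^+ 2 :> R.
  by apply: exprn_ege1; have := expR_ge1Dx (4 : R); lra.
have DG : fE mu (fun o => D o * Gam o ^+ 2) <= B ^+ 2.
  case: H => H1 H2 H3 H4 H5.
  apply: le_trans (chaos_tilt_bound XN m4 M0 H1 H3 H4 H5 H2 f1 shB subY subF _ _).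
  - rewrite fE_pair_tilt fE_pair le_eqVlt; apply/orP; left; apply/eqP.
    rewrite fE_pw_tilt; apply: eq_bigr => o _; congr (_ * _).
    by rewrite fE_pw_tilt.
  - by move=> o; case: (hg o).
  - by move=> o; case: (hg o).
have meanE : fE mu (fun o => D o * Psi x o) =
    16^-1 * \sum_k f k * \sum_i \sum_j X i (x i) * y j * a i j k.
  rewrite fE_pair_tilt.
  pose d j := \sum_k f k * \sum_i X i (x i) * a i j k.
  rewrite (eq_fE muYp (G := fun o => DYp' o * \sum_j (4^-1 * d j) * pval (NY j) (o j))).
    rewrite (@fE_linear_tilt _ _ _ _ _ (fun j => pval (NY j))) //.
    under eq_bigr do rewrite DYp.
    transitivity (16^-1 * \sum_j d j * y j).
      by rewrite mulr_sumr; apply: eq_bigr => j _; field.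
    congr (_ * _); under eq_bigr do rewrite mulr_suml; rewrite exchange_big /=.
    apply: eq_bigr => k _; rewrite [in RHS]exchange_big [RHS]mulr_sumr; apply: eq_bigr => j _.
    by rewrite -mulrA mulr_suml; congr (_ * _); apply: eq_bigr => i _; ring.
  move=> o _; congr (_ * _).
  rewrite (eq_fE muFp (G := fun o' => DFp' o' * \sum_(p : L)
      (m%:R^-1 * \sum_j (\sum_i X i (x i) * a i j p.1) * pval (NY j) (o j)) * pval radcost (o' p))).
    rewrite (@fE_linear_tilt _ _ _ _ _ (fun p => pval radcost)) // sum_pair.
    transitivity (\sum_k 4^-1 * (f k * \sum_j (\sum_i X i (x i) * a i j k) * pval (NY j) (o j))).
      apply: eq_bigr => k _ /=; under eq_bigr do rewrite DFp /=.
      by rewrite sumr_const card_ord -[_ *+ m]mulr_natl; field.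
    rewrite -mulr_sumr; under [RHS]eq_bigr do rewrite -mulrA.
    rewrite -[RHS]mulr_sumr; congr (_ * _).
    under eq_bigr do rewrite mulr_sumr; rewrite exchange_big; apply: eq_bigr => j _.
    by rewrite /d mulr_suml; apply: eq_bigr => k _; rewrite mulrA.
  move=> o' _; congr (_ * _); rewrite sum_pair /=.
  transitivity (\sum_k \sum_j \sum_i a i j k * ey NY o j * ef o' k * X i (x i)).
    rewrite /Psi /bb /=; under eq_bigr do rewrite mulr_suml.
    rewrite exchange_big [RHS]exchange_big; apply: eq_bigr => j _ /=.
    by rewrite [RHS]exchange_big; apply: eq_bigr => i _; rewrite mulr_suml.
  apply: eq_bigr => k _; rewrite -mulr_sumr [m%:R^-1 * _]mulrC -mulrA -/(ef o' k) mulr_suml.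
  apply: eq_bigr => j _; rewrite !mulr_suml; apply: eq_bigr => i _; rewrite -/(ey NY o j); ring.
have := HA x D B (expR 4 ^+ 2) _ D1 e1 D2 B0 DG.
rewrite meanE normrM (ger0_norm (x := 16^-1)) // => h.
have {}h := h (fun o => mulr_ge0 (DY'0 _) (DF'0 _)).
have -> : cCS * M * A x = 16 * (2 * (expR 4 ^+ 2) ^+ 2 * B * A x).
  by rewrite /cCS /B; ring.
by rewrite -ler_pdivrMl.
Qed.

Definition cUP : R := 3 * cHL * (2 * cHL + 1 + 2 * cCS).

Lemma expr3_sum_le (b c d : R) : 0 <= b -> 0 <= c -> 0 <= d ->
  (b + c + d) ^+ m <= 3 ^+ m * (b ^+ m + c ^+ m + d ^+ m).
Proof.
move=> b0 c0 d0; pose e := Num.max b (Num.max c d).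
have [be ce de] : [/\ b <= e, c <= e & d <= e].
  by rewrite /e !le_max !lexx !orbT.
apply: (@le_trans _ _ ((3 * e) ^+ m)).
  by apply: lerXn2r; rewrite ?nnegrE ?addr_ge0 //; lra.
rewrite exprMn ler_wpM2l ?exprn_ge0 //.
have [eb ec ed] : [/\ 0 <= b ^+ m, 0 <= c ^+ m & 0 <= d ^+ m] by rewrite !exprn_ge0.
have : e = b \/ e = c \/ e = d.
  rewrite /e; case: (leP b (Num.max c d)) => _; last by left.
  by case: (leP c d) => _; right; [right|left].
by case=> [->|[->|->]]; lra.
Qed.

(** [hilbert_linear_moment] is applied twice: to the form in [Y] given [X], and to its
    Hilbert-Schmidt norm [q x], which is again the norm of a linear form in [X], with values indexed
    by [J * K]. *)
Lemma chaos_upper (V V' : finType) (wX X : I -> V -> R) (wY Y : J -> V' -> R) :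
  (forall i, subN (wX i) (X i) (NX i)) -> (forall j, subN (wY j) (Y j) (NY j)) ->
  fE (pw wX) (fun x => fE (pw wY) (fun y =>
    l2 (fun k => \sum_i \sum_j X i (x i) * Y j (y j) * a i j k) ^+ m)) <= (cUP * M) ^+ m.
Proof.
move=> XN YN; have [A [A0 A2 HA]] := chaos_sup XN.
have wpX : fprob (pw wX) by apply: fprob_pw => i; case: (XN i).
have C0 : 0 <= cCS := le_trans ler01 cCS_ge1.
have H0 : 0 <= cHL := le_trans ler01 (@cHL_ge1 R).
have MM := ltW M0; have H3 : 0 <= cHL * 3 by exact: mulr_ge0.
pose v (x : {ffun I -> V}) j k := \sum_i X i (x i) * a i j k.
pose q x := l2 (fun p : J * K => v x p.1 p.2).
have q2 x : q x ^+ 2 = \sum_j \sum_k v x j k ^+ 2 by rewrite l2_sqr sum_pair.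
have q0 x : 0 <= q x by exact: l2_ge0.
have CA x : 0 <= cCS * M * A x.
  exact: mulr_ge0 (mulr_ge0 C0 MM) (ltW (A0 x)).
apply: (@le_trans _ _ (fE (pw wX) (fun x => (cHL * 3) ^+ m *
    (q x ^+ m + (M ^+ m + (cCS * M) ^+ m * A x ^+ m))))).
  apply: fE_le => // x _.
  have -> : fE (pw wY) (fun y => l2 (fun k => \sum_i \sum_j X i (x i) * Y j (y j) * a i j k) ^+ m)
    = fE (pw wY) (fun y => l2 (fun k => \sum_j Y j (y j) * v x j k) ^+ m).
    apply: eq_bigr => y _; congr (_ * l2 _ ^+ _); apply: funext => k.
    rewrite exchange_big; apply: eq_bigr => j _; rewrite mulr_sumr.
    by apply: eq_bigr => i _; ring.
  (* The added [M] makes [Q] positive. *)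
  apply: le_trans (hilbert_linear_moment (Q := q x + M) (Rb := cCS * M * A x) YN m4 _ _ _ _) _.
  - by rewrite ltr_wpDl.
  - exact: CA.
  - by rewrite -q2 ler_sqr ?nnegrE ?addr_ge0 // lerDl.
  - move=> y By; have := HA x y By; have := l2_ge0 (fun k => \sum_i \sum_j X i (x i) * y j * a i j k).
    move=> l0 lC; have : l2 (fun k => \sum_i \sum_j X i (x i) * y j * a i j k) ^+ 2 <=
        (cCS * M * A x) ^+ 2 by rewrite ler_sqr ?nnegrE.
    rewrite l2_sqr; apply: le_trans; rewrite le_eqVlt; apply/orP; left; apply/eqP.
    apply: eq_bigr => k _; congr (_ ^+ _); rewrite exchange_big; apply: eq_bigr => j _.
    by rewrite mulr_sumr; apply: eq_bigr => i _; ring.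
  rewrite [leLHS]exprMn [(cHL * 3) ^+ m]exprMn -[leRHS]mulrA.
  apply: ler_wpM2l; first exact: exprn_ge0.
  apply: le_trans (expr3_sum_le (q0 x) MM (CA x)) _.
  by rewrite [(_ * A x) ^+ m]exprMn !addrA.
rewrite fEZ fED fED (fE_cst wpX) fEZ.
have Eq : fE (pw wX) (fun x => q x ^+ m) <= (2 * cHL * M) ^+ m.
  have -> : 2 * cHL * M = cHL * (M + M) by ring.
  have := hilbert_linear_moment (v := fun i (p : J * K) => a i p.1 p.2) (Q := M) (Rb := M) XN m4.
  apply=> //.
    by under eq_bigr do rewrite sum_pair; exact: (cb_HS H).
  by move=> y By; rewrite sum_pair; exact: (cb_X H).
apply: (@le_trans _ _ ((cHL * 3) ^+ m * ((2 * cHL * M) ^+ m + (M ^+ m + (2 * cCS * M) ^+ m)))).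
  apply: ler_wpM2l; first exact: exprn_ge0.
  apply: lerD => //; rewrite lerD2l -mulrA [in leRHS]exprMn mulrC; apply: ler_wpM2r.
    exact: exprn_ge0 (mulr_ge0 C0 MM).
  apply: le_trans A2 _; rewrite -{1}[2]expr1 ler_weXn2l //; first by lra.
  by apply: leq_trans m4.
have -> : (cUP * M) ^+ m = (cHL * 3) ^+ m * ((2 * cHL * M) + (M + 2 * cCS * M)) ^+ m.
  by rewrite -exprMn /cUP; congr (_ ^+ _); ring.
apply: ler_wpM2l; first exact: exprn_ge0.
have pw2 (b c : R) : 0 <= b -> 0 <= c -> b ^+ m + c ^+ m <= (b + c) ^+ m.
  move=> b0 c0; case: m m4 => // p _; rewrite 3!exprS mulrDl; apply: lerD.
    by rewrite ler_wpM2l // lerXn2r ?nnegrE ?addr_ge0 // lerDl.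
  by rewrite ler_wpM2l // lerXn2r ?nnegrE ?addr_ge0 // lerDr.
have t1 : 0 <= 2 * cHL * M by apply: mulr_ge0 MM; exact: mulr_ge0.
have t2 : 0 <= 2 * cCS * M by apply: mulr_ge0 MM; exact: mulr_ge0.
apply: le_trans (pw2 _ _ t1 (addr_ge0 MM t2)); rewrite lerD2l; exact: pw2.
Qed.

End Family.
End ChaosMoment.

(** * The lower bound on finite spaces *)

Section ChaosLower.
Context {R : realType}.
Local Notation cost := (cost (R := R)).
Local Notation kn := (@kn R).

(** The bound [m] on the cost matters: a truncated law can be shifted only to points below its
    truncation level. *)
Definition tiltable (m : nat) (V : finType) (w X : V -> R) (N : cost) : Prop :=
  [/\ fprob w, fE w X = 0, 16^-1 ^+ 2 <= fE w (fun v => X v ^+ 2) &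
    forall y, cdom N y -> N y <= m%:R -> exists D : V -> R,
      [/\ forall v, 0 <= D v, fE w D = 1, fE w (fun v => D v * X v) = 32^-1 * y &
          fE w (fun v => D v ^+ 2) <= expR (4 * N y)]].

Lemma tiltable_product (m : nat) (I V : finType) (w X : I -> V -> R) (N : I -> cost) (x : I -> R) :
  (forall i, tiltable m (w i) (X i) (N i)) -> ball N m%:R x ->
  exists D : I -> V -> R,
    [/\ forall i v, 0 <= D i v, forall i, fE (w i) (D i) = 1,
        forall i, fE (w i) (fun v => D i v * X i v) = 32^-1 * x i &
        fE (pw w) (fun o => (\prod_i D i (o i)) ^+ 2) <= expR 4 ^+ m].
Proof.
move=> XN Bx; have wp i : fprob (w i) by case: (XN i).
have /choice[D hD] i : exists D : V -> R,
      [/\ forall v, 0 <= D v, fE (w i) D = 1, fE (w i) (fun v => D v * X i v) = 32^-1 * x i &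
          fE (w i) (fun v => D v ^+ 2) <= expR (4 * N i (x i))].
  by case: (XN i) => _ _ _; apply; [case: Bx|exact: ball_coord Bx].
exists D; split; try by move=> i; case: (hD i).
rewrite (eq_fE (fprob_pw wp) (G := fun o => \prod_i (fun v => D i v ^+ 2) (o i))).
  rewrite (fE_prod _ (fun i v => D i v ^+ 2)).
  apply: (@le_trans _ _ (\prod_i expR (4 * N i (x i)))).
    apply: ler_prod => i _; apply/andP; split; last by case: (hD i).
    by apply: fE_ge0 => // v _; rewrite sqr_ge0.
  rewrite -expR_sum -expRM_natl ler_expR -mulr_sumr mulrC ler_wpM2r //.
  by case: Bx.
by move=> o _; rewrite prodrXl.
Qed.

Lemma fE_sqr_le (Om : finType) (W F : Om -> R) : fprob W ->
  fE W F ^+ 2 <= fE W (fun o => F o ^+ 2).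
Proof.
move=> Wp; have : 0 <= fE W (fun o => (F o - fE W F) ^+ 2).
  by apply: fE_ge0 => // o _; rewrite sqr_ge0.
have -> : fE W (fun o => (F o - fE W F) ^+ 2) =
    fE W (fun o => F o ^+ 2 + (- (2 * fE W F) * F o + fE W F ^+ 2)).
  by apply: eq_fE => // o _; ring.
rewrite fED fED fEZ fE_cst //; lra.
Qed.

Lemma fE_tilt_sqr_le (Om : finType) (W D F : Om -> R) : fprob W -> (forall o, 0 <= D o) ->
  fE W D = 1 -> fE W (fun o => D o * F o) ^+ 2 <= fE W (fun o => D o * F o ^+ 2).
Proof.
by move=> Wp D0 D1; rewrite -2!fE_tilt; apply: fE_sqr_le; exact: fprob_tilt.
Qed.

(* Khintchine's inequality, from [|z| >= z^2 / t - z^4 / t^3]. *)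
Lemma first_moment_ge (Om : finType) (W Z : Om -> R) (r k2 k4 : R) : fprob W ->
  0 <= r -> 0 < k2 -> 0 < k4 -> k2 * r ^+ 2 <= fE W (fun o => Z o ^+ 2) ->
  fE W (fun o => Z o ^+ 4) <= k4 * r ^+ 4 -> k2 <= 1 -> 1 <= k4 ->
  k2 ^+ 2 / (4 * k4) * r <= fE W (fun o => `|Z o|).
Proof.
move=> Wp; rewrite le_eqVlt => /orP[/eqP<- _ _ _ _ _ _|r0 k20 k40 h2 h4 k21 k41].
  by rewrite mulr0; apply: fE_ge0.
pose t := 2 * k4 / k2 * r; have t0 : 0 < t by rewrite !mulr_gt0 ?invr_gt0.
have tn : t != 0 by rewrite gt_eqF.
apply: (@le_trans _ _ (fE W (fun o => t^-1 * Z o ^+ 2 + - (t ^- 3) * Z o ^+ 4))); last first.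
  apply: fE_le => // o _; pose u := `|Z o| / t.
  have u0 : 0 <= u by rewrite divr_ge0 // ltW.
  have -> : t^-1 * Z o ^+ 2 + - (t ^- 3) * Z o ^+ 4 = t * (u ^+ 2 - u ^+ 4).
    have -> : Z o ^+ 2 = `|Z o| ^+ 2 by rewrite real_normK ?num_real.
    have -> : Z o ^+ 4 = `|Z o| ^+ 4.
      by rewrite -normrX ger0_norm // -[4%N]/(2 * 2)%N exprM sqr_ge0.
    by rewrite /u; field.
  have -> : `|Z o| = t * u by rewrite /u mulrC divfK.
  rewrite ler_wpM2l ?(ltW t0) //.
  have -> : u ^+ 4 = (u ^+ 2) ^+ 2 by rewrite -exprM.
  by case: (leP u 1) => u1; have := sqr_ge0 (u ^+ 2); nra.
rewrite fED !fEZ.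
have a1 : t^-1 * (k2 * r ^+ 2) <= t^-1 * fE W (fun o => Z o ^+ 2).
  by rewrite ler_wpM2l // invr_ge0 ltW.
have a2 : t ^- 3 * fE W (fun o => Z o ^+ 4) <= t ^- 3 * (k4 * r ^+ 4).
  by rewrite ler_wpM2l // invr_ge0 exprn_ge0 // ltW.
have e1 : t^-1 * (k2 * r ^+ 2) = k2 ^+ 2 / (2 * k4) * r.
  by rewrite /t; field; rewrite !gt_eqF.
have e2 : t ^- 3 * (k4 * r ^+ 4) = k2 ^+ 2 / (4 * k4) * r * (k2 / (2 * k4)).
  by rewrite /t; field; rewrite !gt_eqF.
have e3 : k2 ^+ 2 / (2 * k4) * r = 2 * (k2 ^+ 2 / (4 * k4) * r).
  by field; rewrite gt_eqF.
have b0 : 0 <= k2 ^+ 2 / (4 * k4) * r.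
  by rewrite mulr_ge0 ?(ltW r0) // divr_ge0 ?sqr_ge0 // mulr_ge0 // ltW.
have b1 : k2 / (2 * k4) <= 1 by rewrite ler_pdivrMr ?mulr_gt0 //; lra.
have b2 : k2 ^+ 2 / (4 * k4) * r * (k2 / (2 * k4)) <= k2 ^+ 2 / (4 * k4) * r by rewrite ler_piMr.
rewrite mulNr; rewrite e2 in a2; rewrite e1 e3 in a1; lra.
Qed.

Definition k4 : R := (16^-1 ^+ 2) ^+ 2 / (4 * kn).
(** Each tilted variable contributes 32, which undoes the mean [y / 32]; each untilted one 16 from
    its second moment, or [k4^-1] from a first moment; [2 * expR 4 ^ 4] comes from
    [tilted_second_moment]. [cLO] dominates all combinations that occur. *)
Definition cLO : R := 32 ^+ 2 * (2 * 16 ^+ 2 + k4^-1) * (2 * expR 4 ^+ 4).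

Lemma k4_gt0 : 0 < k4.
Proof.
by rewrite /k4 divr_gt0 ?exprn_gt0 ?invr_gt0 // mulr_gt0 // (lt_le_trans ltr01) // kn_ge1.
Qed.

Lemma cLO_ge : [/\ 1 <= cLO, 32 ^+ 2 * (2 * expR 4 ^+ 4) <= cLO,
   32 * 16 * (2 * expR 4 ^+ 4) <= cLO, 16 ^+ 2 * (2 * expR 4 ^+ 4) <= cLO &
   32 * k4^-1 * (2 * expR 4 ^+ 4) <= cLO].
Proof.
have e1 : 1 <= expR 4 ^+ 4 :> R.
  by apply: exprn_ege1; have := expR_ge1Dx (4 : R); lra.
have k0 : 0 < k4^-1 by rewrite invr_gt0 k4_gt0.
rewrite /cLO; move: (k4^-1) (expR 4 ^+ 4) k0 e1 => k e k0 e1.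
by split; nra.
Qed.

Section Lower.
Variables (I J K V V' : finType) (wX X : I -> V -> R) (wY Y : J -> V' -> R).
Variables (NX : I -> cost) (NY : J -> cost) (a : I -> J -> K -> R) (m : nat) (s : R).
Hypotheses (XT : forall i, tiltable m (wX i) (X i) (NX i)).
Hypotheses (YT : forall j, tiltable m (wY j) (Y j) (NY j)).
Hypothesis YN : forall j, subN (wY j) (Y j) (NY j).
Hypotheses (m4 : (4 <= m)%N) (s0 : 0 < s).

Let S (x : {ffun I -> V}) (y : {ffun J -> V'}) k := \sum_i \sum_j X i (x i) * Y j (y j) * a i j k.

Hypothesis Ss : fE (pw wX) (fun x => fE (pw wY) (fun y => l2 (S x y) ^+ m)) <= s ^+ m.

Let wXp i : fprob (wX i). Proof. by case: (XT i). Qed.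
Let wYp j : fprob (wY j). Proof. by case: (YT j). Qed.
Let muX : fprob (pw wX). Proof. exact: fprob_pw. Qed.
Let muY : fprob (pw wY). Proof. exact: fprob_pw. Qed.

(** The density may depend jointly on both variables: [lower_weak] tilts [X] in a way that depends
    on the value of [Y]. *)
Lemma tilted_second_moment (D : {ffun I -> V} -> {ffun J -> V'} -> R) :
  (forall x y, 0 <= D x y) -> fE (pw wX) (fun x => fE (pw wY) (D x)) = 1 ->
  fE (pw wX) (fun x => fE (pw wY) (fun y => D x y ^+ 2)) <= (expR 4 ^+ 2) ^+ m ->
  fE (pw wX) (fun x => fE (pw wY) (fun y => D x y * l2 (S x y) ^+ 2)) <=
    (2 * expR 4 ^+ 4 * s) ^+ 2.
Proof.
move=> D0 D1 D2; rewrite -(fE_pair _ _ (fun o => D o.1 o.2 * l2 (S o.1 o.2) ^+ 2)).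
have e1 : 1 <= expR 4 ^+ 2 :> R.
  by apply: exprn_ege1; have := expR_ge1Dx (4 : R); lra.
apply: le_trans (@tilt_moment R _ _ (fun o => D o.1 o.2) (fun o => l2 (S o.1 o.2))
    (expR 4 ^+ 2) s m 2 (fprob_pair muX muY) _ _ e1 s0 _ _ _ _ _) _ => //.
- by rewrite fE_pair.
- by rewrite fE_pair.
- by move=> o; exact: l2_ge0.
- by rewrite fE_pair.
have -> : (2 * expR 4 ^+ 4 * s) ^+ 2 = 4 * (expR 4 ^+ 2) ^+ 2.*2 * s ^+ 2 by rewrite -exprM; ring.
apply: ler_wpM2r; first exact: sqr_ge0.
apply: ler_wpM2r; last lra.
by apply: exprn_ge0; apply: exprn_ge0; exact: expR_ge0.
Qed.

Lemma lin_X (D : I -> V -> R) (x : I -> R) (y : {ffun J -> V'}) k :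
  (forall i, fE (wX i) (D i) = 1) ->
  (forall i, fE (wX i) (fun v => D i v * X i v) = 32^-1 * x i) ->
  fE (pw wX) (fun o => (\prod_i D i (o i)) * S o y k) =
    32^-1 * \sum_i \sum_j x i * Y j (y j) * a i j k.
Proof.
move=> D1 Dx.
rewrite (eq_fE muX (G := fun o => (\prod_i D i (o i)) *
   \sum_i (\sum_j Y j (y j) * a i j k) * X i (o i))).
  rewrite fE_linear_tilt // mulr_sumr; apply: eq_bigr => i _; rewrite Dx mulr_suml mulr_sumr.
  by apply: eq_bigr => j _; ring.
move=> o _; congr (_ * _); apply: eq_bigr => i _; rewrite mulr_suml.
by apply: eq_bigr => j _; ring.
Qed.

Lemma lin_Y (D : J -> V' -> R) (y : J -> R) (x : I -> R) k :
  (forall j, fE (wY j) (D j) = 1) ->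
  (forall j, fE (wY j) (fun v => D j v * Y j v) = 32^-1 * y j) ->
  fE (pw wY) (fun o => (\prod_j D j (o j)) * \sum_i \sum_j x i * Y j (o j) * a i j k) =
    32^-1 * \sum_i \sum_j x i * y j * a i j k.
Proof.
move=> D1 Dy.
rewrite (eq_fE muY (G := fun o => (\prod_j D j (o j)) *
   \sum_j (\sum_i x i * a i j k) * Y j (o j))).
  rewrite fE_linear_tilt // [in RHS]exchange_big mulr_sumr; apply: eq_bigr => j _.
  rewrite Dy mulr_suml mulr_sumr.
  by apply: eq_bigr => i _; ring.
move=> o _; congr (_ * _); rewrite exchange_big; apply: eq_bigr => j _ /=; rewrite mulr_suml.
by apply: eq_bigr => i _; ring.
Qed.

Lemma expR4_pow : expR 4 ^+ m <= (expR 4 ^+ 2) ^+ m :> R.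
Proof.
rewrite -exprM ler_weXn2l //; last by rewrite leq_pmull.
by have := expR_ge1Dx (4 : R); lra.
Qed.

Lemma sqr_bound (u k c : R) : 0 < k -> 0 <= c -> k * c <= cLO ->
  (k^-1) ^+ 2 * u <= (c * s) ^+ 2 -> u <= (cLO * s) ^+ 2.
Proof.
move=> k0 c0 kc h; have -> : u = k ^+ 2 * ((k^-1) ^+ 2 * u) by field; rewrite gt_eqF.
apply: (@le_trans _ _ (k ^+ 2 * (c * s) ^+ 2)); first by rewrite ler_wpM2l ?sqr_ge0.
have L0 : 0 <= cLO by case: cLO_ge => h1 *; exact: le_trans ler01 h1.
have kcs : k * (c * s) <= cLO * s by rewrite mulrA ler_wpM2r // ltW.
rewrite -exprMn; apply: lerXn2r; rewrite ?nnegrE //.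
  by apply: mulr_ge0; [exact: ltW|apply: mulr_ge0 => //; exact: ltW].
by apply: mulr_ge0 => //; exact: ltW.
Qed.

Lemma lower_XY x y : ball NX m%:R x -> ball NY m%:R y ->
  \sum_k (\sum_i \sum_j x i * y j * a i j k) ^+ 2 <= (cLO * s) ^+ 2.
Proof.
move=> Bx By; case: cLO_ge => _ hc _ _ _.
have [DX [DX0 DX1 DXx DX2]] := tiltable_product XT Bx.
have [DY [DY0 DY1 DYy DY2]] := tiltable_product YT By.
pose PX (o : {ffun I -> V}) := \prod_i DX i (o i).
pose PY (o : {ffun J -> V'}) := \prod_j DY j (o j).
have PX0 o : 0 <= PX o by apply: prodr_ge0.
have PY0 o : 0 <= PY o by apply: prodr_ge0.
have PX1 : fE (pw wX) PX = 1 by rewrite (fE_prod _ DX) big1.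
have PY1 : fE (pw wY) PY = 1 by rewrite (fE_prod _ DY) big1.
apply: sqr_bound hc _; rewrite ?exprn_gt0 //.
apply: le_trans (tilted_second_moment (D := fun x y => PX x * PY y) _ _ _).
- rewrite mulr_sumr; apply: (@le_trans _ _ (\sum_k fE (pw wX) (fun x => PX x * fE (pw wY) (fun y => PY y * S x y k ^+ 2)))).
    apply: ler_sum => k _.
    have -> : (32 ^+ 2)^-1 ^+ 2 * (\sum_i \sum_j x i * y j * a i j k) ^+ 2 =
       fE (pw wX) (fun x => PX x * fE (pw wY) (fun y => PY y * S x y k)) ^+ 2.
      rewrite -exprMn; congr (_ ^+ _).
      rewrite (eq_fE muX (G := fun x => fE (pw wY) (fun y => PY y * (PX x * S x y k)))).
        rewrite fE_swap (eq_fE muY (G := fun y => PY y * (32^-1 *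
           \sum_i \sum_j x i * Y j (y j) * a i j k))).
          transitivity (32^-1 * fE (pw wY) (fun o => PY o * \sum_i \sum_j x i * Y j (o j) * a i j k)).
            by rewrite (lin_Y _ _ DY1 DYy) mulrA; congr (_ * _); field.
          by rewrite -fEZ; apply: eq_fE => // o _; rewrite mulrCA.
        by move=> o _; rewrite fEZ (lin_X _ _ DX1 DXx).
      by move=> o _; rewrite -fEZ; apply: eq_fE => // o' _; rewrite mulrCA.
    apply: le_trans (fE_tilt_sqr_le _ muX PX0 PX1) _; apply: fE_le => // o _.
    by rewrite ler_wpM2l //; exact: fE_tilt_sqr_le.
  rewrite -fE_sum le_eqVlt; apply/orP; left; apply/eqP; apply: eq_fE => // o _.
  rewrite -mulr_sumr -fE_sum -fEZ; apply: eq_fE => // o' _.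
  by rewrite -mulr_sumr l2_sqr mulrA.
- by move=> *; rewrite mulr_ge0.
- by rewrite (eq_fE muX (G := PX)) // => o _; rewrite fEZ PY1 mulr1.
- rewrite (eq_fE muX (G := fun x => PX x ^+ 2 * fE (pw wY) (fun y => PY y ^+ 2))).
    rewrite fEZr -exprM mulnC exprM expr2; apply: ler_pM => //.
      by apply: fE_ge0 => // o _; rewrite sqr_ge0.
    by apply: fE_ge0 => // o _; rewrite sqr_ge0.
  by move=> o _; rewrite -fEZ; apply: eq_fE => // o' _; rewrite exprMn.
Qed.

Lemma quad_Y (u : J -> K -> R) : 16^-1 ^+ 2 * \sum_j \sum_k u j k ^+ 2 <=
  fE (pw wY) (fun y => \sum_k (\sum_j u j k * Y j (y j)) ^+ 2).
Proof.
rewrite fE_sum exchange_big mulr_sumr; apply: ler_sum => k _ /=.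
rewrite fE_sqr_sum //; last by move=> j; case: (YT j).
rewrite mulr_sumr; apply: ler_sum => j _; rewrite mulrC ler_wpM2l ?sqr_ge0 //.
by case: (YT j).
Qed.

Lemma quad_X (K' : finType) (u : I -> K' -> R) : 16^-1 ^+ 2 * \sum_i \sum_k u i k ^+ 2 <=
  fE (pw wX) (fun x => \sum_k (\sum_i u i k * X i (x i)) ^+ 2).
Proof.
rewrite fE_sum exchange_big mulr_sumr; apply: ler_sum => k _ /=.
rewrite fE_sqr_sum //; last by move=> i; case: (XT i).
rewrite mulr_sumr; apply: ler_sum => i _; rewrite mulrC ler_wpM2l ?sqr_ge0 //.
by case: (XT i).
Qed.

(** Only [X] is tilted. The untouched [Y] has second moments at least [16 ^- 2], so averaging over
    it leaves a Hilbert-Schmidt norm. *)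
Lemma lower_X x : ball NX m%:R x ->
  \sum_j \sum_k (\sum_i x i * a i j k) ^+ 2 <= (cLO * s) ^+ 2.
Proof.
move=> Bx; case: cLO_ge => _ _ hc _ _.
have [DX [DX0 DX1 DXx DX2]] := tiltable_product XT Bx.
pose PX (o : {ffun I -> V}) := \prod_i DX i (o i).
have PX0 o : 0 <= PX o by apply: prodr_ge0.
have PX1 : fE (pw wX) PX = 1 by rewrite (fE_prod _ DX) big1.
apply: sqr_bound hc _; rewrite ?mulr_gt0 //.
apply: le_trans (tilted_second_moment (D := fun x y => PX x) _ _ _) => //.
- apply: (@le_trans _ _ (fE (pw wY) (fun y => 32^-1 ^+ 2 *
     \sum_k (\sum_j (\sum_i x i * a i j k) * Y j (y j)) ^+ 2))).
    rewrite fEZ invfM exprMn -mulrA ler_wpM2l ?sqr_ge0 //; exact: quad_Y.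
  rewrite fE_swap; apply: fE_le => // y _.
  rewrite mulr_sumr (eq_fE muX (G := fun x => \sum_k PX x * S x y k ^+ 2)); last first.
    by move=> o _; rewrite l2_sqr mulr_sumr.
  rewrite fE_sum; apply: ler_sum => k _.
  have -> : 32^-1 ^+ 2 * (\sum_j (\sum_i x i * a i j k) * Y j (y j)) ^+ 2 =
      fE (pw wX) (fun x => PX x * S x y k) ^+ 2.
    rewrite (lin_X _ _ DX1 DXx) -exprMn; congr ((_ * _) ^+ _).
    rewrite exchange_big; apply: eq_bigr => j _; rewrite mulr_suml.
    by apply: eq_bigr => i _; ring.
  exact: fE_tilt_sqr_le.
- by rewrite (eq_fE muX (G := PX)) // => o _; rewrite (fE_cst muY).
- apply: le_trans expR4_pow; apply: le_trans DX2.
  by apply: fE_le => // o _; rewrite (fE_cst muY).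
Qed.

Lemma lower_Y y : ball NY m%:R y ->
  \sum_i \sum_k (\sum_j y j * a i j k) ^+ 2 <= (cLO * s) ^+ 2.
Proof.
move=> By; case: cLO_ge => _ _ hc _ _.
have [DY [DY0 DY1 DYy DY2]] := tiltable_product YT By.
pose PY (o : {ffun J -> V'}) := \prod_j DY j (o j).
have PY0 o : 0 <= PY o by apply: prodr_ge0.
have PY1 : fE (pw wY) PY = 1 by rewrite (fE_prod _ DY) big1.
apply: sqr_bound hc _; rewrite ?mulr_gt0 //.
apply: le_trans (tilted_second_moment (D := fun x y => PY y) _ _ _) => //.
- apply: (@le_trans _ _ (fE (pw wX) (fun x => 32^-1 ^+ 2 *
     \sum_k (\sum_i (\sum_j y j * a i j k) * X i (x i)) ^+ 2))).
    rewrite fEZ invfM exprMn -mulrA ler_wpM2l ?sqr_ge0 //; exact: quad_X.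
  apply: fE_le => // x _.
  rewrite mulr_sumr (eq_fE muY (G := fun y => \sum_k PY y * S x y k ^+ 2)); last first.
    by move=> o _; rewrite l2_sqr mulr_sumr.
  rewrite fE_sum; apply: ler_sum => k _.
  have -> : 32^-1 ^+ 2 * (\sum_i (\sum_j y j * a i j k) * X i (x i)) ^+ 2 =
      fE (pw wY) (fun y => PY y * S x y k) ^+ 2.
    rewrite (lin_Y (fun i => X i (x i)) _ DY1 DYy) -exprMn; congr ((_ * _) ^+ _).
    apply: eq_bigr => i _; rewrite mulr_suml.
    by apply: eq_bigr => j _; ring.
  exact: fE_tilt_sqr_le.
- by rewrite fE_cst.
- by rewrite fE_cst //; apply: le_trans expR4_pow; exact: DY2.
Qed.

Lemma quad_XY : (16^-1 ^+ 2) ^+ 2 * \sum_i \sum_j \sum_k a i j k ^+ 2 <=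
  fE (pw wX) (fun x => fE (pw wY) (fun y => l2 (S x y) ^+ 2)).
Proof.
apply: (@le_trans _ _ (fE (pw wX) (fun x => 16^-1 ^+ 2 *
   \sum_j \sum_k (\sum_i X i (x i) * a i j k) ^+ 2))).
  rewrite fEZ [(_ ^+ 2) ^+ 2]expr2 -mulrA; apply: ler_wpM2l; first exact: sqr_ge0.
  have := quad_X (fun i (p : J * K) => a i p.1 p.2).
  under eq_bigr do rewrite sum_pair; move/le_trans; apply.
  apply: fE_le => // x _; rewrite sum_pair.
  by under eq_bigr do under eq_bigr do under eq_bigr do rewrite mulrC.
apply: fE_le => // x _; apply: le_trans (quad_Y _) _.
rewrite le_eqVlt; apply/orP; left; apply/eqP; apply: eq_fE => // y _.
rewrite l2_sqr; apply: eq_bigr => k _; congr (_ ^+ _).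
rewrite /S exchange_big; apply: eq_bigr => j _; rewrite mulr_suml.
by apply: eq_bigr => i _; ring.
Qed.

Lemma lower_HS : \sum_i \sum_j \sum_k a i j k ^+ 2 <= (cLO * s) ^+ 2.
Proof.
case: cLO_ge => _ _ _ hc _.
apply: sqr_bound hc _; rewrite ?exprn_gt0 //.
apply: le_trans (tilted_second_moment (D := fun x y => 1) _ _ _) => //.
- rewrite (_ : (16 ^+ 2)^-1 ^+ 2 = (16^-1 ^+ 2) ^+ 2 :> R); last by field.
  apply: le_trans quad_XY _; apply: fE_le => // x _; apply: fE_le => // y _.
  by rewrite mul1r.
- by rewrite fE_cst // fE_cst.
- rewrite expr1n fE_cst // fE_cst //; apply: exprn_ege1; apply: exprn_ege1.
  by have := expR_ge1Dx (4 : R); lra.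
Qed.

(** Given [y], the law of [X] is shifted to the point with coordinates [sg (Z i y) |x i|], so the
    tilted mean of the chaos against [f] is the sum of the [|x i| |Z i y| / 32]. Averaging over [Y],
    [first_moment_ge] bounds the mean of [|Z i|] below by a multiple of the norm of the row. *)
Lemma lower_weak f x : \sum_k f k ^+ 2 <= 1 -> ball NX m%:R x ->
  \sum_i x i * l2 (fun j => \sum_k f k * a i j k) <= cLO * s.
Proof.
move=> f1 Bx; case: cLO_ge => c1 _ _ _ hc.
pose b i j := \sum_k f k * a i j k.
pose Z i (y : {ffun J -> V'}) := \sum_j b i j * Y j (y j).
have k40 := k4_gt0; have kn1 := @kn_ge1 R.
have EZ i : k4 * l2 (b i) <= fE (pw wY) (fun y => `|Z i y|).
  apply: (first_moment_ge (k2 := 16^-1 ^+ 2) (k4 := kn)) => //.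
  - exact: l2_ge0.
  - exact: lt_le_trans kn1.
  - rewrite fE_sqr_sum //; last by move=> j; case: (YT j).
    rewrite l2_sqr mulr_sumr; apply: ler_sum => j _; rewrite mulrC ler_wpM2l ?sqr_ge0 //.
    by case: (YT j).
  - by apply: linear_form_fourth => //; rewrite ?l2_ge0 ?l2_sqr.
  - by rewrite exprn_ile1 //; lra.
pose xs (y : {ffun J -> V'}) i := Num.sg (Z i y) * `|x i|.
have Bxs y : ball NX m%:R (xs y).
  apply: (ballM (t := fun i => Num.sg (Z i y))) (ball_norm Bx) => i.
  by rewrite normr_sg; case: (_ != 0).
have /choice[D hD] y := tiltable_product XT (Bxs y).
pose P (x : {ffun I -> V}) y := \prod_i D y i (x i).
have P0 o y : 0 <= P o y by apply: prodr_ge0 => i _; case: (hD y).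
have P1 y : fE (pw wX) (P^~ y) = 1.
  by rewrite (fE_prod _ (D y)) big1 // => i _; case: (hD y).
have T := tilted_second_moment (D := P) P0 _ _.
have {T} T : fE (pw wX) (fun x => fE (pw wY) (fun y => P x y * l2 (S x y) ^+ 2)) <=
    (2 * expR 4 ^+ 4 * s) ^+ 2.
  apply: T.
    by rewrite fE_swap (eq_fE muY (G := fun=> 1)) ?fE_cst.
  rewrite fE_swap; apply: le_trans expR4_pow; apply: fE_lebound => // y _.
  by case: (hD y).
pose q y := \sum_i `|x i| * `|Z i y|.
have q2 y : (32^-1 * q y) ^+ 2 <= fE (pw wX) (fun x => P x y * l2 (S x y) ^+ 2).
  have -> : 32^-1 * q y = fE (pw wX) (fun x => P x y * \sum_k f k * S x y k).
    rewrite (eq_fE muX (G := fun x => \sum_k f k * (P x y * S x y k))); last first.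
      by move=> o _; rewrite mulr_sumr; apply: eq_bigr => k _; rewrite mulrCA.
    rewrite fE_sum; have [_ D1 Dx _] := hD y.
    under eq_bigr do rewrite fEZ (lin_X _ _ D1 Dx) mulrCA.
    rewrite -mulr_sumr; congr (_ * _); under [RHS]eq_bigr do rewrite mulr_sumr.
    rewrite [RHS]exchange_big; apply: eq_bigr => i _ /=.
    under [RHS]eq_bigr do rewrite mulr_sumr.
    rewrite [RHS]exchange_big /=.
    have -> : `|x i| * `|Z i y| = xs y i * Z i y by rewrite /xs mulrAC mulrC -normrEsg.
    rewrite /Z mulr_sumr; apply: eq_bigr => j _; rewrite /b mulr_suml mulr_sumr.
    by apply: eq_bigr => k _; ring.
  apply: le_trans (fE_tilt_sqr_le _ muX (P0^~ y) (P1 y)) _; apply: fE_le => // o _.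
  rewrite ler_wpM2l // l2_sqr; apply: le_trans (sum_CauchySchwarz _ _ _) _.
  by rewrite ler_piMl // sum_sqr_ge0.
have q0 y : 0 <= q y by apply: sumr_ge0 => i _; rewrite mulr_ge0.
have Eq : (32^-1 * fE (pw wY) q) ^+ 2 <= (2 * expR 4 ^+ 4 * s) ^+ 2.
  apply: le_trans T; rewrite fE_swap -fEZ; apply: le_trans (fE_sqr_le _ muY) _.
  by apply: fE_le => // y _; exact: q2.
have {}Eq : fE (pw wY) q <= 32 * (2 * expR 4 ^+ 4 * s).
  rewrite -ler_pdivrMl //; move: Eq; rewrite ler_sqr ?nnegrE //.
    by rewrite mulr_ge0 // fE_ge0.
  by rewrite mulr_ge0 // ltW.
apply: (@le_trans _ _ (k4^-1 * fE (pw wY) q)).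
  rewrite -ler_pdivrMl ?invr_gt0 // invrK mulr_sumr fE_sum; apply: ler_sum => i _.
  rewrite fEZ mulrCA; apply: (@le_trans _ _ (`|x i| * (k4 * l2 (b i)))).
    by rewrite ler_wpM2r ?ler_norm // mulr_ge0 ?l2_ge0 // ltW.
  by rewrite ler_wpM2l.
apply: (@le_trans _ _ (k4^-1 * (32 * (2 * expR 4 ^+ 4 * s)))).
  by rewrite ler_wpM2l // invr_ge0 ltW.
have -> : k4^-1 * (32 * (2 * expR 4 ^+ 4 * s)) = 32 * k4^-1 * (2 * expR 4 ^+ 4) * s by ring.
by rewrite ler_wpM2r // ltW.
Qed.

Lemma chaos_lower : chaos_bound NX NY a m (cLO * s).
Proof.
split; [exact: lower_HS|exact: lower_X|exact: lower_Y|exact: lower_weak|exact: lower_XY].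
Qed.

End Lower.
End ChaosLower.

(** * Discretisation *)

Section TailCost.
Context {R : realType} {d : measure_display} {T : measurableType d} (P : probability T R).
Variable Z : T -> R.
Hypothesis mZ : measurable_fun setT Z.
Hypothesis lcZ : log_concave_tails P Z.
Hypothesis tnZ : tail_normalized P Z.

Definition tail (t : R) : R := fine (P [set w | t <= `|Z w|]).

Lemma measurable_tail_set (t : R) : measurable [set w | t <= `|Z w|].
Proof.
have -> : [set w | t <= `|Z w|] = (fun w => `|Z w|) @^-1` `[t, +oo[.
  by apply/seteqP; split=> w /=; rewrite in_itv /= andbT.
rewrite -[X in measurable X]setTI; apply: (measurableT_comp _ mZ) => //.
Qed.

Lemma tailE t : P [set w | t <= `|Z w|] = (tail t)%:E.
Proof. by rewrite /tail fineK // fin_num_measure //; exact: measurable_tail_set. Qed.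

Lemma tail_ge0 t : 0 <= tail t.
Proof. by rewrite -lee_fin -tailE. Qed.

Lemma tail_le1 t : tail t <= 1.
Proof. by rewrite -lee_fin -tailE; apply: probability_le1; exact: measurable_tail_set. Qed.

Lemma tail_anti s t : s <= t -> tail t <= tail s.
Proof.
move=> st; rewrite -lee_fin -!tailE; apply: le_measure; rewrite ?inE;
  try exact: measurable_tail_set.
by move=> w /=; exact: le_trans.
Qed.

Lemma tailNE t : tailN P Z t = if tail t == 0 then +oo%E else (- ln (tail t))%:E.
Proof. by rewrite /tailN tailE eqe. Qed.

Lemma tailN_ge0 t : (0 <= tailN P Z t)%E.
Proof.
rewrite tailNE; case: eqP => [_|/eqP t0]; first by rewrite leey.
rewrite lee_fin oppr_ge0; apply: ln_le0; exact: tail_le1.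
Qed.

Lemma tailN0 : tailN P Z 0 = 0%E.
Proof.
have -> : tailN P Z 0 = if tail 0 == 0 then +oo%E else (- ln (tail 0))%:E by exact: tailNE.
have -> : tail 0 = 1.
  rewrite /tail (_ : [set w | _] = setT) ?probability_setT //.
  by apply/seteqP; split=> // w _ /=; exact: normr_ge0.
by rewrite oner_eq0 ln1 oppr0.
Qed.

Lemma tailN_star l s : 0 <= s -> 0 <= l <= 1 -> (tailN P Z (l * s) <= l%:E * tailN P Z s)%E.
Proof.
move=> s0 l01; have := lcZ s0 (lexx 0) l01.
by rewrite mulr0 addr0 tailN0 mule0 adde0.
Qed.

Lemma tailN_lt1 t : 0 <= t < 1 -> (tailN P Z t < 1)%E.
Proof.
move=> /andP[t0 t1]; rewrite ltNge; apply/negP => h.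
have : (1 <= t%:E)%E.
  by rewrite -tnZ; apply: ereal_inf_lbound; exists t.
by rewrite lee_fin leNgt t1.
Qed.

(** The normalization provides points [u] arbitrarily close to 1 where the tail function is at least
    1; star-shapedness compares them with [t] and gives [t <= u L]. *)
Lemma tailN_ge t : 1 < t -> (t%:E <= tailN P Z t)%E.
Proof.
move=> t1; rewrite tailNE; case: eqP => [_|/eqP t0]; first by rewrite leey.
rewrite lee_fin leNgt; apply/negP => Lt; set L := - ln (tail t) in Lt *.
(* Cutting [L] from below at 1 ensures that a point [u < t / b] also satisfies [u < t]. *)
pose b := Num.max L 1.
have b1 : 1 <= b by rewrite le_max lexx orbT.
have b0 : 0 < b by exact: lt_le_trans b1.
have bt : b < t by rewrite gt_max Lt.
have : (ereal_inf [set t%:E | t in [set t | (0 <= t)%R /\ (1 <= tailN P Z t)%E]] < (t / b)%:E)%E.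
  by rewrite tnZ lte_fin ltr_pdivlMr // mul1r.
move=> /ereal_inf_lt [_ [u [u0 Nu] <-]]; rewrite lte_fin ltr_pdivlMr // => ub.
have ut : u < t by apply: le_lt_trans ub; rewrite ler_peMr.
have t0' : 0 < t by exact: lt_trans t1.
have : (tailN P Z u <= (u / t)%:E * tailN P Z t)%E.
  have tn0 : t != 0 by rewrite gt_eqF.
  rewrite -{1}[u](divfK tn0).
  apply: tailN_star; first exact: ltW.
  by rewrite divr_ge0 ?(ltW t0') //= ler_pdivrMr // mul1r ltW.
move/(le_trans Nu); rewrite tailNE (negPf t0) -/L -EFinM lee_fin mulrAC ler_pdivlMr // mul1r.
rewrite leNgt => /negP; apply; apply: le_lt_trans ub.
by rewrite ler_wpM2l // le_max lexx.
Qed.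

Lemma hatN_fin t : (hatN P Z t < +oo)%E -> hatN P Z t = (fine (hatN P Z t))%:E.
Proof.
rewrite /hatN; case: ifP => // _ h; rewrite fineK // ge0_fin_numE //; exact: tailN_ge0.
Qed.

Lemma hatN_ge0 t : (0 <= hatN P Z t)%E.
Proof. by rewrite /hatN; case: ifP => _; rewrite ?lee_fin ?sqr_ge0 ?tailN_ge0. Qed.

(** The case [|t x| <= 1 < |x|] crosses the two branches of [hatN]; there [(t x) ^ 2 <= |t| |x|] and
    [tailN_ge] applies. *)
Lemma hatN_star t x : `|t| <= 1 -> (hatN P Z (t * x) <= `|t|%:E * hatN P Z x)%E.
Proof.
move=> t1; rewrite /hatN normrM; have t0 := normr_ge0 t; have x0 := normr_ge0 x.
have sq1 (u : R) : u ^+ 2 = `|u| ^+ 2 by rewrite real_normK ?num_real.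
case: (leP `|x| 1) => x1.
  rewrite mulr_ile1 // -EFinM lee_fin exprMn (sq1 t) ler_wpM2r ?sqr_ge0 //.
  by rewrite expr2 ler_piMl.
case: (leP (`|t| * `|x|) 1) => tx1.
  apply: (@le_trans _ _ (`|t|%:E * `|x|%:E)%E).
    by rewrite -EFinM lee_fin sq1 normrM expr2 ler_piMl // mulr_ge0.
  by apply: lee_wpmul2l; rewrite ?lee_fin //; exact: tailN_ge.
by apply: tailN_star; rewrite ?t0.
Qed.

Lemma tail_cost_domZ t x : `|t| <= 1 -> (hatN P Z x < +oo)%E -> (hatN P Z (t * x) < +oo)%E.
Proof.
move=> t1 hx; apply: le_lt_trans (hatN_star x t1) _.
by rewrite (hatN_fin hx) -EFinM ltry.
Qed.

Lemma tail_cost_valZ t x : `|t| <= 1 -> (hatN P Z x < +oo)%E ->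
  fine (hatN P Z (t * x)) <= `|t| * fine (hatN P Z x).
Proof.
move=> t1 hx; have htx := tail_cost_domZ t1 hx.
by rewrite -lee_fin -(hatN_fin htx) EFinM -(hatN_fin hx); exact: hatN_star.
Qed.

Lemma tail_cost_dom1 x : `|x| <= 1 -> (hatN P Z x < +oo)%E.
Proof. by move=> x1; rewrite /hatN x1 ltry. Qed.

Lemma tail_cost_val1 x : `|x| <= 1 -> fine (hatN P Z x) = x ^+ 2.
Proof. by move=> x1; rewrite /hatN x1. Qed.

Lemma tail_cost_ge x : 1 < `|x| -> (hatN P Z x < +oo)%E -> `|x| <= fine (hatN P Z x).
Proof.
move=> x1 hx; rewrite -lee_fin -(hatN_fin hx) /hatN ifN -?ltNge //; exact: tailN_ge.
Qed.

(** [fine] sends infinity to 0, so the value is meaningful on the domain only. *)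
Definition tail_cost : cost (R := R) :=
  @Cost R (fun x => fine (hatN P Z x)) (fun x => (hatN P Z x < +oo)%E)
    tail_cost_domZ tail_cost_valZ tail_cost_dom1 tail_cost_val1 tail_cost_ge.

Lemma tail_cost_large x : 1 < `|x| -> cdom tail_cost x -> expR (- tail_cost x) = tail `|x|.
Proof.
move=> x1; rewrite /= /hatN ifN -?ltNge // tailNE; case: eqP => // /eqP t0 _ /=.
by rewrite opprK lnK // posrE lt_neqAle eq_sym t0 tail_ge0.
Qed.

Lemma cdom_large x : 1 < `|x| -> 0 < tail `|x| -> cdom tail_cost x.
Proof. by move=> x1 t0; rewrite /= /hatN ifN -?ltNge // tailNE gt_eqF // ltry. Qed.

Lemma tail_half : expR (- 1) <= tail 2^-1.
Proof.
have h : 0 <= (2^-1 : R) < 1 by rewrite invr_ge0 ler0n invf_lt1 ?ltr1n ?ltr0n.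
have := tailN_lt1 h; rewrite tailNE; case: eqP => // /eqP t0; rewrite lte_fin => h1.
have tp : 0 < tail 2^-1 by rewrite lt_neqAle eq_sym t0 tail_ge0.
by rewrite -[leRHS]lnK ?posrE // ler_expR; lra.
Qed.

End TailCost.

(** * Tails and tilts of finite symmetric laws *)

Section FiniteSymmetric.
Context {R : realType}.
Variables (V : finType) (w : V -> R).
Hypothesis wp : fprob w.

(* Comparison with the telescoping sum of the square roots of the tail. *)
Lemma inv_sqrt_tail_mean (lev : V -> nat) (M : nat) : (forall v, (lev v <= M)%N) ->
  fE w (fun v => (Num.sqrt (fE w (fun u => (lev v <= lev u)%N%:R)))^-1) <= 2.
Proof.
move=> levM; pose a j := fE w (fun u => (j <= lev u)%N%:R).
have a0 j : 0 <= a j by apply: fE_ge0 => // u _; rewrite ler0n.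
have aS j : a j.+1 <= a j.
  by apply: fE_le => // u _; rewrite ler_nat; case: ltnP => // /ltnW ->.
have a1 : a 0 = 1.
  by rewrite -[RHS](fE_cst wp 1); apply: eq_fE => // u _; rewrite leq0n.
have -> : fE w (fun v => (Num.sqrt (a (lev v)))^-1) =
    \sum_(j < M.+1) (a j - a j.+1) / Num.sqrt (a j).
  rewrite (eq_fE wp (G := fun v => \sum_(j < M.+1)
    ((j <= lev v)%N%:R - (j < lev v)%N%:R) * (Num.sqrt (a j))^-1)); last first.
    move=> v _; have lv : (lev v < M.+1)%N by rewrite ltnS.
    rewrite (bigD1 (Ordinal lv)) //= leqnn ltnn subr0 mul1r big1 ?addr0 // => j jl.
    have : (j : nat) != lev v by apply: contra jl => /eqP jl; apply/eqP/val_inj.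
    by case: (ltngtP j (lev v)) => // _ _; rewrite subrr mul0r.
  rewrite fE_sum; apply: eq_bigr => j _; rewrite fEZr; congr (_ * _).
  by rewrite /a -[X in _ = _ - X]mul1r -mulNr -fEZ -fED; apply: eq_fE => // v _; rewrite mulN1r.
apply: (@le_trans _ _ (\sum_(j < M.+1) 2 * (Num.sqrt (a j) - Num.sqrt (a j.+1)))).
  apply: ler_sum => j _; have u0 := sqrtr_ge0 (a j); have v0 := sqrtr_ge0 (a j.+1).
  have vu : Num.sqrt (a j.+1) <= Num.sqrt (a j) by rewrite ler_wsqrtr.
  rewrite -{1}(sqr_sqrtr (a0 j)) -{1}(sqr_sqrtr (a0 j.+1)).
  have [un0|un0] := eqVneq (Num.sqrt (a j)) 0.
    by rewrite un0 invr0 mulr0; rewrite un0 in vu; rewrite (_ : Num.sqrt _ = 0) ?subr0 ?mulr0 //; apply/le_anti; rewrite vu.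
  have up : 0 < Num.sqrt (a j) by rewrite lt_neqAle eq_sym un0.
  by rewrite ler_pdivrMr //; nra.
rewrite -mulr_sumr -(big_mkord xpredT (fun j => Num.sqrt (a j) - Num.sqrt (a j.+1))).
rewrite (eq_bigr (fun j => - (Num.sqrt (a j.+1) - Num.sqrt (a j)))) => [|j _]; last by rewrite opprB.
rewrite sumrN telescope_sumr // a1 sqrtr1 opprB.
by rewrite -[leRHS]mulr1 ler_wpM2l // gerBl sqrtr_ge0.
Qed.

Variable X : V -> R.
Hypothesis symX : forall F : R -> R, fE w (fun v => F (X v)) = fE w (fun v => F (- X v)).

Lemma odd_mean0 (F : R -> R) : (forall x, F (- x) = - F x) -> fE w (fun v => F (X v)) = 0.
Proof.
move=> Fodd; have := symX F.
have -> : fE w (fun v => F (- X v)) = - fE w (fun v => F (X v)).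
  by rewrite -mulN1r -fEZ; apply: eq_fE => // v _; rewrite Fodd mulN1r.
by move=> h; lra.
Qed.

(** The density conditions on [|X| >= c] and biases the sign by [s]. Symmetry leaves the
    normalisation intact and makes the mean [s mu / th], which dictates [s]. *)
Lemma symmetric_tilt (c y b : R) : b <= 1 ->
  0 < fE w (fun v => (c <= `|X v|)%R%:R) -> 0 < fE w (fun v => (c <= `|X v|)%R%:R * `|X v|) ->
  `|y| * fE w (fun v => (c <= `|X v|)%R%:R) <= 32 * b * fE w (fun v => (c <= `|X v|)%R%:R * `|X v|) ->
  exists D : V -> R, [/\ forall v, 0 <= D v, fE w D = 1, fE w (fun v => D v * X v) = 32^-1 * y &
    fE w (fun v => D v ^+ 2) <= (fE w (fun v => (c <= `|X v|)%R%:R))^-1 * (1 + b ^+ 2)].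
Proof.
set th := fE w _; set mu := fE w _ => b1 th0 mu0 yb.
pose s := y * th / (32 * mu).
have sb : `|s| <= b.
  rewrite /s !normrM normfV (ger0_norm (ltW th0)) (ger0_norm (_ : 0 <= 32 * mu)); last by lra.
  by rewrite ler_pdivrMr; [nra|lra].
pose A (x : R) : R := (c <= `|x|)%R%:R.
have Aev x : A (- x) = A x by rewrite /A normrN.
pose D v := th^-1 * (A (X v) * (1 + s * Num.sg (X v))).
have sg1 x : `|Num.sg x : R| <= 1 by rewrite normr_sg; case: (x != 0).
have ss x : `|s * Num.sg x| <= b.
  by rewrite normrM -[leRHS]mulr1 ler_pM.
have EA : fE w (fun v => A (X v)) = th by [].
have EAs : fE w (fun v => A (X v) * Num.sg (X v)) = 0.
  by apply: (odd_mean0 (F := fun x => A x * Num.sg x)) => x; rewrite Aev sgrN mulrN.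
have EAx : fE w (fun v => A (X v) * X v) = 0.
  by apply: (odd_mean0 (F := fun x => A x * x)) => x; rewrite Aev mulrN.
exists D; split.
- move=> v; have := ss (X v); rewrite ler_norml => /andP[h _].
  by rewrite /D mulr_ge0 ?invr_ge0 ?(ltW th0) // mulr_ge0 ?ler0n //; lra.
- rewrite (eq_fE wp (G := fun v => th^-1 * A (X v) + th^-1 * s * (A (X v) * Num.sg (X v)))); last first.
    by move=> v _; rewrite /D; ring.
  by rewrite fED !fEZ EA EAs mulr0 addr0 mulVf // gt_eqF.
- rewrite (eq_fE wp (G := fun v => th^-1 * (A (X v) * X v) + th^-1 * s * (A (X v) * `|X v|))); last first.
    by move=> v _; rewrite /D normrEsg; ring.
  rewrite fED !fEZ EAx mulr0 add0r -/mu /s.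
  by field; rewrite !gt_eqF.
- apply: (@le_trans _ _ (fE w (fun v => th^-1 ^+ 2 * (1 + b ^+ 2) * A (X v) +
      th^-1 ^+ 2 * (2 * s) * (A (X v) * Num.sg (X v))))).
    apply: fE_le => // v _; rewrite /D !exprMn.
    have -> : A (X v) ^+ 2 = A (X v) by rewrite /A; case: (c <= _); rewrite ?expr1n ?expr0n.
    have A0 : 0 <= A (X v) by rewrite ler0n.
    have h2 : (s * Num.sg (X v)) ^+ 2 <= b ^+ 2.
      by rewrite -real_normK ?num_real // lerXn2r ?nnegrE ?(le_trans _ (ss (X v))).
    have t0 : 0 <= th^-1 ^+ 2 by exact: sqr_ge0.
    have tA : 0 <= th^-1 ^+ 2 * A (X v) by exact: mulr_ge0.
    move: tA h2; set q := th^-1 ^+ 2; set Av := A _; set g := Num.sg _ => tA h2.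
    have := ler_wpM2l tA h2; lra.
  rewrite fED !fEZ EA EAs mulr0 addr0 le_eqVlt; apply/orP; left; apply/eqP.
  by field; rewrite gt_eqF.
Qed.

End FiniteSymmetric.

Section FiniteLaw.
Context {R : realType} {d : measure_display} {T : measurableType d} (P : probability T R).

Section Law.
Variables (O : finType) (g : T -> O).
Hypothesis mg : forall o, measurable (g @^-1` [set o]).

Definition law (o : O) : R := fine (P (g @^-1` [set o])).

Lemma measurable_finpred (A : O -> Prop) : measurable [set w | A (g w)].
Proof.
have -> : [set w | A (g w)] = \bigcup_(o in [set o | A o]) (g @^-1` [set o]).
  apply/seteqP; split=> w /=; first by exists (g w).
  by case=> o /= Ao ->.
by apply: fin_bigcup_measurable => //; exact: finite_finset.
Qed.

Lemma measurable_finrange (F : O -> R) : measurable_fun setT (F \o g).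
Proof.
by move=> _ B _; rewrite setTI; apply: (measurable_finpred (fun o => B (F o))).
Qed.

Lemma lawE o : P (g @^-1` [set o]) = (law o)%:E.
Proof. by rewrite /law fineK // fin_num_measure. Qed.

Lemma law_integral (F : O -> R) : (forall o, 0 <= F o) ->
  (\int[P]_w (F (g w))%:E = (fE law F)%:E)%E.
Proof.
move=> F0.
have -> : (fun w => (F (g w))%:E) =
    (fun w => \sum_(o <- index_enum O) (F o)%:E * (\1_(g @^-1` [set o]) w)%:E)%E.
  apply/funext => w; rewrite (bigD1 (g w)) //= big1 ?adde0 => [|o og].
    by rewrite indicE mem_set //= mule1.
  rewrite indicE memNset ?mule0 //= => gw.
  by rewrite gw eqxx in og.
rewrite ge0_integral_sum //.
- rewrite /fE -sumEFin; apply: eq_bigr => o _.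
  rewrite ge0_integralZl_EFin //.
  + have -> : (\int[P]_w (\1_(g @^-1` [set o]) w)%:E = (law o)%:E)%E.
      by rewrite integral_indic // setIT; exact: lawE.
    by rewrite -EFinM mulrC.
  + exact/measurable_EFinP/measurable_indic.
- move=> o; apply/measurable_EFinP; exact: measurable_funM.
- by move=> o w _; rewrite -EFinM lee_fin mulr_ge0.
Qed.

Lemma fprob_law : fprob law.
Proof.
split=> [v|]; first by rewrite fine_ge0.
have := @law_integral (fun=> 1) (fun=> ler01).
rewrite (_ : (\int[P]_w 1%:E = 1)%E); last by rewrite integral_cst // mul1e; exact: probability_setT.
case=> one_law; rewrite [RHS]one_law.
by rewrite /fE; apply: eq_bigr => o _; rewrite mulr1.
Qed.

Lemma law_pred (A : pred O) : fE law (fun o => (A o)%:R) = fine (P [set w | A (g w)]).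
Proof.
have mA := measurable_finpred A.
have := @law_integral (fun o => (A o)%:R) (fun=> ler0n _ _).
rewrite (_ : (fun w => ((A (g w))%:R)%:E) = (fun w => (\1_[set w | A (g w)] w)%:E)); last first.
  apply/funext => w; rewrite indicE; congr (_%:R%:E).
  by case: (boolP (A (g w))) => h; [rewrite mem_set|rewrite memNset //=; apply/negP].
by rewrite integral_indic // setIT => ->.
Qed.

End Law.

End FiniteLaw.

(** * Rounding to a finite grid *)

Section Quantisation.
Context {R : realType}.
Variable k : nat.

(* Rounding toward 0 on the grid [2^-k Z], truncated at [2^k]. *)
Definition qlev (z : R) : nat := minn (Num.truncn (`|z| * 2 ^+ k)) (4 ^ k).
Definition quant (z : R) : bool * 'I_(4 ^ k).+1 := (0 <= z, inord (qlev z)).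
Definition qval (v : bool * 'I_(4 ^ k).+1) : R := bsgn v.1 * ((v.2 : nat)%:R / 2 ^+ k).

Let p2 : 0 < 2 ^+ k :> R. Proof. exact: exprn_gt0. Qed.

Lemma quant_lev z : (quant z).2 = qlev z :> nat.
Proof. by rewrite inordK // ltnS geq_minr. Qed.

(** Rounding toward 0 gives this equivalence: at grid points the quantised variable has exactly the
    tail of the original one. *)
Lemma qlev_ge j z : (j <= 4 ^ k)%N -> (j <= qlev z)%N = (j%:R / 2 ^+ k <= `|z|).
Proof.
by move=> jk; rewrite leq_min jk andbT truncn_ge_nat ?mulr_ge0 ?(ltW p2) // ler_pdivrMr.
Qed.

Lemma norm_qval v : `|qval v| = (v.2 : nat)%:R / 2 ^+ k.
Proof.
rewrite normrM /bsgn (ger0_norm (_ : 0 <= _ / _)) ?divr_ge0 ?(ltW p2) //.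
by case: v.1; rewrite ?normrN1 ?normr1 mul1r.
Qed.

Lemma qval_quantN z : qval (quant (- z)) = - qval (quant z).
Proof.
have [->|zn0] := eqVneq z 0.
  by rewrite oppr0 /qval quant_lev /qlev normr0 mul0r truncn0 min0n mul0r mulr0 oppr0.
rewrite /qval !quant_lev /qlev normrN /quant /= oppr_ge0 /bsgn (leNgt 0 z) lt_neqAle zn0 /=.
by case: (z <= 0); rewrite mulN1r mul1r ?opprK.
Qed.

Lemma norm_qval_le z : `|qval (quant z)| <= `|z|.
Proof.
by rewrite norm_qval quant_lev -qlev_ge // geq_minr.
Qed.

Lemma quant_close z : `|z| <= 2 ^+ k -> `|z - qval (quant z)| <= (2 ^+ k)^-1.
Proof.
move=> zk; have z0 : 0 <= `|z| * 2 ^+ k by rewrite mulr_ge0 ?(ltW p2).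
have tk : (Num.truncn (`|z| * 2 ^+ k) <= 4 ^ k)%N.
  rewrite -(ler_nat R) (@le_trans _ _ (`|z| * 2 ^+ k)) ?truncn_le //.
  rewrite natrX (_ : 4%:R = 2 * 2 :> R) ?exprMn; last by rewrite -natrM.
  by rewrite ler_wpM2r ?(ltW p2).
have hq : `|z| - (2 ^+ k)^-1 <= (qlev z)%:R / 2 ^+ k <= `|z|.
  rewrite /qlev (minn_idPl tk); have /andP[h1 h2] := truncn_itv z0.
  rewrite ler_pdivrMr // h1 andbT ler_pdivlMr // mulrBl mulVf ?gt_eqF //.
  by rewrite lerBlDr natr1 ltW.
rewrite /qval quant_lev /quant /= /bsgn.
move: hq; set q := _ / _; case: (ltrP z 0) => zs /andP[h1 h2].
  by move: h1 h2; rewrite (ltr0_norm zs) mulN1r opprK => h1 h2; rewrite ler_norml; apply/andP; split; lra.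
by move: h1 h2; rewrite (ger0_norm zs) mul1r => h1 h2; rewrite ler_norml; apply/andP; split; lra.
Qed.

Lemma measurable_quant v : measurable (quant @^-1` [set v] : set R).
Proof.
have mlev j : measurable [set z : R | (j <= qlev z)%N].
  case: (leqP j (4 ^ k)) => jk.
    rewrite (_ : [set z | _] = [set z : R | j%:R / 2 ^+ k <= `|z|]).
      exact: (@measurable_tail_set R _ R id (@measurable_id _ _ _) _).
    by apply/seteqP; split=> z /=; rewrite qlev_ge.
  rewrite (_ : [set z | _] = set0) //; apply/seteqP; split=> z //= jz.
  by have := leq_trans jk jz; rewrite ltnNge geq_minr.
case: v => b j.
have -> : quant @^-1` [set (b, j)] =
    [set z | (0 <= z) = b] `&` ([set z | (j <= qlev z)%N] `&` ~` [set z | (j.+1 <= qlev z)%N]).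
  apply/seteqP; split=> z /=.
    move=> h; have : (quant z).2 = j by rewrite h.
    move/(congr1 val) => /=; rewrite -/(nat_of_ord (quant z).2) quant_lev => ->.
    by rewrite ltnn leqnn; split=> //; case: h.
  case=> hb [h1 /negP]; rewrite -ltnNge ltnS => h2; apply/pair_eqP; rewrite /= hb eqxx /=.
  by apply/eqP/val_inj => /=; rewrite -/(nat_of_ord (quant z).2) quant_lev; apply/eqP; rewrite eqn_leq h1 h2.
apply: measurableI; last by apply: measurableI => //; exact: measurableC.
have m0 : measurable [set z : R | 0 <= z].
  by rewrite (_ : [set z : R | _] = `[0, +oo[%classic) //; apply/seteqP; split=> z /=; rewrite in_itv /= andbT.
case: b; first by [].
rewrite (_ : [set z | _] = ~` [set z : R | 0 <= z]); first exact: measurableC.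
by apply/seteqP; split=> z /= => [->|/negP/negPf].
Qed.

End Quantisation.

Section QuantisedVariable.
Context {R : realType} {d : measure_display} {T : measurableType d} (P : probability T R).
Variables (k : nat) (Z : T -> R).
Hypothesis mZ : measurable_fun setT Z.

Definition qlaw (Z : T -> R) := law P (@quant R k \o Z).

Let p2 : 0 < 2 ^+ k :> R. Proof. exact: exprn_gt0. Qed.

Lemma measurable_quant_comp v : measurable ((@quant R k \o Z) @^-1` [set v]).
Proof. by rewrite -[X in measurable X]setTI; exact: (mZ measurableT (measurable_quant v)). Qed.

Lemma fprob_qlaw : fprob (qlaw Z).
Proof. exact: (fprob_law P measurable_quant_comp). Qed.

Lemma qlaw_tail (j : nat) : (j <= 4 ^ k)%N ->
  fE (qlaw Z) (fun v => (j <= v.2)%N%:R) = tail P Z (j%:R / 2 ^+ k).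
Proof.
move=> jk; have := law_pred P measurable_quant_comp (fun v => (j <= v.2)%N).
rewrite -/(qlaw Z) => ->; congr (fine (P _)); apply/seteqP.
by split=> w /=; rewrite -/(nat_of_ord _) quant_lev qlev_ge.
Qed.

Lemma qlaw_norm_ge (j : nat) : (j <= 4 ^ k)%N ->
  fE (qlaw Z) (fun v => (j%:R / 2 ^+ k <= `|@qval R k v|)%R%:R) = tail P Z (j%:R / 2 ^+ k).
Proof.
move=> jk; rewrite -qlaw_tail //; apply: eq_fE; first exact: fprob_qlaw.
by move=> v _; rewrite norm_qval ler_pdivrMr // divfK ?gt_eqF // ler_nat.
Qed.

Section Symmetric.
Hypothesis symZ : symmetric_rv P Z.

Lemma qlaw_sym (F : R -> R) :
  fE (qlaw Z) (fun v => F (@qval R k v)) = fE (qlaw Z) (fun v => F (- @qval R k v)).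
Proof.
have mN v : measurable ((@quant R k \o (fun w => - Z w)) @^-1` [set v]).
  have mNZ : measurable_fun setT (fun w => - Z w : R) by exact: measurableT_comp.
  by rewrite -[X in measurable X]setTI; refine (mNZ measurableT _ (measurable_quant v)).
have lawN : qlaw Z = qlaw (fun w => - Z w).
  by apply/funext => v; congr fine; exact: (symZ (measurable_quant v)).
have pos (G : R -> R) : (forall x, 0 <= G x) ->
    fE (qlaw Z) (fun v => G (@qval R k v)) = fE (qlaw Z) (fun v => G (- @qval R k v)).
  move=> G0; rewrite {1}lawN.
  have := law_integral P mN (fun v => G0 (@qval R k v)).
  have := law_integral P measurable_quant_comp (fun v => G0 (- @qval R k v)).
  rewrite /= (_ : (fun w => (G (- @qval R k (quant k (Z w))))%:E) =
    (fun w => (G (@qval R k (quant k (- Z w))))%:E)); last first.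
    by apply/funext => w; rewrite qval_quantN.
  by move=> -> [].
(* [law_integral] concerns nonnegative functions, hence the decomposition into positive and negative
   parts. *)
have Fpn x : F x = Num.max (F x) 0 - Num.max (- F x) 0.
  by case: (ltP (F x) 0); case: (ltP (- F x) 0) => h1 h2; lra.
have split_fE (s : R -> R) : fE (qlaw Z) (fun v => F (s (@qval R k v))) =
    fE (qlaw Z) (fun v => Num.max (F (s (@qval R k v))) 0) -
    fE (qlaw Z) (fun v => Num.max (- F (s (@qval R k v))) 0).
  rewrite -mulN1r -fEZ -fED; apply: eq_fE; first exact: fprob_qlaw.
  by move=> v _; rewrite mulN1r {1}Fpn.
rewrite (split_fE id) (split_fE -%R).
rewrite (pos (fun x => Num.max (F x) 0)); last by move=> x; rewrite le_max lexx orbT.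
by rewrite (pos (fun x => Num.max (- F x) 0)) // => x; rewrite le_max lexx orbT.
Qed.

Lemma qlaw_mean0 : fE (qlaw Z) (@qval R k) = 0.
Proof. exact: (odd_mean0 fprob_qlaw qlaw_sym (F := id)). Qed.

Hypothesis lcZ : log_concave_tails P Z.
Hypothesis tnZ : tail_normalized P Z.
Local Notation N := (tail_cost mZ lcZ tnZ).

Lemma qlaw_tail_gt0 v : 0 < qlaw Z v -> 0 < tail P Z `|@qval R k v|.
Proof.
move=> v0; rewrite norm_qval -qlaw_tail; last by rewrite -ltnS.
apply: lt_le_trans v0 _; rewrite /fE (bigD1 v) //= leqnn mulr1 lerDl.
by apply: sumr_ge0 => u _; rewrite mulr_ge0 ?ler0n //; case: fprob_qlaw.
Qed.

Lemma qlaw_dom v : 0 < qlaw Z v -> cdom N (@qval R k v).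
Proof.
move=> v0; case: (leP `|@qval R k v| 1) => v1; first exact: cdom1.
exact/cdom_large/qlaw_tail_gt0.
Qed.

(** On large values [expR (N / 2)] is the inverse square root of the tail, with mean at most 2 by
    [inv_sqrt_tail_mean]; on small ones it is at most [expR (1 / 2) <= 2]. *)
Lemma qlaw_subN : subN (qlaw Z) (@qval R k) N.
Proof.
have wp := fprob_qlaw.
apply: (subN_intro (U := @qval R k)) => //.
- exact: qlaw_mean0.
- by move=> v _; rewrite subrr normr0.
- exact: qlaw_dom.
have h4 : (2 + 2 : R) <= 8 by lra.
apply: le_trans h4.
have levM (v : bool * 'I_(4 ^ k).+1) : (v.2 <= 4 ^ k)%N by rewrite -ltnS.
apply: le_trans (_ : fE (qlaw Z) (fun v => 2 + (Num.sqrt (fE (qlaw Z)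
    (fun u => (v.2 <= u.2)%N%:R)))^-1) <= _); last first.
  rewrite (fED _ (fun=> 2)) fE_cst // lerD2l.
  exact: (inv_sqrt_tail_mean wp levM).
apply: fE_le => // v v0; case: (leP `|@qval R k v| 1) => v1.
  rewrite cval1 // ler_wpDr ?invr_ge0 ?sqrtr_ge0 // (le_trans _ (@expR_half_le2 R)) //.
  rewrite ler_expR -[leRHS]mul1r ler_wpM2r ?invr_ge0 // -real_normK ?num_real //.
  by rewrite exprn_ile1.
rewrite qlaw_tail // -norm_qval -(tail_cost_large v1 (qlaw_dom v0)).
rewrite ler_wpDl //.
have -> : expR (- N (@qval R k v)) = expR (- (N (@qval R k v) / 2)) ^+ 2.
  by rewrite -expRM_natl; congr expR; field.
by rewrite sqrtr_sqr ger0_norm ?expR_ge0 // expRN invrK.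
Qed.

(** For [|y| <= 1] a sign bias suffices, since the mean of the absolute value is at least [1 / 8].
    For larger [y] one conditions on exceeding the rounded value [c] of [|y|], whose tail is at
    least [expR (- N y)]. [0 < k] puts [1 / 2] on the grid and makes the mesh fine enough for
    [c >= |y| / 2]; [m <= 2 ^ k] protects [|y| <= m] from truncation. *)
Lemma qlaw_tiltable m : (0 < k)%N -> (m <= 2 ^ k)%N ->
  tiltable m (qlaw Z) (@qval R k) N.
Proof.
move=> k0 mk; have wp := fprob_qlaw.
have half : (2 ^ k.-1)%:R / 2 ^+ k = 2^-1 :> R.
  rewrite -{2}(prednK k0) exprS natrX.
  have q0 : 0 < 2 ^+ k.-1 :> R by exact: exprn_gt0.
  by field; rewrite gt_eqF.
have jhalf : (2 ^ k.-1 <= 4 ^ k)%N.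
  rewrite (@leq_trans (2 ^ k)) ?leq_exp2l ?leq_pred //; exact: leq_exp2r.
have ph : 4^-1 <= fE (qlaw Z) (fun v => (2^-1 <= `|@qval R k v|)%R%:R).
  rewrite -half qlaw_norm_ge // half; apply: le_trans (tail_half mZ tnZ).
  rewrite expRN lef_pV2 ?posrE ?expR_gt0 //.
  have := @expR_half_le2 R; have := expR_ge0 (2^-1 : R).
  have -> : expR 1 = expR (2^-1) ^+ 2 :> R by rewrite -expRM_natl mulfV.
  by nra.
have E1 : 8^-1 <= fE (qlaw Z) (fun v => `|@qval R k v|).
  apply: (@le_trans _ _ (fE (qlaw Z) (fun v => 2^-1 * (2^-1 <= `|@qval R k v|)%R%:R))).
    by rewrite fEZ; lra.
  by apply: fE_le => // v _; case: (leP 2^-1 `|@qval R k v|) => h; rewrite ?mulr1 ?mulr0.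
split=> //.
- exact: qlaw_mean0.
- apply: (@le_trans _ _ (fE (qlaw Z) (fun v => 4^-1 * (2^-1 <= `|@qval R k v|)%R%:R))).
    by rewrite fEZ; lra.
  apply: fE_le => // v _; case: (leP 2^-1 `|@qval R k v|) => h; rewrite ?mulr1 ?mulr0 ?sqr_ge0 //.
  by rewrite -(real_normK (num_real (@qval R k v))); nra.
move=> y dy Ny; case: (leP `|y| 1) => y1.
  have th1 : fE (qlaw Z) (fun v => (0 <= `|@qval R k v|)%R%:R) = 1.
    by rewrite -[RHS](fE_cst wp 1); apply: eq_fE => // v _; rewrite normr_ge0.
  have mu : fE (qlaw Z) (fun v => (0 <= `|@qval R k v|)%R%:R * `|@qval R k v|) =
      fE (qlaw Z) (fun v => `|@qval R k v|).
    by apply: eq_fE => // v _; rewrite normr_ge0 mul1r.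
  have [||||D [D0 D1 DX D2]] := symmetric_tilt wp qlaw_sym (c := 0) (y := y) (b := `|y| / 4).
  + by lra.
  + by rewrite th1.
  + by rewrite mu; lra.
  + by rewrite th1 mu; have := normr_ge0 y; nra.
  exists D; split=> //; apply: le_trans D2 _.
  rewrite th1 invr1 mul1r cval1 // (le_trans _ (expR_ge1Dx _)) // lerD2l.
  by rewrite exprMn real_normK ?num_real //; have := sqr_ge0 y; lra.
have y0 : 0 <= `|y| by [].
have Nyy : `|y| <= N y by exact: cval_ge.
have ym : `|y| <= m%:R by exact: le_trans Ny.
have jk : (qlev k `|y| <= 4 ^ k)%N by rewrite geq_minr.
pose c : R := (qlev k `|y|)%:R / 2 ^+ k.
have cy : c <= `|y| by rewrite /c -[leRHS]normr_id -qlev_ge.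
have yc : `|y| / 2 <= c.
  have : `| `|y| - @qval R k (quant k `|y|)| <= (2 ^+ k)^-1.
    apply: quant_close; rewrite normr_id (le_trans ym) //.
    by rewrite -natrX ler_nat.
  have -> : @qval R k (quant k `|y|) = c.
    by rewrite /qval quant_lev /quant /= normr_ge0 /bsgn mul1r.
  have : (2 ^+ k)^-1 <= 2^-1 :> R.
    by rewrite lef_pV2 ?posrE // -[leLHS]expr1 ler_eXn2l ?ltr1n.
  rewrite ler_norml => h /andP[_ h2]; lra.
have c0 : 0 < c by lra.
set X := @qval R k.
have thE : fE (qlaw Z) (fun v => (c <= `|X v|)%R%:R) = tail P Z c by rewrite /c qlaw_norm_ge.
have ty : expR (- N y) <= tail P Z c.
  by rewrite (tail_cost_large y1 dy); exact: tail_anti.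
have tc0 : 0 < tail P Z c by apply: lt_le_trans ty; exact: expR_gt0.
have muE : c * tail P Z c <= fE (qlaw Z) (fun v => (c <= `|X v|)%R%:R * `|X v|).
  rewrite -thE -fEZ; apply: fE_le => // v _.
  by case: (leP c `|X v|) => h; rewrite ?mulr0 ?mul0r // mulr1 mul1r.
have [||||D [D0 D1 DX D2]] := symmetric_tilt wp qlaw_sym (c := c) (y := y) (b := 16^-1).
+ by lra.
+ by rewrite thE.
+ by apply: lt_le_trans muE; exact: mulr_gt0.
+ rewrite thE; have := ler_wpM2r (ltW tc0) yc; lra.
exists D; split=> //; apply: le_trans D2 _; rewrite thE.
have tN : (tail P Z c)^-1 <= expR (N y).
  by rewrite -[leRHS]invrK -expRN lef_pV2 ?posrE ?expR_gt0.
have -> : expR (4 * N y) = expR (N y) * expR (3 * N y).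
  by rewrite -expRD; congr expR; ring.
apply: ler_pM => //; first by rewrite invr_ge0 ltW.
apply: le_trans (expR_ge1Dx _); rewrite lerD2l; lra.
Qed.

End Symmetric.
End QuantisedVariable.

(** * Passage to the limit *)

Section QuantisedChaos.
Context {R : realType} {d : measure_display} {T : measurableType d} (P : probability T R).
Variables (n : nat) (X Y : 'I_n -> T -> R).
Hypotheses (mX : forall i, measurable_fun setT (X i)) (mY : forall j, measurable_fun setT (Y j)).
Hypothesis indep : mutually_independent P (join_family X Y).

Section Level.
Variable k : nat.
Local Notation V := (bool * 'I_(4 ^ k).+1)%type.

Let g (w : T) : {ffun 'I_n -> V} * {ffun 'I_n -> V} :=
  ([ffun i => quant k (X i w)], [ffun j => quant k (Y j w)]).

Let gE (o : {ffun 'I_n -> V} * {ffun 'I_n -> V}) : g @^-1` [set o] =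
  \bigcap_(i in [set: 'I_n + 'I_n]) (join_family X Y i @^-1`
    (@quant R k @^-1` [set match i with inl i => o.1 i | inr j => o.2 j end])).
Proof.
apply/seteqP; split=> w /=.
  by move=> <- [i|j] _ /=; rewrite ffunE.
move=> h; rewrite [RHS]surjective_pairing /g; congr pair; apply/ffunP => i; rewrite ffunE.
  exact: (h (inl i)).
exact: (h (inr i)).
Qed.

Let mg o : measurable (g @^-1` [set o]).
Proof.
rewrite gE; apply: fin_bigcap_measurable => [|[i|j] _].
- exact: finite_finset.
- exact: (measurable_quant_comp (mX i)).
- exact: (measurable_quant_comp (mY j)).
Qed.

Let lawg : law P g = pairW (pw (fun i => @qlaw R d T P k (X i))) (pw (fun j => @qlaw R d T P k (Y j))).
Proof.
apply/funext => o; rewrite /law gE indep; last by move=> i; exact: measurable_quant.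
by rewrite big_sumType.
Qed.

Definition qE (F : ('I_n -> R) -> ('I_n -> R) -> R) : R :=
  fE (pw (fun i => @qlaw R d T P k (X i))) (fun x => fE (pw (fun j => @qlaw R d T P k (Y j)))
    (fun y => F (fun i => @qval R k (x i)) (fun j => @qval R k (y j)))).

Definition qX (w : T) (i : 'I_n) : R := @qval R k (quant k (X i w)).
Definition qY (w : T) (j : 'I_n) : R := @qval R k (quant k (Y j w)).

Let qF (F : ('I_n -> R) -> ('I_n -> R) -> R) (o : {ffun 'I_n -> V} * {ffun 'I_n -> V}) :=
  F (fun i => @qval R k (o.1 i)) (fun j => @qval R k (o.2 j)).

Let qFg F w : qF F (g w) = F (qX w) (qY w).
Proof.
by rewrite /qF; congr F; apply/funext => i; rewrite ffunE.
Qed.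

Lemma measurable_quantised (F : ('I_n -> R) -> ('I_n -> R) -> R) : measurable_fun setT (fun w => F (qX w) (qY w)).
Proof.
rewrite (_ : (fun w => _) = qF F \o g); first exact: (measurable_finrange mg).
by apply/funext => w; rewrite /= qFg.
Qed.

Lemma quantised_integral (F : ('I_n -> R) -> ('I_n -> R) -> R) : (forall x y, 0 <= F x y) ->
  (\int[P]_w (F (qX w) (qY w))%:E = (qE F)%:E)%E.
Proof.
move=> F0; rewrite (_ : (fun w => _) = (fun w => (qF F (g w))%:E)).
  by rewrite (law_integral P mg) => [|v]; rewrite ?lawg ?fE_pair //; exact: F0.
by apply/funext => w; rewrite /= qFg.
Qed.

End Level.

Lemma quant_cvg (z : R) : (fun k => @qval R k (quant k z)) @ \oo --> z.
Proof.
apply/cvgrPdist_le => e e0; near=> k.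
have zk : `|z| <= 2 ^+ k.
  rewrite (@le_trans _ _ k%:R) //; last by rewrite -natrX ler_nat ltnW // ltn_expl.
  by near: k; exact: nbhs_infty_ger.
apply: le_trans (quant_close zk) _.
rewrite -[leRHS]invrK lef_pV2 ?posrE ?invr_gt0 //.
rewrite (@le_trans _ _ k%:R) //; last by rewrite -natrX ler_nat ltnW // ltn_expl.
by near: k; exact: nbhs_infty_ger.
Unshelve. all: by end_near. Qed.

Definition seq_continuous (F : ('I_n -> R) -> ('I_n -> R) -> R) : Prop :=
  forall (xs ys : nat -> 'I_n -> R) x y, (forall i, xs ^~ i @ \oo --> x i) ->
    (forall j, ys ^~ j @ \oo --> y j) -> (fun k => F (xs k) (ys k)) @ \oo --> F x y.

(** The dominating function for the limit. It increases with the absolute values, so rounding toward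
    0 decreases it, and for [c = 16^-1] its mean is bounded uniformly in the discretisation because
    of [subN]. *)
Definition expprod (c : R) (x y : 'I_n -> R) : R :=
  (\prod_i expR (c * `|x i|)) * \prod_j expR (c * `|y j|).

Lemma expprod_gt0 c x y : 0 < expprod c x y.
Proof. by rewrite mulr_gt0 //; apply: prodr_gt0 => i _; exact: expR_gt0. Qed.

Lemma cvg_prodr (I : finType) (f : nat -> I -> R) (l : I -> R) :
  (forall i, f ^~ i @ \oo --> l i) -> (fun k => \prod_i f k i) @ \oo --> \prod_i l i.
Proof.
move=> fl; elim: (index_enum I) => [|i s IH].
  by under eq_fun do rewrite big_nil; rewrite big_nil; exact: cvg_cst.
by under eq_fun do rewrite big_cons; rewrite big_cons; exact: cvgM.
Qed.

Lemma cvg_sumr (I : finType) (f : nat -> I -> R) (l : I -> R) :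
  (forall i, f ^~ i @ \oo --> l i) -> (fun k => \sum_i f k i) @ \oo --> \sum_i l i.
Proof.
move=> fl; elim: (index_enum I) => [|i s IH].
  by under eq_fun do rewrite big_nil; rewrite big_nil; exact: cvg_cst.
by under eq_fun do rewrite big_cons; rewrite big_cons; exact: cvgD.
Qed.

Lemma expprod_continuous c : seq_continuous (expprod c).
Proof.
move=> xs ys x y xx yy; apply: cvgM; apply: cvg_prodr => i;
  (apply: continuous_cvg; first exact: continuous_expR);
  (apply: cvgM; first exact: cvg_cst); exact: cvg_norm.
Qed.

Lemma expprod_le c x y x' y' : 0 <= c -> (forall i, `|x i| <= `|x' i|) ->
  (forall j, `|y j| <= `|y' j|) -> expprod c x y <= expprod c x' y'.
Proof.
move=> c0 xx yy; apply: ler_pM; try (by apply: prodr_ge0 => i _; exact: expR_ge0);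
  by apply: ler_prod => i _; rewrite expR_ge0 ler_expR ler_wpM2l.
Qed.

Hypotheses (sX : forall i, symmetric_rv P (X i)) (sY : forall j, symmetric_rv P (Y j)).
Hypotheses (lX : forall i, log_concave_tails P (X i)) (lY : forall j, log_concave_tails P (Y j)).
Hypotheses (nX : forall i, tail_normalized P (X i)) (nY : forall j, tail_normalized P (Y j)).

Let NX i := tail_cost (mX i) (lX i) (nX i).
Let NY j := tail_cost (mY j) (lY j) (nY j).

Lemma subN_exp_norm (V : finType) (w Z : V -> R) (N : cost (R := R)) : subN w Z N ->
  fE w (fun v => expR (16^-1 * `|Z v|)) <= 2 * expR 33.
Proof.
move=> [wp hN].
have key (s : R) : `|s| = 1 -> fE w (fun v => expR (s * Z v / 16)) <= expR 33.
  move=> s1; rewrite -[X in expR X]mulr1; apply: hN => t dt.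
  have st : s * t <= `|t| by rewrite (le_trans (ler_norm _)) // normrM s1 mul1r.
  case: (leP `|t| 1) => t1; last by have := cval_ge t1 dt; lra.
  by rewrite cval1 //; have := sqr_ge0 t; lra.
apply: (@le_trans _ _ (fE w (fun v => expR (1 * Z v / 16) + expR (-1 * Z v / 16)))); last first.
  by rewrite fED; have := key 1 (normr1 _); have := key (-1) (normrN1 _); lra.
apply: fE_le => // v _; have [h|h] := leP 0 (Z v).
  by rewrite ?(ger0_norm h) ler_wpDr ?expR_ge0 // ler_expR; lra.
by rewrite ?(ltr0_norm h) ler_wpDl ?expR_ge0 // ler_expR; lra.
Qed.

Lemma qE_expprod_le k : qE k (expprod 16^-1) <= (2 * expR 33) ^+ n * (2 * expR 33) ^+ n.
Proof.
have E0 (w : bool * 'I_(4 ^ k).+1 -> R) : fprob w -> 0 <= fE w (fun v => expR (16^-1 * `|@qval R k v|)).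
  by move=> wp; apply: fE_ge0 => // v _; exact: expR_ge0.
have pr (Z : 'I_n -> T -> R) : (forall i, measurable_fun setT (Z i)) ->
    (forall i, symmetric_rv P (Z i)) -> (forall i, log_concave_tails P (Z i)) ->
    (forall i, tail_normalized P (Z i)) ->
    0 <= \prod_i fE (@qlaw R d T P k (Z i)) (fun v => expR (16^-1 * `|@qval R k v|)) <=
    (2 * expR 33) ^+ n.
  move=> mZ sZ lZ nZ; apply/andP; split.
    by apply: prodr_ge0 => i _; apply: E0; exact: fprob_qlaw.
  have -> : (2 * expR 33) ^+ n = \prod_(i < n) (2 * expR 33 : R) by rewrite prodr_const card_ord.
  apply: ler_prod => i _.
  rewrite E0 /=; last exact: fprob_qlaw.
  exact: (subN_exp_norm (qlaw_subN k (mZ i) (sZ i) (lZ i) (nZ i))).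
rewrite /qE /expprod.
rewrite (eq_fE (fprob_pw (fun i => fprob_qlaw P k (mX i))) (G := fun x =>
   (\prod_i expR (16^-1 * `|@qval R k (x i)|)) *
   \prod_j fE (@qlaw R d T P k (Y j)) (fun v => expR (16^-1 * `|@qval R k v|)))); last first.
  move=> x _; rewrite fEZ; congr (_ * _).
  exact: (fE_prod _ (fun _ v => expR (16^-1 * `|@qval R k v|))).
rewrite fEZr (fE_prod _ (fun _ v => expR (16^-1 * `|@qval R k v|))).
by have /andP[? ?] := pr X mX sX lX nX; have /andP[? ?] := pr Y mY sY lY nY; exact: ler_pM.
Qed.

Lemma seq_continuous_measurable F : seq_continuous F ->
  measurable_fun setT (fun w => F (X ^~ w) (Y ^~ w)).
Proof.
move=> cF; apply: (measurable_fun_cvg (h := fun k w => F (qX k w) (qY k w))).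
  by move=> k; exact: measurable_quantised.
by move=> w _; apply: cF => i; exact: quant_cvg.
Qed.

Lemma quantised_limit F (C : R) : seq_continuous F -> (forall x y, 0 <= F x y) ->
  (forall x y, F x y <= C * expprod 16^-1 x y) ->
  exists2 L, (\int[P]_w (F (X ^~ w) (Y ^~ w))%:E = L%:E)%E & (fun k => qE k F) @ \oo --> L.
Proof.
move=> cF F0 FC.
have C0 : 0 <= C.
  by have := le_trans (F0 (fun=> 0) (fun=> 0)) (FC _ _); rewrite pmulr_lge0 ?expprod_gt0.
have cE := @expprod_continuous 16^-1.
have E0 x y := ltW (expprod_gt0 16^-1 x y).
(* Fatou's lemma carries the uniform bound over to the original variables, which makes the
   dominating function integrable. *)
have intE : (\int[P]_w (expprod 16^-1 (X ^~ w) (Y ^~ w))%:E <= ((2 * expR 33) ^+ n * (2 * expR 33) ^+ n)%:E)%E.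
  have := @fatou _ _ _ P _ measurableT ( fun k w => (expprod 16^-1 (qX k w) (qY k w))%:E).
  rewrite (_ : (fun w => limn_einf _) = (fun w => (expprod 16^-1 (X ^~ w) (Y ^~ w))%:E)); last first.
    apply/funext => w; apply: (cvg_limn_einf_sup _).1.
    by apply: cvg_EFin; [exact: nearW|apply: cE => i; exact: quant_cvg].
  move=> h; apply: (le_trans (h _ _)).
  - by move=> k; apply/measurable_EFinP; exact: measurable_quantised.
  - by move=> k w _; rewrite lee_fin.
  rewrite limn_einf_lim; apply: lime_le; first exact: is_cvg_einfs.
  apply: nearW => k; apply: (@le_trans _ _ (\int[P]_w (expprod 16^-1 (qX k w) (qY k w))%:E)%E).
    by apply: ereal_inf_lbound; exists k => /=.
  by rewrite quantised_integral // lee_fin qE_expprod_le.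
have mF := seq_continuous_measurable cF; have mE := seq_continuous_measurable cE.
have [|||||intF _ lim] := @dominated_convergence _ _ _ P _ measurableT
   (fun k w => (F (qX k w) (qY k w))%:E)
   (fun w => (F (X ^~ w) (Y ^~ w))%:E) (fun w => (C * expprod 16^-1 (X ^~ w) (Y ^~ w))%:E).
- by move=> k; apply/measurable_EFinP; exact: measurable_quantised.
- exact/measurable_EFinP.
- apply: aeW => w _; apply: cvg_EFin; first exact: nearW.
  by apply: cF => i; exact: quant_cvg.
- apply/integrableP; split; first by apply/measurable_EFinP; exact: measurable_funM.
  rewrite (eq_integral (fun w => C%:E * (expprod 16^-1 (X ^~ w) (Y ^~ w))%:E)%E); last first.
    by move=> w _; rewrite gee0_abs // lee_fin mulr_ge0.
  rewrite ge0_integralZl_EFin //; last exact/measurable_EFinP.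
    by apply: le_lt_trans (lee_wpmul2l _ intE) _; rewrite ?lee_fin // -EFinM ltry.
  by move=> w _; rewrite lee_fin.
- apply: aeW => w k _; rewrite gee0_abs ?lee_fin //.
  apply: le_trans (FC _ _) _; rewrite ler_wpM2l // expprod_le //.
    by move=> i; exact: norm_qval_le.
  by move=> i; exact: norm_qval_le.
have fin := integrable_fin_num measurableT intF.
exists (fine (\int[P]_w (F (X ^~ w) (Y ^~ w))%:E)%E); first by rewrite fineK.
move: lim; rewrite -{1}(fineK fin) => /fine_cvg.
rewrite (_ : fine \o _ = (fun k => qE k F)) //.
by apply/funext => k; rewrite /= quantised_integral.
Qed.

End QuantisedChaos.

(** * First moments against Hilbert-Schmidt norms *)

Section FirstMoments.
Context {R : realType}.
Local Notation cost := (cost (R := R)).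
Local Notation kn := (@kn R).

(** The constant of [first_moment_ge] for the bilinear chaos, where the second and fourth moment
    constants are squared; it serves the linear forms as well. *)
Definition cKH : R := ((16^-1 ^+ 2) ^+ 2) ^+ 2 / (4 * kn ^+ 2).

Let kn1 : 1 <= kn. Proof. exact: kn_ge1. Qed.

Lemma cKH_gt0 : 0 < cKH.
Proof.
rewrite divr_gt0 ?exprn_gt0 ?invr_gt0 // pmulr_rgt0 // exprn_gt0 //; have := kn1; lra.
Qed.

Variables (I J K V V' : finType) (wX X : I -> V -> R) (wY Y : J -> V' -> R).
Variables (NX : I -> cost) (NY : J -> cost) (m : nat).
Hypotheses (XT : forall i, tiltable m (wX i) (X i) (NX i)).
Hypotheses (YT : forall j, tiltable m (wY j) (Y j) (NY j)).
Hypothesis XN : forall i, subN (wX i) (X i) (NX i).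
Hypothesis YN : forall j, subN (wY j) (Y j) (NY j).

Let muX : fprob (pw wX). Proof. by apply: fprob_pw => i; case: (XN i). Qed.
Let muY : fprob (pw wY). Proof. by apply: fprob_pw => j; case: (YN j). Qed.

Lemma linear_fourth_moment (u : I -> K -> R) (r : R) : \sum_i \sum_k u i k ^+ 2 = r ^+ 2 ->
  fE (pw wX) (fun x => l2 (fun k => \sum_i u i k * X i (x i)) ^+ 4) <= kn * r ^+ 4.
Proof.
move=> ur; have := hilbert_form_fourth (v := u) (r := r) XN.
rewrite exchange_big ur => /(_ erefl) h; apply: le_trans h; apply: fE_le => // x _.
by rewrite -[4%N]/(2 * 2)%N exprM l2_sqr.
Qed.

Lemma linear_mean_le (u : I -> K -> R) (r : R) : 0 <= r -> \sum_i \sum_k u i k ^+ 2 = r ^+ 2 ->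
  fE (pw wX) (fun x => l2 (fun k => \sum_i u i k * X i (x i))) <= kn * r.
Proof.
move=> r0 ur; set E := fE _ _.
have E0 : 0 <= E by apply: fE_ge0 => // x _; exact: l2_ge0.
have : E ^+ 4 <= (kn * r) ^+ 4.
  apply: (@le_trans _ _ (kn * r ^+ 4)); last first.
    by rewrite exprMn ler_wpM2r ?exprn_ge0 // ler_eXnr.
  apply: le_trans (linear_fourth_moment ur).
  rewrite -[4%N]/(2 * 2)%N exprM.
  apply: (@le_trans _ _ (fE (pw wX) (fun x => l2 (fun k => \sum_i u i k * X i (x i)) ^+ 2) ^+ 2)).
    by rewrite lerXn2r ?nnegrE ?sqr_ge0 ?fE_sqr_le //; apply: fE_ge0 => // x _; rewrite sqr_ge0.
  by apply: le_trans (fE_sqr_le _ muX) _; apply: fE_le => // x _; rewrite exprM.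
by rewrite ler_pXn2r ?nnegrE // mulr_ge0 // (le_trans ler01).
Qed.

Lemma linear_mean_ge (u : I -> K -> R) (r : R) : 0 <= r -> \sum_i \sum_k u i k ^+ 2 = r ^+ 2 ->
  cKH * r <= fE (pw wX) (fun x => l2 (fun k => \sum_i u i k * X i (x i))).
Proof.
move=> r0 ur.
have q : (16^-1 ^+ 2) ^+ 2 <= 16^-1 ^+ 2 :> R by lra.
have h2 : (16^-1 ^+ 2) ^+ 2 * r ^+ 2 <= fE (pw wX) (fun x => l2 (fun k => \sum_i u i k * X i (x i)) ^+ 2).
  rewrite -ur; apply: le_trans (_ : 16^-1 ^+ 2 * \sum_i \sum_k u i k ^+ 2 <= _).
    by rewrite ler_wpM2r // ur sqr_ge0.
  by apply: le_trans (quad_X XT u) _; apply: fE_le => // x _; rewrite l2_sqr.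
have kk : kn <= kn ^+ 2 by rewrite expr2 ler_peMl // (le_trans ler01).
have h4 : fE (pw wX) (fun x => l2 (fun k => \sum_i u i k * X i (x i)) ^+ 4) <= kn ^+ 2 * r ^+ 4.
  by apply: le_trans (linear_fourth_moment ur) _; rewrite ler_wpM2r // exprn_ge0.
apply: le_trans (first_moment_ge muX r0 _ _ h2 h4 _ _) _.
- by rewrite exprn_gt0 // exprn_gt0 // invr_gt0.
- by rewrite exprn_gt0 // (lt_le_trans ltr01).
- by lra.
- by rewrite exprn_ege1.
by apply: fE_le => // x _; rewrite ger0_norm ?l2_ge0.
Qed.

Lemma chaos_mean_ge (a : I -> J -> K -> R) (r : R) : 0 <= r ->
  \sum_i \sum_j \sum_k a i j k ^+ 2 = r ^+ 2 ->
  cKH * r <= fE (pw wX) (fun x => fE (pw wY) (fun y =>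
    l2 (fun k => \sum_i \sum_j X i (x i) * Y j (y j) * a i j k))).
Proof.
move=> r0 ar.
pose S (x : {ffun I -> V}) (y : {ffun J -> V'}) k := \sum_i \sum_j X i (x i) * Y j (y j) * a i j k.
have h2 : (16^-1 ^+ 2) ^+ 2 * r ^+ 2 <= fE (pairW (pw wX) (pw wY)) (fun o => l2 (S o.1 o.2) ^+ 2).
  by rewrite fE_pair -ar; exact: (quad_XY a XT YT).
have h4 : fE (pairW (pw wX) (pw wY)) (fun o => l2 (S o.1 o.2) ^+ 4) <= kn ^+ 2 * r ^+ 4.
  rewrite fE_pair.
  apply: (@le_trans _ _ (fE (pw wX) (fun x => kn *
     (l2 (fun p : J * K => \sum_i a i p.1 p.2 * X i (x i)) ^+ 4)))).
    apply: fE_le => // x _ /=.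
    have := hilbert_form_fourth (v := fun j k => \sum_i a i j k * X i (x i))
      (r := l2 (fun p : J * K => \sum_i a i p.1 p.2 * X i (x i))) YN.
    rewrite exchange_big l2_sqr sum_pair => /(_ erefl) h; apply: le_trans h.
    apply: fE_le => // y _; rewrite -[4%N]/(2 * 2)%N exprM l2_sqr.
    rewrite le_eqVlt; apply/orP; left; apply/eqP; congr (_ ^+ 2).
    apply: eq_bigr => k _; congr (_ ^+ 2); rewrite /S exchange_big; apply: eq_bigr => j _.
    by rewrite mulr_suml; apply: eq_bigr => i _; ring.
  rewrite fEZ expr2 -mulrA ler_wpM2l ?(le_trans ler01) //.
  have := hilbert_form_fourth (v := fun i (p : J * K) => a i p.1 p.2) (r := r) XN.
  rewrite exchange_big; under eq_bigr do rewrite sum_pair.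
  move=> /(_ ar) h; apply: le_trans h; apply: fE_le => // x _.
  by rewrite -[4%N]/(2 * 2)%N exprM l2_sqr.
have muP := fprob_pair muX muY.
have := first_moment_ge muP r0 _ _ h2 h4 _ _.
rewrite fE_pair => h; apply: le_trans (h _ _ _ _) _.
- by rewrite exprn_gt0 // exprn_gt0 // invr_gt0.
- by rewrite exprn_gt0 // (lt_le_trans ltr01).
- by lra.
- by rewrite exprn_ege1.
by apply: fE_le => // x _; apply: fE_le => // y _; rewrite ger0_norm ?l2_ge0.
Qed.

End FirstMoments.

Section AffineChaos.
Context {R : realType}.
Variables (n : nat) (K : finType).

Lemma l2_le_sum (I : finType) (u : I -> R) : l2 u <= \sum_i `|u i|.
Proof.
have s0 : 0 <= \sum_i `|u i| by apply: sumr_ge0 => i _.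
rewrite -(ler_pXn2r (_ : (0 < 2)%N)) ?nnegrE ?l2_ge0 // l2_sqr expr2 mulr_suml.
apply: ler_sum => i _; rewrite -real_normK ?num_real // expr2 ler_wpM2l //.
by rewrite (bigD1 i) //= lerDl sumr_ge0.
Qed.

Lemma abs_le_expR (c x : R) : 0 < c -> `|x| <= c^-1 * expR (c * `|x|).
Proof.
move=> c0; rewrite -ler_pdivrMl ?invr_gt0 // invrK.
by have := expR_ge1Dx (c * `|x|); lra.
Qed.

(** One function covers the chaos and both mixed terms: slopes 1 with zero shifts, or a slope 0 with
    a shift by a deterministic point. *)
Definition affine_chaos (s t : R) (b c : 'I_n -> R) (a : 'I_n -> 'I_n -> K -> R) (m : nat)
    (x y : 'I_n -> R) : R :=
  l2 (fun k => \sum_i \sum_j (s * x i + b i) * (t * y j + c j) * a i j k) ^+ m.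

Variables (s t : R) (b c : 'I_n -> R) (a : 'I_n -> 'I_n -> K -> R) (m : nat).

Lemma affine_chaos_ge0 x y : 0 <= affine_chaos s t b c a m x y.
Proof. by rewrite exprn_ge0 ?l2_ge0. Qed.

Lemma cvg_exprn (u : nat -> R) (l : R) (p : nat) : u @ \oo --> l ->
  (fun k => u k ^+ p) @ \oo --> l ^+ p.
Proof.
move=> ul; elim: p => [|p IH].
  by under eq_fun do rewrite expr0; rewrite expr0; exact: cvg_cst.
by under eq_fun do rewrite exprS; rewrite exprS; exact: cvgM.
Qed.

Lemma cvg_sqrt (u : nat -> R) (l : R) : u @ \oo --> l ->
  (fun k => Num.sqrt (u k)) @ \oo --> Num.sqrt l.
Proof. by move=> ul; apply: continuous_cvg => //; exact: sqrt_continuous. Qed.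

Lemma affine_chaos_continuous : seq_continuous (affine_chaos s t b c a m).
Proof.
move=> xs ys x y xx yy; rewrite /affine_chaos.
apply/cvg_exprn/cvg_sqrt/cvg_sumr => k; apply/cvg_exprn.
apply: cvg_sumr => i; apply: cvg_sumr => j; apply: cvgM; last exact: cvg_cst.
apply: cvgM; apply: cvgD; try exact: cvg_cst; apply: cvgM => //; exact: cvg_cst.
Qed.

Lemma expprod_ge (e : R) (x y : 'I_n -> R) i j : 0 <= e ->
  expR (e * `|x i|) * expR (e * `|y j|) <= expprod e x y.
Proof.
move=> e0; have e1 z : 1 <= expR (e * `|z|).
  by rewrite -[leLHS]expR0 ler_expR mulr_ge0.
have key (z : 'I_n -> R) l : expR (e * `|z l|) <= \prod_l expR (e * `|z l|).
  rewrite (bigD1 l) //= ler_peMr ?expR_ge0 //.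
  by apply: (big_ind (fun v => 1 <= v)) => // v v' h h'; rewrite -[1]mulr1 ler_pM.
by rewrite ler_pM ?expR_ge0.
Qed.

Lemma expprodX (e : R) (x y : 'I_n -> R) : expprod e x y ^+ m = expprod (m%:R * e) x y.
Proof.
rewrite /expprod exprMn -!prodrXl; congr (_ * _); apply: eq_bigr => i _;
  by rewrite -expRM_natl mulrA.
Qed.

Lemma affine_chaos_dominated : (0 < m)%N -> `|s| <= 1 -> `|t| <= 1 ->
  exists C, forall x y, affine_chaos s t b c a m x y <= C * expprod 16^-1 x y.
Proof.
move=> m0 s1 t1; have mR : 0 < m%:R :> R by rewrite ltr0n.
(* An exponential of rate [1 / (16 m)] has [m]-th power of rate [1 / 16], the rate for which
   [expprod] is controlled. *)
pose e : R := m%:R^-1 * 16^-1; have e0 : 0 < e by rewrite mulr_gt0 ?invr_gt0.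
have lin (u v z : R) : `|u| <= 1 -> `|u * z + v| <= (e^-1 + `|v|) * expR (e * `|z|).
  move=> u1; rewrite (le_trans (ler_normD _ _)) // mulrDl lerD //.
    by rewrite normrM (le_trans _ (abs_le_expR z e0)) // ler_piMl.
  rewrite ler_peMr // -[leLHS]expR0 ler_expR mulr_ge0 //; exact: ltW.
pose C := \sum_(k : K) \sum_i \sum_j (e^-1 + `|b i|) * (e^-1 + `|c j|) * `|a i j k|.
exists (C ^+ m) => x y.
have -> : 16^-1 = m%:R * e by rewrite /e mulVKf // gt_eqF.
rewrite -expprodX -exprMn lerXn2r ?nnegrE ?l2_ge0 //.
  rewrite mulr_ge0 ?(ltW (expprod_gt0 _ _ _)) //.
  by do 3 (apply: sumr_ge0 => ? _); rewrite !mulr_ge0 // addr_ge0 ?invr_ge0 ?(ltW e0).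
apply: le_trans (l2_le_sum _) _; rewrite mulr_suml; apply: ler_sum => k _.
rewrite (le_trans (ler_norm_sum _ _ _)) // mulr_suml; apply: ler_sum => i _.
rewrite (le_trans (ler_norm_sum _ _ _)) // mulr_suml; apply: ler_sum => j _.
rewrite !normrM [leRHS]mulrAC ler_wpM2r //.
have e1 : 0 <= e^-1 by rewrite invr_ge0 ltW.
apply: le_trans (ler_pM _ _ (lin s (b i) (x i) s1) (lin t (c j) (y j) t1)) _ => //.
rewrite mulrACA ler_wpM2l ?mulr_ge0 ?addr_ge0 //; apply: expprod_ge; exact: ltW.
Qed.

End AffineChaos.

Section ChaosMoments.
Context {R : realType} {d : measure_display} {T : measurableType d} (P : probability T R).
Variables (n : nat) (X Y : 'I_n -> T -> R).
Hypotheses (mX : forall i, measurable_fun setT (X i)) (mY : forall j, measurable_fun setT (Y j)).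
Hypothesis indep : mutually_independent P (join_family X Y).
Hypotheses (sX : forall i, symmetric_rv P (X i)) (sY : forall j, symmetric_rv P (Y j)).
Hypotheses (lX : forall i, log_concave_tails P (X i)) (lY : forall j, log_concave_tails P (Y j)).
Hypotheses (nX : forall i, tail_normalized P (X i)) (nY : forall j, tail_normalized P (Y j)).

Local Notation NX := (fun i => tail_cost (mX i) (lX i) (nX i)).
Local Notation NY := (fun j => tail_cost (mY j) (lY j) (nY j)).

Variables (K : finType) (a : 'I_n -> 'I_n -> K -> R).

Let XN k i := qlaw_subN k (mX i) (sX i) (lX i) (nX i).
Let YN k j := qlaw_subN k (mY j) (sY j) (lY j) (nY j).
Let XT k m (k0 : (0 < k)%N) (mk : (m <= 2 ^ k)%N) i :=
  qlaw_tiltable (mX i) (sX i) (lX i) (nX i) k0 mk.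
Let YT k m (k0 : (0 < k)%N) (mk : (m <= 2 ^ k)%N) i :=
  qlaw_tiltable (mY i) (sY i) (lY i) (nY i) k0 mk.

Lemma affine_limit s t b c m : (0 < m)%N -> `|s| <= 1 -> `|t| <= 1 ->
  exists2 L, (\int[P]_w (affine_chaos s t b c a m (X ^~ w) (Y ^~ w))%:E = L%:E)%E &
    (fun k => qE P X Y k (affine_chaos s t b c a m)) @ \oo --> L.
Proof.
move=> m0 s1 t1; have [C HC] := affine_chaos_dominated b c a m0 s1 t1.
apply: quantised_limit HC => //; first exact: affine_chaos_continuous.
by move=> x y; exact: affine_chaos_ge0.
Qed.

Lemma cvg_ge (u : nat -> R) (L c : R) k0 : u @ \oo --> L ->
  (forall k, (k0 <= k)%N -> c <= u k) -> c <= L.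
Proof.
move=> uL cu; rewrite -(cvg_lim _ uL) //; apply: limr_ge; first by apply/cvg_ex; exists L.
by exists k0 => // k /= /cu.
Qed.

Lemma cvg_le (u : nat -> R) (L c : R) k0 : u @ \oo --> L ->
  (forall k, (k0 <= k)%N -> u k <= c) -> L <= c.
Proof.
move=> uL cu; rewrite -(cvg_lim _ uL) //; apply: limr_le; first by apply/cvg_ex; exists L.
by exists k0 => // k /= /cu.
Qed.

Let chaosE m x y : affine_chaos 1 1 (fun=> 0) (fun=> 0) a m x y =
  l2 (fun k => \sum_i \sum_j x i * y j * a i j k) ^+ m.
Proof.
congr (_ ^+ _); congr l2; apply/funext => k; apply: eq_bigr => i _; apply: eq_bigr => j _.
by rewrite !mul1r !addr0.
Qed.

Lemma chaos_limit m : (0 < m)%N ->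
  exists2 L, (\int[P]_w (l2 (fun k => \sum_i \sum_j X i w * Y j w * a i j k) ^+ m)%:E = L%:E)%E &
    (fun l => qE P X Y l (fun x y => l2 (fun k => \sum_i \sum_j x i * y j * a i j k) ^+ m))
      @ \oo --> L.
Proof.
move=> m0; have n1 : `|1 : R| <= 1 by rewrite normr1.
have [L h1 h2] := affine_limit (fun=> 0) (fun=> 0) m0 n1 n1.
exists L.
  by rewrite -h1; apply: eq_integral => w _; rewrite chaosE.
rewrite (_ : affine_chaos _ _ _ _ _ _ = (fun x y =>
  l2 (fun k => \sum_i \sum_j x i * y j * a i j k) ^+ m)) in h2 => //.
by apply/funext => x; apply/funext => y; rewrite chaosE.
Qed.

Lemma chaos_moment_le m M : (4 <= m)%N -> 0 < M -> chaos_bound NX NY a m M ->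
  (\int[P]_w (l2 (fun k => \sum_i \sum_j X i w * Y j w * a i j k) ^+ m)%:E <= ((cUP * M) ^+ m)%:E)%E.
Proof.
move=> m4 M0 hM; have [|L -> lim] := @chaos_limit m; first exact: leq_trans m4.
rewrite lee_fin; apply: (cvg_le (k0 := 0) lim) => l _.
exact: (chaos_upper m4 M0 hM (XN l) (YN l)).
Qed.

(** The strict inequality passes from the limit to all fine discretisations; one with [m <= 2 ^ k]
    is then enough, as the conclusion does not involve the discretisation. *)
Lemma chaos_moment_ge m s : (4 <= m)%N -> 0 < s ->
  (\int[P]_w (l2 (fun k => \sum_i \sum_j X i w * Y j w * a i j k) ^+ m)%:E < (s ^+ m)%:E)%E ->
  chaos_bound NX NY a m (cLO * s).
Proof.
move=> m4 s0; have [|L -> lim] := @chaos_limit m; first exact: leq_trans m4.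
rewrite lte_fin => Ls.
have [k0 _ hk] : \forall k \near \oo, qE P X Y k (fun x y =>
    l2 (fun k => \sum_i \sum_j x i * y j * a i j k) ^+ m) < s ^+ m.
  exact: (cvgr_lt _ lim).
pose k := maxn k0 m.+1.
have k1 : (0 < k)%N by rewrite leq_max orbT.
have mk : (m <= 2 ^ k)%N.
  by apply: ltnW; apply: leq_trans (ltnW (ltn_expl k (ltnSn 1))); rewrite leq_max leqnn orbT.
apply: (chaos_lower (XT k1 mk) (YT k1 mk) (YN k) m4 s0).
by apply: ltW; apply: hk; rewrite /= leq_max leqnn.
Qed.

Lemma chaos_first_moment r : 0 <= r -> \sum_i \sum_j \sum_k a i j k ^+ 2 = r ^+ 2 ->
  ((cKH * r)%:E <= \int[P]_w (l2 (fun k => \sum_i \sum_j X i w * Y j w * a i j k))%:E)%E.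
Proof.
move=> r0 ar; have [//|L h lim] := @chaos_limit 1.
rewrite h lee_fin; apply: (cvg_ge (k0 := 1) lim) => k k1.
have mk : (1 <= 2 ^ k)%N by rewrite expn_gt0.
exact: (chaos_mean_ge (XT k1 mk) (YT k1 mk) (XN k) (YN k) r0 ar).
Qed.

Lemma linearX_first_moment (y : 'I_n -> R) r : 0 <= r ->
  \sum_i \sum_k (\sum_j y j * a i j k) ^+ 2 = r ^+ 2 ->
  ((cKH * r)%:E <= \int[P]_w (l2 (fun k => \sum_i \sum_j X i w * y j * a i j k))%:E <= (kn * r)%:E)%E.
Proof.
move=> r0 ar; have n1 : `|1 : R| <= 1 by rewrite normr1.
have n0 : `|0 : R| <= 1 by rewrite normr0.
have [//|L h lim] := @affine_limit 1 0 (fun=> 0) y 1 _ n1 n0.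
have E x z : affine_chaos 1 0 (fun=> 0) y a 1 x z =
    l2 (fun k => \sum_i (\sum_j y j * a i j k) * x i).
  rewrite /affine_chaos expr1; congr l2; apply/funext => k; apply: eq_bigr => i _.
  by rewrite mulr_suml; apply: eq_bigr => j _; ring.
have -> : (\int[P]_w (l2 (fun k => \sum_i \sum_j X i w * y j * a i j k))%:E = L%:E)%E.
  rewrite -h; apply: eq_integral => w _; rewrite E; congr (l2 _)%:E; apply/funext => k.
  by apply: eq_bigr => i _; rewrite mulr_suml; apply: eq_bigr => j _; ring.
have Eq k : qE P X Y k (affine_chaos 1 0 (fun=> 0) y a 1) =
    fE (pw (fun i => @qlaw R d T P k (X i))) (fun x =>
      l2 (fun k' => \sum_i (\sum_j y j * a i j k') * @qval R k (x i))).
  apply: eq_fE => [|x _]; first by apply: fprob_pw => i; exact: fprob_qlaw.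
  rewrite -[RHS](fE_cst (fprob_pw (fun j => fprob_qlaw P k (mY j)))).
  by apply: eq_fE => [|z _]; [apply: fprob_pw => j; exact: fprob_qlaw|exact: E].
rewrite !lee_fin; apply/andP; split.
  apply: (cvg_ge (k0 := 1) lim) => k k1; rewrite Eq.
  have mk : (1 <= 2 ^ k)%N by rewrite expn_gt0.
  exact: (linear_mean_ge (XT k1 mk) (XN k) r0 ar).
apply: (cvg_le (k0 := 0) lim) => k _; rewrite Eq.
exact: (linear_mean_le (XN k) r0 ar).
Qed.

Lemma linearY_first_moment (x : 'I_n -> R) r : 0 <= r ->
  \sum_j \sum_k (\sum_i x i * a i j k) ^+ 2 = r ^+ 2 ->
  ((cKH * r)%:E <= \int[P]_w (l2 (fun k => \sum_i \sum_j x i * Y j w * a i j k))%:E <= (kn * r)%:E)%E.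
Proof.
move=> r0 ar; have n1 : `|1 : R| <= 1 by rewrite normr1.
have n0 : `|0 : R| <= 1 by rewrite normr0.
have [//|L h lim] := @affine_limit 0 1 x (fun=> 0) 1 _ n0 n1.
have E z y : affine_chaos 0 1 x (fun=> 0) a 1 z y =
    l2 (fun k => \sum_j (\sum_i x i * a i j k) * y j).
  rewrite /affine_chaos expr1; congr l2; apply/funext => k; rewrite exchange_big.
  by apply: eq_bigr => j _; rewrite mulr_suml; apply: eq_bigr => i _; ring.
have -> : (\int[P]_w (l2 (fun k => \sum_i \sum_j x i * Y j w * a i j k))%:E = L%:E)%E.
  rewrite -h; apply: eq_integral => w _; rewrite E; congr (l2 _)%:E; apply/funext => k.
  by rewrite exchange_big; apply: eq_bigr => j _; rewrite mulr_suml; apply: eq_bigr => i _; ring.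
have Eq k : qE P X Y k (affine_chaos 0 1 x (fun=> 0) a 1) =
    fE (pw (fun j => @qlaw R d T P k (Y j))) (fun y =>
      l2 (fun k' => \sum_j (\sum_i x i * a i j k') * @qval R k (y j))).
  rewrite -[RHS](fE_cst (fprob_pw (fun i => fprob_qlaw P k (mX i)))).
  apply: eq_fE => [|z _]; first by apply: fprob_pw => i; exact: fprob_qlaw.
  by apply: eq_fE => [|y _]; [apply: fprob_pw => j; exact: fprob_qlaw|exact: E].
rewrite !lee_fin; apply/andP; split.
  apply: (cvg_ge (k0 := 1) lim) => k k1; rewrite Eq.
  have mk : (1 <= 2 ^ k)%N by rewrite expn_gt0.
  exact: (linear_mean_ge (YT k1 mk) (YN k) r0 ar).
apply: (cvg_le (k0 := 0) lim) => k _; rewrite Eq.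
exact: (linear_mean_le (YN k) r0 ar).
Qed.

End ChaosMoments.

(** * Hilbert space coordinates and conclusion *)

Section InnerProduct.
Context {R : realType} {H : normedModType R} (ip : H -> H -> R).
Hypothesis Hip : inner_product ip.

Let ipC x y : ip x y = ip y x. Proof. by case: Hip. Qed.
Let ipl (c : R) x y z : ip (c *: x + y) z = c * ip x z + ip y z.
Proof. by case: Hip => _ []. Qed.

Lemma ip0l z : ip 0 z = 0.
Proof. by have := ipl 1 0 0 z; rewrite scaler0 addr0 mul1r => h; lra. Qed.

Lemma ip_sumZl (I : finType) (c : I -> R) (u : I -> H) z :
  ip (\sum_i c i *: u i) z = \sum_i c i * ip (u i) z.
Proof. by elim/big_rec2: _ => [|i r v _ <-]; [exact: ip0l|rewrite ipl]. Qed.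

Lemma ip_norm x : ip x x = `|x| ^+ 2.
Proof.
case: Hip => _ [_ nE]; case: (leP 0 (ip x x)) => h; first by rewrite nE sqr_sqrtr.
have x0 : x = 0 by apply/normr0_eq0; rewrite nE ler0_sqrtr // ltW.
by rewrite x0 normr0 ip0l expr0n.
Qed.

Lemma ip_CauchySchwarz x y : `|ip x y| <= `|x| * `|y|.
Proof.
have [->|yn0] := eqVneq y 0; first by rewrite ipC ip0l normr0 normr0 mulr0.
have y0 : 0 < `|y| ^+ 2 by rewrite exprn_gt0 // normr_gt0.
pose z := - (ip x y / `|y| ^+ 2) *: y + x.
have : 0 <= ip z z by rewrite ip_norm sqr_ge0.
have zy : ip z y = 0 by rewrite ipl ip_norm mulNr divfK ?gt_eqF // addNr.
have -> : ip z z = `|x| ^+ 2 - ip x y * ip x y / `|y| ^+ 2.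
  rewrite {1}/z ipl (ipC y z) zy mulr0 add0r ipC ipl ip_norm (ipC y x) mulNr addrC.
  by rewrite mulrAC.
rewrite subr_ge0.
rewrite ler_pdivrMr // -expr2 -exprMn => h.
by apply: ler_sqr_norm => //; rewrite mulr_ge0.
Qed.

Definition orthonormal (K : finType) (e : K -> H) : Prop :=
  forall k l, ip (e k) (e l) = (k == l)%:R.

Lemma sum_delta (K : finType) (c : K -> R) l : \sum_k c k * (k == l)%:R = c l.
Proof. by rewrite (bigD1 l) //= eqxx mulr1 big1 ?addr0 // => k /negPf->; rewrite mulr0. Qed.

Lemma ip_orthonormal (K : finType) (e : K -> H) (c : K -> R) l : orthonormal e ->
  ip (\sum_k c k *: e k) (e l) = c l.
Proof.
by move=> oe; rewrite ip_sumZl -[RHS]sum_delta; apply: eq_bigr => k _; rewrite oe.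
Qed.

Lemma norm_orthonormal (K : finType) (e : K -> H) (c : K -> R) : orthonormal e ->
  `|\sum_k c k *: e k| = l2 c.
Proof.
move=> oe; rewrite -[LHS]ger0_norm // -[in LHS]sqrtr_sqr -ip_norm ip_sumZl; congr Num.sqrt.
by apply: eq_bigr => k _; rewrite ipC ip_orthonormal.
Qed.

(** Gram-Schmidt: the index type gains one point whenever the next vector has a nonzero residual. *)
Lemma orthonormal_coordinates (s : seq H) : exists (K : finType) (e : K -> H),
  orthonormal e /\ forall x, x \in s -> x = \sum_k ip x (e k) *: e k.
Proof.
elim: s => [|x s [K [e [oe es]]]].
  by exists 'I_0, (fun=> 0); split=> // -[].
pose r := x - \sum_k ip x (e k) *: e k.
have [r0|rn0] := eqVneq r 0.
  exists K, e; split=> // y; rewrite inE => /orP[/eqP->|/es//].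
  by apply/eqP; rewrite -subr_eq0 -/r r0.
have rp : 0 < `|r| by rewrite normr_gt0.
have xr : x = r + \sum_k ip x (e k) *: e k by rewrite subrK.
have re k : ip r (e k) = 0.
  by rewrite /r addrC -[- _]scaleN1r ipl ip_orthonormal // mulN1r addNr.
pose v := `|r|^-1 *: r.
have vl z : ip v z = `|r|^-1 * ip r z by rewrite -[v]addr0 ipl ip0l addr0.
pose e' (k : K + unit) := match k with inl k => e k | inr _ => v end.
have sumE (c : K + unit -> R) : \sum_k c k *: e' k = \sum_k c (inl k) *: e k + c (inr tt) *: v.
  by rewrite big_sumType /=; congr (_ + _); rewrite (bigD1 tt) //= big1 ?addr0 // => -[].
exists (K + unit)%type, e'; split=> [[k|[]] [l|[]] /=|y].
- exact: oe.
- by rewrite ipC vl re mulr0.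
- by rewrite vl re mulr0.
- rewrite vl ipC vl ip_norm expr2 mulKf ?gt_eqF // mulVf ?gt_eqF //.
rewrite inE sumE /= => /orP[/eqP->|ys].
  have -> : ip x v = `|r|.
    rewrite ipC vl {1}xr ipC [r + _]addrC -[\sum__ _]scale1r ipl ip_norm ip_sumZl.
    rewrite big1 ?mulr0 ?add0r => [|k _]; last by rewrite (ipC (e k)) re mulr0.
    by rewrite expr2 mulKf // gt_eqF.
  by rewrite scalerA divff ?gt_eqF // scale1r addrC.
have -> : ip y v = 0.
  rewrite ipC vl ipC {1}(es _ ys) ip_sumZl big1 ?mulr0 // => k _.
  by rewrite (ipC (e k)) re mulr0.
by rewrite scale0r addr0; exact: es.
Qed.

(** Testing [f] on the vector with coordinates [f (e k)] bounds the square of a norm by the norm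
    itself. *)
Lemma dual_ball_coords (K : finType) (e : K -> H) (f : H -> R) : orthonormal e ->
  dual_ball f -> \sum_k f (e k) ^+ 2 <= 1.
Proof.
move=> oe [fl fb].
have f0 : f 0 = 0 by have := fl 1 0 0; rewrite scaler0 addr0 mul1r => h; lra.
have fs (c : K -> R) : f (\sum_k c k *: e k) = \sum_k c k * f (e k).
  by elim/big_rec2: _ => [//|k x y _ <-]; rewrite fl.
have := fb (\sum_k f (e k) *: e k); rewrite fs norm_orthonormal // => h.
rewrite -l2_sqr; have := l2_ge0 (fun k => f (e k)).
have : l2 (fun k => f (e k)) ^+ 2 <= l2 (fun k => f (e k)).
  by rewrite l2_sqr; apply: le_trans h; rewrite ler_norm.
by nra.
Qed.

Lemma dual_ball_sum (f : H -> R) (K : finType) (c : K -> R) (u : K -> H) : dual_ball f ->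
  f (\sum_k c k *: u k) = \sum_k c k * f (u k).
Proof.
move=> [fl _]; have f0 : f 0 = 0 by have := fl 1 0 0; rewrite scaler0 addr0 mul1r => h; lra.
by elim/big_rec2: _ => [//|k x y _ <-]; rewrite fl.
Qed.

Lemma dual_ball_ip (K : finType) (e : K -> H) (c : K -> R) : orthonormal e ->
  \sum_k c k ^+ 2 <= 1 -> dual_ball (ip ^~ (\sum_k c k *: e k)).
Proof.
move=> oe c1; split=> [b x y|x]; first exact: ipl.
apply: le_trans (ip_CauchySchwarz _ _) _; rewrite norm_orthonormal //.
by rewrite ler_piMr // /l2 -(@sqrtr1 R) ler_sqrt.
Qed.

End InnerProduct.

Section BallX.
Context {R : realType} {d : measure_display} {T : measurableType d} (P : probability T R).
Variables (n : nat) (X : 'I_n -> T -> R).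
Hypothesis mX : forall i, measurable_fun setT (X i).
Hypothesis lX : forall i, log_concave_tails P (X i).
Hypothesis nX : forall i, tail_normalized P (X i).

Lemma ballXE p x : ballX P X p x <-> ball (fun i => tail_cost (mX i) (lX i) (nX i)) p x.
Proof.
split=> [|[dx sx]].
  rewrite /ballX /= => h.
  have dx i : (hatN P (X i) (x i) < +oo)%E.
    apply: le_lt_trans (ltry p); apply: le_trans h; rewrite (bigD1 i) //=.
    by rewrite leeDl // sume_ge0 // => j _; exact: hatN_ge0.
  split=> //; rewrite -lee_fin -sumEFin; apply: le_trans h.
  by apply: lee_sum => i _; rewrite /= -hatN_fin.
rewrite /ballX /=; move: sx; rewrite -lee_fin -sumEFin; apply: le_trans.
by apply: lee_sum => i _; rewrite /= -hatN_fin //; exact: dx.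
Qed.

End BallX.

Section Powers.
Context {R : realType} {d : measure_display} {T : measurableType d} (P : probability T R).

Lemma powR_le_1D (t p q : R) : 0 <= t -> 0 < p -> p <= q -> t `^ p <= 1 + t `^ q.
Proof.
move=> t0 p0 pq; case: (leP t 1) => t1.
  rewrite ler_wpDr ?powR_ge0 //; have -> : 1 = 1 `^ p :> R by rewrite powR1.
  by rewrite ge0_ler_powR ?nnegrE // ltW.
by rewrite ler_wpDl // ler_powR // ltW.
Qed.

(** After scaling by [B], the inequality [t ^ p <= 1 + t ^ q] compares the two moments up to a
    factor 2. *)
Lemma powR_integral_le (f : T -> R) (p q B : R) : measurable_fun setT f -> (forall w, 0 <= f w) ->
  0 < p -> p <= q -> 0 < B -> (\int[P]_w (f w `^ q)%:E <= (B `^ q)%:E)%E ->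
  (\int[P]_w (f w `^ p)%:E <= (2 * B `^ p)%:E)%E.
Proof.
move=> mf f0 p0 pq B0 h.
have Bq : 0 < B `^ q by exact: powR_gt0.
have mp r : measurable_fun setT (fun w => f w `^ r).
  exact: (measurableT_comp (measurable_powR _) mf).
pose c := B `^ p / B `^ q; have c0 : 0 <= c by rewrite divr_ge0 ?powR_ge0.
have key w : f w `^ p <= B `^ p + c * f w `^ q.
  have fB r : f w `^ r = B `^ r * (f w / B) `^ r.
    by rewrite -powRM ?divr_ge0 ?(ltW B0) // mulrC divfK // gt_eqF.
  rewrite /c (fB q) mulrA divfK ?gt_eqF // (fB p) -[X in X + _]mulr1 -mulrDr ler_wpM2l ?powR_ge0 //.
  by apply: powR_le_1D; rewrite ?divr_ge0 // ltW.
apply: (@le_trans _ _ (\int[P]_w ((B `^ p)%:E + c%:E * (f w `^ q)%:E))%E).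
  apply: ge0_le_integral => //.
  - by move=> w _; rewrite lee_fin powR_ge0.
  - exact/measurable_EFinP.
  - by apply/measurable_EFinP; apply: measurable_funD => //; exact: measurable_funM.
  - by move=> w _; rewrite -EFinM -EFinD lee_fin.
rewrite ge0_integralD //.
- rewrite ge0_integralZl_EFin //.
  + have -> : (\int[P]_w (B `^ p)%:E = (B `^ p)%:E)%E.
      by rewrite integral_cst // -[RHS]mule1; congr (_ * _)%E; exact: probability_setT.
    rewrite mulr_natl mulr2n EFinD leeD2l // (le_trans (lee_wpmul2l _ h)) ?lee_fin //.
    by rewrite divfK // gt_eqF.
  + by move=> w _; rewrite lee_fin powR_ge0.
  + exact/measurable_EFinP.
- by move=> w _; rewrite lee_fin powR_ge0.
- by move=> w _; rewrite -EFinM lee_fin mulr_ge0 // powR_ge0.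
- by apply/measurable_EFinP; exact: measurable_funM.
Qed.

Lemma poweR_integral_le (f : T -> R) (p B : R) : 1 <= p -> 0 < B ->
  (forall w, 0 <= f w) ->
  (\int[P]_w (f w `^ p)%:E <= (2 * B `^ p)%:E)%E ->
  (poweR (\int[P]_w (f w `^ p)%:E) p^-1 <= (2 * B)%:E)%E.
Proof.
move=> p1 B0 f0 h; have p0 : 0 < p by exact: lt_le_trans p1.
have I0 : (0 <= \int[P]_w (f w `^ p)%:E)%E.
  by apply: integral_ge0 => w _; rewrite lee_fin powR_ge0.
have fin : (\int[P]_w (f w `^ p)%:E = (fine (\int[P]_w (f w `^ p)%:E))%:E)%E.
  by rewrite fineK // ge0_fin_numE // (le_lt_trans h) // ltry.
move: I0 h; rewrite fin; set L := fine _; rewrite !lee_fin => L0 h.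
rewrite ?poweR_EFin ?lee_fin.
have -> : 2 * B = ((2 * B) `^ p) `^ p^-1.
  by rewrite -powRrM mulfV ?gt_eqF // powRr1 // mulr_ge0 // ltW.
rewrite ge0_ler_powR ?nnegrE ?invr_ge0 ?powR_ge0 ?(ltW p0) //.
apply: le_trans h _; rewrite powRM ?(ltW B0) // ler_wpM2r ?powR_ge0 //.
by rewrite -{1}[2]powRr1 // ler_powR // ler1n.
Qed.

Lemma poweR_integral_lt (f : T -> R) (p s : R) : 0 < p -> 0 < s ->
  (poweR (\int[P]_w (f w `^ p)%:E) p^-1 < s%:E)%E ->
  (\int[P]_w (f w `^ p)%:E <= (s `^ p)%:E)%E.
Proof.
move=> p0 s0 h.
have I0 : (0 <= \int[P]_w (f w `^ p)%:E)%E.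
  by apply: integral_ge0 => w _; rewrite lee_fin powR_ge0.
move: I0 h; case: (\int[P]_w _)%E => [L| |] //; last first.
  by move=> _; rewrite poweRyr ?invr_eq0 ?gt_eqF // => /lt_geF; rewrite leey.
rewrite lee_fin poweR_EFin lte_fin => L0 h; rewrite lee_fin.
have -> : L = (L `^ p^-1) `^ p by rewrite -powRrM mulVf ?gt_eqF // powRr1.
by rewrite ge0_ler_powR ?nnegrE ?powR_ge0 ?(ltW p0) ?(ltW h) // ltW.
Qed.

End Powers.

Section SmallExponents.
Context {R : realType}.
Local Notation cost := (cost (R := R)).

Lemma sum_sqr_form_le (I J : finType) (x : I -> R) (u : I -> J -> R) :
  \sum_j (\sum_i x i * u i j) ^+ 2 <= (\sum_i x i ^+ 2) * \sum_i \sum_j u i j ^+ 2.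
Proof.
rewrite [X in _ * X]exchange_big mulr_sumr; apply: ler_sum => j _.
exact: sum_CauchySchwarz.
Qed.

Variables (I J K : finType) (NX : I -> cost) (NY : J -> cost) (a : I -> J -> K -> R).

Lemma chaos_bound_mono m M M' : 0 <= M -> M <= M' ->
  chaos_bound NX NY a m M -> chaos_bound NX NY a m M'.
Proof.
move=> M0 MM [h1 h2 h3 h4 h5].
have q : M ^+ 2 <= M' ^+ 2 by rewrite lerXn2r // nnegrE // (le_trans M0).
split.
- exact: le_trans h1 q.
- by move=> x Bx; exact: le_trans (h2 x Bx) q.
- by move=> y By; exact: le_trans (h3 y By) q.
- by move=> f x f1 Bx; exact: le_trans (h4 f x f1 Bx) MM.
- by move=> x y Bx By; exact: le_trans (h5 x y Bx By) q.
Qed.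

(** [20 = 4 + 4 ^ 2] is the squared Euclidean radius of the ball of radius 4 by [ball_sqr]; two
    balls give [20 ^ 2], hence [20 * r]. *)
Lemma chaos_bound_HS r : 0 <= r -> \sum_i \sum_j \sum_k a i j k ^+ 2 <= r ^+ 2 ->
  chaos_bound NX NY a 4 (20 * r).
Proof.
move=> r0 ar.
have B20 (L : finType) (N : L -> cost) x : ball N 4 x -> \sum_i x i ^+ 2 <= 20.
  by move/ball_sqr; lra.
have s0 := sqr_ge0 r.
have r20 : 20 * r ^+ 2 <= (20 * r) ^+ 2 by rewrite exprMn; lra.
have X20 x : ball NX 4 x -> \sum_j \sum_k (\sum_i x i * a i j k) ^+ 2 <= 20 * r ^+ 2.
  move=> Bx; have := sum_sqr_form_le x (fun i (p : J * K) => a i p.1 p.2).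
  rewrite sum_pair; under [X in _ <= _ * X]eq_bigr do rewrite sum_pair.
  move/le_trans; apply; apply: ler_pM (B20 _ _ _ Bx) ar.
    exact: sum_sqr_ge0.
  by do 3 (apply: sumr_ge0 => ? _); exact: sqr_ge0.
split.
- by apply: le_trans ar _; rewrite exprMn; lra.
- by move=> x Bx; exact: le_trans (X20 x Bx) r20.
- move=> y By; apply: le_trans r20.
  apply: (@le_trans _ _ (\sum_i 20 * \sum_j \sum_k a i j k ^+ 2)).
    apply: ler_sum => i _; apply: le_trans (sum_sqr_form_le y (a i)) _.
    rewrite ler_wpM2r ?(B20 _ _ _ By) //.
    by do 2 (apply: sumr_ge0 => ? _); exact: sqr_ge0.
  by rewrite -mulr_sumr ler_wpM2l.
- move=> f x f1 Bx; apply: le_trans (ler_norm _) _; apply: le_trans (l2_dot _ _) _.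
  apply: ler_pM; rewrite ?l2_ge0 //.
    have := B20 _ _ _ Bx; rewrite -l2_sqr; have := l2_ge0 x; nra.
  rewrite -(ler_pXn2r (_ : (0 < 2)%N)) ?nnegrE ?l2_ge0 // l2_sqr; apply: le_trans ar.
  apply: ler_sum => i _; rewrite l2_sqr; apply: ler_sum => j _.
  apply: le_trans (sum_CauchySchwarz _ _ _) _; rewrite ler_piMl ?sum_sqr_ge0 //.
- move=> x y Bx By.
  have -> : \sum_k (\sum_i \sum_j x i * y j * a i j k) ^+ 2 =
      \sum_k (\sum_j y j * \sum_i x i * a i j k) ^+ 2.
    apply: eq_bigr => k _; congr (_ ^+ 2); rewrite exchange_big; apply: eq_bigr => j _.
    by rewrite mulr_sumr; apply: eq_bigr => i _; ring.
  apply: le_trans (sum_sqr_form_le _ _) _.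
  apply: le_trans (_ : 20 * (20 * r ^+ 2) <= _); last by rewrite exprMn; lra.
  apply: ler_pM (B20 _ _ _ By) (X20 x Bx); first exact: sum_sqr_ge0.
  by do 2 (apply: sumr_ge0 => ? _); exact: sqr_ge0.
Qed.

End SmallExponents.

(** * Comparison with the five terms *)

Section HilbertChaos.
Context {R : realType} {H : normedModType R} (ip : H -> H -> R).
Hypothesis Hip : inner_product ip.
Context {d : measure_display} {T : measurableType d} (P : probability T R).
Variables (n : nat) (X Y : 'I_n -> T -> R).
Hypotheses (mX : forall i, measurable_fun setT (X i)) (mY : forall j, measurable_fun setT (Y j)).
Hypothesis indep : mutually_independent P (join_family X Y).
Hypotheses (sX : forall i, symmetric_rv P (X i)) (sY : forall j, symmetric_rv P (Y j)).
Hypotheses (lX : forall i, log_concave_tails P (X i)) (lY : forall j, log_concave_tails P (Y j)).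
Hypotheses (nX : forall i, tail_normalized P (X i)) (nY : forall j, tail_normalized P (Y j)).
Variables (a : 'I_n -> 'I_n -> H) (p : R).
Hypothesis p1 : 1 <= p.

Variables (K : finType) (e : K -> H).
Hypothesis oe : orthonormal ip e.
Hypothesis ae : forall i j, a i j = \sum_k ip (a i j) (e k) *: e k.

Local Notation cKH := (@cKH R).
Local Notation kn := (@kn R).
Local Notation NX := (fun i => tail_cost (mX i) (lX i) (nX i)).
Local Notation NY := (fun j => tail_cost (mY j) (lY j) (nY j)).
Local Notation A := (fun i j k => ip (a i j) (e k)).

Let S w := \sum_i \sum_j (X i w * Y j w) *: a i j.
Let SX x w := \sum_i \sum_j (x i * Y j w) *: a i j.
Let SY y w := \sum_i \sum_j (X i w * y j) *: a i j.
Let b (f : H -> R) i := Num.sqrt (\sum_j f (a i j) ^+ 2).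
Let T2 := ereal_sup [set expect_norm P (SX x) | x in ballX P X p].
Let T3 := ereal_sup [set expect_norm P (SY y) | y in ballX P Y p].
Let T4 := ereal_sup [set normXp P X p (b f) | f in dual_ball (H := H)].
Let T5 := ereal_sup [set normXYp P X Y p (fun i j => f (a i j)) | f in dual_ball (H := H)].

Let p0 : 0 < p. Proof. exact: lt_le_trans p1. Qed.
Let cKH0 := @cKH_gt0 R.

Lemma norm_chaosE (c : 'I_n -> 'I_n -> R) :
  `|\sum_i \sum_j c i j *: a i j| = l2 (fun k => \sum_i \sum_j c i j * A i j k).
Proof.
rewrite -(norm_orthonormal Hip _ oe); congr `|_|.
transitivity (\sum_i \sum_j \sum_k (c i j * A i j k) *: e k).
  apply: eq_bigr => i _; apply: eq_bigr => j _; rewrite {1}ae scaler_sumr.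
  by apply: eq_bigr => k _; rewrite scalerA.
rewrite [RHS](eq_bigr (fun k => \sum_i \sum_j (c i j * A i j k) *: e k)) => [|k _].
  by rewrite [RHS]exchange_big; apply: eq_bigr => i _; rewrite [RHS]exchange_big.
by rewrite scaler_suml; apply: eq_bigr => i _; rewrite scaler_suml.
Qed.

Lemma dual_ballE f i j : dual_ball f -> f (a i j) = \sum_k f (e k) * A i j k.
Proof.
by move=> df; rewrite {1}ae (dual_ball_sum _ _ df); apply: eq_bigr => k _; rewrite mulrC.
Qed.

Lemma dual_of_coords (c : K -> R) : \sum_k c k ^+ 2 <= 1 ->
  exists2 f, dual_ball (H := H) f & forall i j, f (a i j) = \sum_k c k * A i j k.
Proof.
move=> c1; exists (ip ^~ (\sum_k c k *: e k)); first exact: dual_ball_ip.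
move=> i j; case: (Hip) => -> _; rewrite (ip_sumZl Hip); apply: eq_bigr => k _.
by case: (Hip) => ->.
Qed.

Let rX x := l2 (fun q : 'I_n * K => \sum_i x i * A i q.1 q.2).
Let rY y := l2 (fun q : 'I_n * K => \sum_j y j * A q.1 j q.2).

Let rXE x : \sum_j \sum_k (\sum_i x i * A i j k) ^+ 2 = rX x ^+ 2.
Proof. by rewrite l2_sqr sum_pair. Qed.

Let rYE y : \sum_i \sum_k (\sum_j y j * A i j k) ^+ 2 = rY y ^+ 2.
Proof. by rewrite l2_sqr sum_pair. Qed.

Lemma expect_SX x : ((cKH * rX x)%:E <= expect_norm P (SX x) <= (kn * rX x)%:E)%E.
Proof.
rewrite /expect_norm /SX (_ : (fun w => _) = (fun w =>
  (l2 (fun k => \sum_i \sum_j x i * Y j w * A i j k))%:E)).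
  exact: (linearY_first_moment mX mY indep sX sY lX lY nX nY (l2_ge0 _) (rXE x)).
by apply/funext => w; rewrite norm_chaosE.
Qed.

Lemma expect_SY y : ((cKH * rY y)%:E <= expect_norm P (SY y) <= (kn * rY y)%:E)%E.
Proof.
rewrite /expect_norm /SY (_ : (fun w => _) = (fun w =>
  (l2 (fun k => \sum_i \sum_j X i w * y j * A i j k))%:E)).
  exact: (linearX_first_moment mX mY indep sX sY lX lY nX nY (l2_ge0 _) (rYE y)).
by apply/funext => w; rewrite norm_chaosE.
Qed.

Lemma expect_SE : expect_norm P S =
  (\int[P]_w (l2 (fun k => \sum_i \sum_j X i w * Y j w * A i j k))%:E)%E.
Proof. by apply: eq_integral => w _; rewrite norm_chaosE. Qed.

Lemma HS_le_expect_S : exists r, [/\ 0 <= r, \sum_i \sum_j \sum_k A i j k ^+ 2 = r ^+ 2 &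
  ((cKH * r)%:E <= expect_norm P S)%E].
Proof.
exists (l2 (fun q : 'I_n * ('I_n * K) => A q.1 q.2.1 q.2.2)).
have E : \sum_i \sum_j \sum_k A i j k ^+ 2 =
    l2 (fun q : 'I_n * ('I_n * K) => A q.1 q.2.1 q.2.2) ^+ 2.
  by rewrite l2_sqr sum_pair; apply: eq_bigr => i _; rewrite sum_pair.
split=> //; first exact: l2_ge0.
rewrite expect_SE.
exact: (chaos_first_moment mX mY indep sX sY lX lY nX nY (l2_ge0 _) E).
Qed.

Lemma cKH_le1 : cKH <= 1.
Proof.
have k2 : 1 <= kn ^+ 2 by rewrite exprn_ege1 // kn_ge1.
rewrite /cKH ler_pdivrMr; last by lra.
apply: le_trans (_ : 1 <= _); last by lra.
by rewrite !exprn_ile1 ?exprn_ge0 ?invr_ge0 // invf_le1 ?ler1n.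
Qed.

(** Since [m <= 5 p], a point of the ball of radius [m] divided by 5 lies in that of radius [p]; two
    balls cost 25. Dividing by [cKH] converts mean norms into Hilbert-Schmidt norms. *)
Lemma chaos_bound_of_terms rho m : 0 < rho -> m%:R <= 5 * p ->
  (expect_norm P S <= rho%:E)%E -> (T2 <= rho%:E)%E -> (T3 <= rho%:E)%E ->
  (T4 <= rho%:E)%E -> (T5 <= rho%:E)%E -> chaos_bound NX NY A m (25 * (rho / cKH)).
Proof.
move=> rho0 mp h1 h2 h3 h4 h5.
pose q := rho / cKH; have q0 : 0 < q by rewrite divr_gt0.
have qK : q * cKH = rho by rewrite /q divfK // gt_eqF.
rewrite -/q; move: q q0 qK => q q0 qK.
have rq : rho <= q by rewrite -qK ler_piMr ?cKH_le1 // ltW.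
have q5 : 25 * q ^+ 2 <= (25 * q) ^+ 2 by rewrite exprMn; have := sqr_ge0 q; lra.
have sc (N : 'I_n -> cost (R := R)) x : ball N m%:R x -> ball N p (fun i => 5^-1 * x i).
  by move=> Bx; apply: ball_scale (ball_le mp Bx); lra.
have le_q r : 0 <= r -> ((cKH * r)%:E <= rho%:E)%E -> r ^+ 2 <= q ^+ 2.
  rewrite lee_fin => r0 h; rewrite lerXn2r ?nnegrE ?(ltW q0) //.
  by rewrite -(ler_pM2r cKH0) qK mulrC.
split.
- have [r [r0 -> h]] := HS_le_expect_S.
  have hr := le_q r r0 (le_trans h h1); apply: le_trans q5; have q2 := sqr_ge0 q; lra.
- move=> x Bx; apply: le_trans q5.
  have -> : \sum_j \sum_k (\sum_i x i * A i j k) ^+ 2 = 25 * rX (fun i => 5^-1 * x i) ^+ 2.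
    rewrite -rXE mulr_sumr; apply: eq_bigr => j _; rewrite mulr_sumr; apply: eq_bigr => k _.
    rewrite [X in 25 * X ^+ 2](eq_bigr (fun i => 5^-1 * (x i * A i j k))) => [|i _]; last by rewrite mulrA.
    by rewrite -mulr_sumr; field.
  rewrite ler_wpM2l //; apply: le_q; first exact: l2_ge0.
  have /andP[h _] := expect_SX (fun i => 5^-1 * x i); apply: le_trans h _.
  apply: le_trans h2; apply: ereal_sup_ubound; exists (fun i => 5^-1 * x i) => //.
  by apply/ballXE; exact: sc.
- move=> y By; apply: le_trans q5.
  have -> : \sum_i \sum_k (\sum_j y j * A i j k) ^+ 2 = 25 * rY (fun i => 5^-1 * y i) ^+ 2.
    rewrite -rYE mulr_sumr; apply: eq_bigr => i _; rewrite mulr_sumr; apply: eq_bigr => k _.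
    rewrite [X in 25 * X ^+ 2](eq_bigr (fun j => 5^-1 * (y j * A i j k))) => [|j _]; last by rewrite mulrA.
    by rewrite -mulr_sumr; field.
  rewrite ler_wpM2l //; apply: le_q; first exact: l2_ge0.
  have /andP[h _] := expect_SY (fun i => 5^-1 * y i); apply: le_trans h _.
  apply: le_trans h3; apply: ereal_sup_ubound; exists (fun i => 5^-1 * y i) => //.
  by apply/ballXE; exact: sc.
- move=> c x c1 Bx; have [f df fE] := dual_of_coords c1.
  have : ((\sum_i b f i * (5^-1 * x i))%:E <= rho%:E)%E.
    apply: le_trans h4; apply: le_trans (_ : normXp P X p (b f) <= _)%E; last first.
      by apply: ereal_sup_ubound; exists f.
    apply: ereal_sup_ubound; exists (fun i => 5^-1 * x i) => //.
    by apply/ballXE; exact: sc.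
  rewrite lee_fin; have -> : \sum_i b f i * (5^-1 * x i) = 5^-1 *
      \sum_i x i * l2 (fun j => \sum_k c k * A i j k).
    rewrite mulr_sumr; apply: eq_bigr => i _; rewrite mulrCA mulrA -mulrA; congr (_ * _).
    by rewrite mulrC; congr (_ * Num.sqrt _); apply: eq_bigr => j _; rewrite fE.
  by lra.
- move=> x y Bx By.
  suff h : l2 (fun k => \sum_i \sum_j x i * y j * A i j k) <= 25 * q.
    by rewrite -l2_sqr lerXn2r ?nnegrE ?l2_ge0 // mulr_ge0 // ltW.
  apply: l2_dual => [|c c1]; first by rewrite mulr_ge0 // ltW.
  have key (z : 'I_n -> R) : ball NX m%:R z ->
      \sum_k c k * (\sum_i \sum_j z i * y j * A i j k) <= 25 * q.
    move=> Bz; have [f df fE] := dual_of_coords c1.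
    have : ((\sum_i \sum_j f (a i j) * (5^-1 * z i) * (5^-1 * y j))%:E <= rho%:E)%E.
      apply: le_trans h5; apply: le_trans (_ : normXYp P X Y p (fun i j => f (a i j)) <= _)%E; last first.
        by apply: ereal_sup_ubound; exists f.
      apply: ereal_sup_ubound; exists (fun i => 5^-1 * z i), (fun j => 5^-1 * y j).
      by split; [apply/ballXE; exact: sc|split=> //; apply/ballXE; exact: sc].
    rewrite lee_fin.
    have -> : \sum_i \sum_j f (a i j) * (5^-1 * z i) * (5^-1 * y j) =
        25^-1 * \sum_k c k * (\sum_i \sum_j z i * y j * A i j k).
      rewrite (eq_bigr (fun i => \sum_j \sum_k 25^-1 * (c k * (z i * y j * A i j k)))) => [|i _].
        under [X in 25^-1 * X]eq_bigr => k _ do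
          (rewrite mulr_sumr; under eq_bigr => i _ do rewrite mulr_sumr).
        rewrite [X in 25^-1 * X]exchange_big mulr_sumr; apply: eq_bigr => i _.
        rewrite [X in 25^-1 * X]exchange_big mulr_sumr; apply: eq_bigr => j _.
        by rewrite mulr_sumr.
      apply: eq_bigr => j _; rewrite fE !mulr_suml; apply: eq_bigr => k _; by field.
    by lra.
  rewrite ler_norml key // andbT lerNl.
  (* The bound from below is [key] at [- x], which is also in the ball. *)
  have := key (fun i => - x i); have -> : \sum_k c k * (\sum_i \sum_j - x i * y j * A i j k) =
      - \sum_k c k * (\sum_i \sum_j x i * y j * A i j k).
    rewrite -sumrN; apply: eq_bigr => k _; rewrite -mulrN -sumrN; congr (_ * _).
    by apply: eq_bigr => i _; rewrite -sumrN; apply: eq_bigr => j _; rewrite !mulNr.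
  apply; have := ballM (t := fun=> -1) _ Bx.
  have -> : (fun i => -1 * x i) = (fun i => - x i) by apply/funext => i; rewrite mulN1r.
  by apply => i; rewrite normrN1.
Qed.

Lemma terms_of_chaos_bound M m : 0 <= M -> p <= 2 * m%:R -> chaos_bound NX NY A m M ->
  [/\ (T2 <= (2 * kn * M)%:E)%E, (T3 <= (2 * kn * M)%:E)%E,
      (T4 <= (2 * M)%:E)%E & (T5 <= (4 * M)%:E)%E].
Proof.
move=> M0 pm [_ hX hY hw hXY]; have kn0 : 0 <= kn := le_trans ler01 (@kn_ge1 R).
have sc (N : 'I_n -> cost (R := R)) x : ball N p x -> ball N m%:R (fun i => 2^-1 * x i).
  by move=> Bx; apply: ball_scale (ball_le pm Bx); lra.
split; apply: ge_ereal_sup => r [] .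
- move=> x Bx <-; have {}Bx := (ballXE mX lX nX p x).1 Bx.
  have /andP[_ h] := expect_SX x; apply: le_trans h _.
  rewrite lee_fin (_ : 2 * kn * M = kn * (2 * M)); last by ring.
  apply: ler_wpM2l => //.
  rewrite -(ler_pXn2r (_ : (0 < 2)%N)) ?nnegrE ?l2_ge0 ?mulr_ge0 // -rXE.
  have -> : \sum_j \sum_k (\sum_i x i * A i j k) ^+ 2 =
      2 ^+ 2 * \sum_j \sum_k (\sum_i 2^-1 * x i * A i j k) ^+ 2.
    rewrite mulr_sumr; apply: eq_bigr => j _; rewrite mulr_sumr; apply: eq_bigr => k _.
    rewrite -exprMn mulr_sumr; congr (_ ^+ 2); apply: eq_bigr => i _.
    by field.
  by rewrite exprMn ler_wpM2l // ?exprn_ge0 //; apply: hX; exact: sc.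
- move=> y By <-; have {}By := (ballXE mY lY nY p y).1 By.
  have /andP[_ h] := expect_SY y; apply: le_trans h _.
  rewrite lee_fin (_ : 2 * kn * M = kn * (2 * M)); last by ring.
  apply: ler_wpM2l => //.
  rewrite -(ler_pXn2r (_ : (0 < 2)%N)) ?nnegrE ?l2_ge0 ?mulr_ge0 // -rYE.
  have -> : \sum_i \sum_k (\sum_j y j * A i j k) ^+ 2 =
      2 ^+ 2 * \sum_i \sum_k (\sum_j 2^-1 * y j * A i j k) ^+ 2.
    rewrite mulr_sumr; apply: eq_bigr => i _; rewrite mulr_sumr; apply: eq_bigr => k _.
    rewrite -exprMn mulr_sumr; congr (_ ^+ 2); apply: eq_bigr => j _.
    by field.
  by rewrite exprMn ler_wpM2l // ?exprn_ge0 //; apply: hY; exact: sc.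
- move=> f df <-; apply: ge_ereal_sup => _ [x Bx <-]; have {}Bx := (ballXE mX lX nX p x).1 Bx.
  have := hw _ _ (dual_ball_coords Hip oe df) (sc _ _ Bx); rewrite lee_fin.
  have -> : \sum_i 2^-1 * x i * l2 (fun j => \sum_k f (e k) * A i j k) =
      2^-1 * \sum_i b f i * x i; last by lra.
  rewrite mulr_sumr; apply: eq_bigr => i _; rewrite -mulrA; congr (_ * _).
  by rewrite mulrC; congr (Num.sqrt _ * _); apply: eq_bigr => j _; rewrite dual_ballE.
- move=> f df <-; apply: ge_ereal_sup => _ [x [y [Bx [By ->]]]].
  have {}Bx := (ballXE mX lX nX p x).1 Bx; have {}By := (ballXE mY lY nY p y).1 By.
  rewrite lee_fin.
  have -> : \sum_i \sum_j f (a i j) * x i * y j = 4 * \sum_k f (e k) *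
      (\sum_i \sum_j (2^-1 * x i) * (2^-1 * y j) * A i j k).
    rewrite (eq_bigr (fun i => \sum_j \sum_k f (e k) * A i j k * x i * y j)) => [|i _].
      rewrite mulr_sumr.
      under [RHS]eq_bigr => k _ do
        (rewrite !mulr_sumr; under eq_bigr => i _ do rewrite !mulr_sumr).
      rewrite [RHS]exchange_big; apply: eq_bigr => i _.
      rewrite [RHS]exchange_big; apply: eq_bigr => j _; apply: eq_bigr => k _.
      by field.
    by apply: eq_bigr => j _; rewrite dual_ballE // !mulr_suml.
  rewrite ler_wpM2l // (le_trans (ler_norm _)) // (le_trans (l2_dot _ _)) //.
  rewrite -[leRHS]mul1r ler_pM ?l2_ge0 //.
    by rewrite -(@sqrtr1 R) ler_sqrt // (dual_ball_coords Hip oe df).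
  rewrite -(ler_pXn2r (_ : (0 < 2)%N)) ?nnegrE ?l2_ge0 // l2_sqr.
  by apply: hXY; exact: sc.
Qed.

(** [3] comes from [2 s ^ m < (3 s) ^ m], and [40] from the 20 of [chaos_bound_HS] times the bound
    [2 s] on the mean norm. In [cLower], [4 kn + 6] collects the coefficients of
    [terms_of_chaos_bound]. *)
Definition cM : R := 3 * cLO + 40 / cKH.
Definition cUpper : R := 2 * cUP * (25 / cKH).
Definition cLower : R := 2 + (4 * kn + 6) * cM.

Let rhs := (expect_norm P S + T2 + T3 + T4 + T5)%E.

Lemma cUpper_gt0 : 0 < cUpper.
Proof.
have c1 := @cHL_ge1 R; have c2 := @cCS_ge1 R.
have cU : 0 < @cUP R.
  rewrite /cUP; apply: mulr_gt0; [by lra|by lra].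
by apply: mulr_gt0; [lra|exact: divr_gt0].
Qed.

Lemma cM_gt0 : 0 < cM.
Proof.
have [c1 _ _ _ _] := @cLO_ge R; have c2 : 0 < 40 / cKH by exact: divr_gt0.
by rewrite /cM; lra.
Qed.

Lemma cLower_gt0 : 0 < cLower.
Proof.
have c1 := cM_gt0; have c2 := @kn_ge1 R.
by rewrite /cLower; apply: addr_gt0 => //; apply: mulr_gt0 => //; lra.
Qed.

Lemma measurable_norm_S : measurable_fun setT (fun w => `|S w|).
Proof.
have := seq_continuous_measurable mX mY
  (@affine_chaos_continuous R n K 1 1 (fun=> 0) (fun=> 0) A 1).
congr measurable_fun; apply/funext => w; rewrite norm_chaosE /affine_chaos expr1.
congr l2; apply/funext => k; apply: eq_bigr => i _; apply: eq_bigr => j _.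
by rewrite !mul1r !addr0.
Qed.

Lemma ballX0 (Z : 'I_n -> T -> R) : ballX P Z p (fun=> 0).
Proof.
rewrite /ballX /= big1 ?lee_fin ?(ltW p0) // => i _.
by rewrite /hatN normr0 ler01 expr0n.
Qed.

Lemma dual_ball0 : dual_ball (H := H) (fun=> 0).
Proof. by split=> [c x y|x]; rewrite ?mulr0 ?addr0 ?normr0. Qed.

Lemma expect_norm_ge0 (Z : T -> H) : (0 <= expect_norm P Z)%E.
Proof. by apply: integral_ge0 => w _; rewrite lee_fin. Qed.

Lemma terms_ge0 : [/\ (0 <= T2)%E, (0 <= T3)%E, (0 <= T4)%E & (0 <= T5)%E].
Proof.
split.
- apply: le_trans (expect_norm_ge0 (SX (fun=> 0))) _.
  by apply: ereal_sup_ubound; exists (fun=> 0) => //; exact: ballX0.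
- apply: le_trans (expect_norm_ge0 (SY (fun=> 0))) _.
  by apply: ereal_sup_ubound; exists (fun=> 0) => //; exact: ballX0.
- apply: (@le_trans _ _ (normXp P X p (b (fun=> 0)))).
    apply: ereal_sup_ubound; exists (fun=> 0); first exact: ballX0.
    by rewrite big1 // => i _; rewrite mulr0.
  by apply: ereal_sup_ubound; exists (fun=> 0) => //; exact: dual_ball0.
- apply: (@le_trans _ _ (normXYp P X Y p (fun _ _ => 0))).
    apply: ereal_sup_ubound; exists (fun=> 0), (fun=> 0); do 2 (split; first exact: ballX0).
    by rewrite big1 // => i _; rewrite big1 // => j _; rewrite !mulr0.
  by apply: ereal_sup_ubound; exists (fun=> 0) => //; exact: dual_ball0.
Qed.

Lemma le_sum5 (t1 t2 t3 t4 t5 : \bar R) :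
  (0 <= t1)%E -> (0 <= t2)%E -> (0 <= t3)%E -> (0 <= t4)%E -> (0 <= t5)%E ->
  let t := (t1 + t2 + t3 + t4 + t5)%E in
  [/\ (t1 <= t)%E, (t2 <= t)%E, (t3 <= t)%E, (t4 <= t)%E & (t5 <= t)%E].
Proof.
move=> h1 h2 h3 h4 h5 t.
have a2 : (0 <= t1 + t2)%E by exact: adde_ge0.
have a3 : (0 <= t1 + t2 + t3)%E by exact: adde_ge0.
have a4 : (0 <= t1 + t2 + t3 + t4)%E by exact: adde_ge0.
have b4 : (t1 + t2 + t3 + t4 <= t)%E by exact: leeDl.
have b3 : (t1 + t2 + t3 <= t)%E by apply: le_trans b4; exact: leeDl.
have b2 : (t1 + t2 <= t)%E by apply: le_trans b3; exact: leeDl.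
split; last exact: leeDr.
- by apply: le_trans b2; exact: leeDl.
- by apply: le_trans b2; exact: leeDr.
- by apply: le_trans b3; exact: leeDr.
- by apply: le_trans b4; exact: leeDr.
Qed.

(* [m] is an integer with [p <= m <= 5 p], so that the ball of radius [m] is within a factor 5
   of the ball of radius [p]. *)
Lemma pnorm_le : (pnorm P S p <= cUpper%:E * rhs)%E.
Proof.
have [h2 h3 h4 h5] := terms_ge0; have h1 := expect_norm_ge0 S.
have c0 := cUpper_gt0.
have r0 : (0 <= rhs)%E by rewrite /rhs; do 4 apply: adde_ge0 => //.
have [le1 le2 le3 le4 le5] : [/\ (expect_norm P S <= rhs)%E, (T2 <= rhs)%E, (T3 <= rhs)%E,
    (T4 <= rhs)%E & (T5 <= rhs)%E].
  exact: le_sum5.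
move: r0 le1 le2 le3 le4 le5; move: rhs => [r| |] // r0 le1 le2 le3 le4 le5; last first.
  by rewrite gt0_muley ?lte_fin // leey.
(* The excess [eps / cUpper] keeps [rho] positive when the right side vanishes. *)
apply/lee_addgt0Pr => eps eps0; rewrite -EFinM -EFinD; pose rho := r + eps / cUpper.
have rr : 0 <= r by rewrite -lee_fin.
have rho0 : 0 < rho by rewrite /rho ltr_wpDl // divr_gt0.
have rrho : (r%:E <= rho%:E)%E by rewrite lee_fin lerDl ltW // divr_gt0.
have -> : cUpper * r + eps = cUpper * rho by rewrite /rho mulrDr [X in _ = _ + X]mulrC divfK // gt_eqF.
pose m := (Num.truncn p + 4)%N; have m4 : (4 <= m)%N by rewrite leq_addl.
have /andP[tp1 tp2] := truncn_itv (ltW p0).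
have mE : m%:R = (Num.truncn p)%:R + 4 :> R by rewrite natrD.
have mp : m%:R <= 5 * p by rewrite mE; move: tp1 p1; lra.
have pm : p <= m%:R by rewrite mE; move: tp2; rewrite -natr1; lra.
have hM := chaos_bound_of_terms rho0 mp (le_trans le1 rrho) (le_trans le2 rrho)
   (le_trans le3 rrho) (le_trans le4 rrho) (le_trans le5 rrho).
have M0 : 0 < 25 * (rho / cKH) by rewrite mulr_gt0 // divr_gt0.
have := chaos_moment_le indep sX sY m4 M0 hM.
pose B := cUP * (25 * (rho / cKH)); rewrite -/B.
have BE : 2 * B = cUpper * rho by rewrite /B /cUpper; field; rewrite gt_eqF.
have B0 : 0 < B by have := mulr_gt0 c0 rho0; rewrite -BE pmulr_rgt0.
move=> hm; rewrite -BE; apply: poweR_integral_le => //.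
apply: (powR_integral_le measurable_norm_S (q := m%:R)) => //.
rewrite powR_mulrn; last exact: ltW.
rewrite (eq_integral (fun w => (l2 (fun k => \sum_i \sum_j X i w * Y j w * A i j k) ^+ m)%:E)) //.
by move=> w _; rewrite powR_mulrn // norm_chaosE.
Qed.

(* For [p < 4] all five terms are comparable to the Hilbert-Schmidt norm, hence to the mean. *)
Lemma pnorm_ge : (rhs <= cLower%:E * pnorm P S p)%E.
Proof.
have c0 := cLower_gt0; have M0 := cM_gt0; have kn1 := @kn_ge1 R.
have l0 : (0 <= pnorm P S p)%E by exact: poweR_ge0.
case El : (pnorm P S p) l0 => [l| |] // l0; last by rewrite gt0_muley ?lte_fin // leey.
apply/lee_addgt0Pr => eps eps0; rewrite -EFinM -EFinD; pose s := l + eps / cLower.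
have ll : 0 <= l by rewrite -lee_fin.
have s0 : 0 < s by rewrite /s ltr_wpDl // divr_gt0.
have ls : (pnorm P S p < s%:E)%E by rewrite El lte_fin ltrDl divr_gt0.
have -> : cLower * l + eps = cLower * s by rewrite /s mulrDr [X in _ = _ + X]mulrC divfK // gt_eqF.
have hs := poweR_integral_lt p0 s0 ls.
have S0 w : 0 <= `|S w| by [].
have T1s : (expect_norm P S <= (2 * s)%:E)%E.
  have := powR_integral_le measurable_norm_S S0 ltr01 p1 s0 hs.
  rewrite powRr1 ?(ltW s0) //; apply: le_trans.
  by rewrite le_eqVlt; apply/orP; left; apply/eqP; apply: eq_integral => w _; rewrite powRr1.
have [m pm hm] : exists2 m : nat, p <= 2 * m%:R & chaos_bound NX NY A m (cM * s).
  case: (leP 4 p) => p4.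
    have /andP[tp1 tp2] := truncn_itv (ltW p0); pose m := Num.truncn p.
    have m4 : (4 <= m)%N by rewrite truncn_ge_nat // ltW.
    have mR : 4 <= m%:R :> R by rewrite (ler_nat R 4 m).
    exists m; first by move: tp2; rewrite -natr1 -/m; lra.
    have m0 : 0 < m%:R :> R by lra.
    have hm := powR_integral_le measurable_norm_S S0 m0 tp1 s0 hs.
    (* The passage from [p] to its integer part leaves a factor 2; enlarging [s] to [3 s] absorbs it
       and gives the strict inequality needed by [chaos_moment_ge]. *)
    have s3 : 0 < 3 * s by rewrite mulr_gt0.
    have hlt : (\int[P]_w (l2 (fun k => \sum_i \sum_j X i w * Y j w * A i j k) ^+ m)%:E <
        ((3 * s) ^+ m)%:E)%E.
      apply: le_lt_trans (le_lt_trans hm _).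
        by rewrite le_eqVlt; apply/orP; left; apply/eqP; apply: eq_integral => w _;
          rewrite powR_mulrn // norm_chaosE.
      rewrite lte_fin powR_mulrn ?(ltW s0) // exprMn ltr_pM2r ?exprn_gt0 //.
      apply: lt_le_trans (_ : 3 ^+ 1 <= _); first by rewrite expr1; lra.
      by rewrite ler_weXn2l ?(leq_trans _ m4) //; lra.
    have [c1 _ _ _ _] := @cLO_ge R.
    apply: chaos_bound_mono (chaos_moment_ge mX mY indep sX sY lX lY nX nY m4 s3 hlt).
      by rewrite mulr_ge0 // ?(ltW s3) // (le_trans ler01).
    have c2 : 0 <= 40 / cKH * s by apply: ltW; apply: mulr_gt0 => //; exact: divr_gt0.
    by rewrite /cM mulrDl; lra.
  exists 4%N; first by lra.
  have [r [r0 rE hr]] := HS_le_expect_S.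
  have rs : r <= 2 * s / cKH.
    by rewrite ler_pdivlMr // mulrC; have := le_trans hr T1s; rewrite lee_fin.
  apply: chaos_bound_mono (chaos_bound_HS NX NY r0 _); first by rewrite mulr_ge0.
    have [c1 _ _ _ _] := @cLO_ge R.
    have c2 : 0 <= 3 * cLO * s by rewrite mulr_ge0 ?(ltW s0) //; lra.
    have -> : cM * s = 3 * cLO * s + 20 * (2 * s / cKH) by rewrite /cM; field; rewrite gt_eqF.
    by lra.
  by rewrite rE.
have Ms : 0 <= cM * s by rewrite mulr_ge0 // ltW.
have [t2 t3 t4 t5] := terms_of_chaos_bound Ms pm hm.
apply: le_trans (leeD (leeD (leeD (leeD T1s t2) t3) t4) t5) _.
by rewrite -!EFinD lee_fin /cLower; lra.
Qed.

End HilbertChaos.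

Unset Implicit Arguments. Set Strict Implicit. Set Printing Implicit Defensive.

Theorem theorem2p5 (R : realType) :
  exists C : R, 0 < C /\
  forall (H : completeNormedModType R) (ip : H -> H -> R),
  inner_product ip ->
  forall (d : measure_display) (T : measurableType d) (P : probability T R)
    (n : nat) (X Y : 'I_n -> T -> R),
  (1 <= n)%N ->
  (forall i, measurable_fun setT (X i)) ->
  (forall j, measurable_fun setT (Y j)) ->
  mutually_independent P (join_family X Y) ->
  (forall i, symmetric_rv P (X i)) ->
  (forall j, symmetric_rv P (Y j)) ->
  (forall i, log_concave_tails P (X i)) ->
  (forall j, log_concave_tails P (Y j)) ->
  (forall i, tail_normalized P (X i)) ->
  (forall j, tail_normalized P (Y j)) ->
  forall (a : 'I_n -> 'I_n -> H) (p : R), 1 <= p ->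
  let S := fun w => \sum_(i < n) \sum_(j < n) (X i w * Y j w) *: a i j in
  let lhs := pnorm P S p in
  let rhs :=
    (expect_norm P S
     + ereal_sup [set expect_norm P
          (fun w => (\sum_(i < n) \sum_(j < n) (x i * Y j w) *: a i j)%R)
          | x in ballX P X p]
     + ereal_sup [set expect_norm P
          (fun w => (\sum_(i < n) \sum_(j < n) (X i w * y j) *: a i j)%R)
          | y in ballX P Y p]
     + ereal_sup [set normXp P X p
          (fun i => Num.sqrt (\sum_(j < n) f (a i j) ^+ 2)%R) | f in dual_ball (H:=H)]
     + ereal_sup [set normXYp P X Y p (fun i j => f (a i j)) | f in dual_ball (H:=H)])%E in
  ((C^-1)%:E * lhs <= rhs)%E /\ (rhs <= C%:E * lhs)%E.
Proof.
have u0 := @cUpper_gt0 R; have l0 := @cLower_gt0 R.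
exists (cUpper + cLower); split; first exact: addr_gt0.
move=> H ip Hip d T P n X Y _ mX mY indep sX sY lX lY nX nY a p p1 S lhs rhs.
have [K [e [oe ae]]] := orthonormal_coordinates Hip [seq a i j | i <- enum 'I_n, j <- enum 'I_n].
have {}ae i j : a i j = \sum_k ip (a i j) (e k) *: e k.
  by apply: ae; apply/allpairsP; exists (i, j); rewrite !mem_enum.
have up : (lhs <= cUpper%:E * rhs)%E := pnorm_le Hip mX mY indep sX sY lX lY nX nY p1 oe ae.
have low : (rhs <= cLower%:E * lhs)%E := pnorm_ge Hip mX mY indep sX sY lX lY nX nY p1 oe ae.
have lhs0 : (0 <= lhs)%E by exact: poweR_ge0.
have rhs0 : (0 <= rhs)%E.
  have [h2 h3 h4 h5] := terms_ge0 P X Y a p1.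
  by do 4 apply: adde_ge0 => //; exact: expect_norm_ge0.
split; last by apply: (@le_trans _ _ (cLower%:E * lhs)%E) => //; rewrite lee_wpmul2r // lee_fin lerDr ltW.
rewrite lee_pdivrMl; last exact: addr_gt0.
apply: (@le_trans _ _ (cUpper%:E * rhs)%E) => //.
by rewrite lee_wpmul2r // lee_fin lerDl ltW.
Qed.
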